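(* Let $P_0$ be a probability distribution on $\mathbb{R}$ with bounded support. Then for all $\lambda\in D$, $$\mathbb{E}\Big\langle\big((\mathbf x.\mathbf X)^2-q^*(\lambda)^2\big)^2\Big\rangle\xrightarrow[n\to\infty]{}0,$$ where, under $\langle\cdot\rangle$, $\mathbf x$ is distributed according to the posterior distribution of $\mathbf X$ given $\mathbf Y$.
   Context: For $\lambda>0$ and $n\ge 1$, consider $Y_{i,j}=\sqrt{\lambda/n}\,X_iX_j+Z_{i,j}$ for $1\le i<j\le n$, where $X_i\overset{i.i.d.}{\sim}P_0$ and $Z_{i,j}\overset{i.i.d.}{\sim}\mathcal N(0,1)$ are independent; $\mathbf X=(X_1,\dots,X_n)$, $\mathbf Y=(Y_{i,j})_{i<j}$. $\langle\cdot\rangle$ denotes the average with respect to the (random) posterior distribution of $\mathbf X$ given $\mathbf Y$: $$dP(\mathbf x|\mathbf Y)=\frac{1}{Z_n(\lambda)}\Big(\prod_{i=1}^n dP_0(x_i)\Big)\exp\Big(\sum_{i<j}x_ix_j\sqrt{\tfrac{\lambda}{n}}\,Y_{i,j}-\tfrac{\lambda}{2n}x_i^2x_j^2\Big),$$ with $Z_n(\lambda)$ the normalizing constant; $\mathbb{E}$ is the expectation over $\mathbf X$ and the noise. For $\mathbf u,\mathbf v\in\mathbb{R}^n$, $\mathbf u.\mathbf v=\frac1n\sum_{i=1}^n u_iv_i$. For $\lambda,q\ge 0$, $$\mathcal F(\lambda,q)=-\frac{\lambda}{4}q^2+\mathbb{E}\log\left(\int dP_0(x)\exp\Big(\sqrt{\lambda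 q}\,Zx+\lambda q\,xX-\frac{\lambda}{2}q x^2\Big)\right),$$ with $Z\sim\mathcal N(0,1)$, $X\sim P_0$ independent. $D\subset(0,\infty)$ is the set of $\lambda$ at which the function $\lambda\mapsto\sup_{q\ge0}\mathcal F(\lambda,q)$ is differentiable (equivalently, at which $\lambda\mapsto \frac{\lambda(\mathbb{E}_{P_0}[X^2])^2}{4}-\sup_{q\ge 0}\mathcal F(\lambda,q)$ is differentiable); for $\lambda\in D$, $q\ge0\mapsto\mathcal F(\lambda,q)$ has a unique maximizer, denoted $q^*(\lambda)$. *)

(* Defs.v *)
From HB Require Import structures.
From mathcomp Require Import all_boot all_order all_algebra.
From mathcomp Require Import all_classical all_reals all_analysis.

Set Implicit Arguments.
Unset Strict Implicit.
Unset Printing Implicit Defensive.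

Import Order.TTheory GRing.Theory Num.Theory.
Import numFieldNormedType.Exports.

Local Open Scope classical_set_scope.
Local Open Scope ring_scope.

Definition mutually_independent d (T : measurableType d) (R : realType)
    (P : probability T R) (I : finType) (X : I -> {RV P >-> R}) : Prop :=
  forall (J : {set I}) (A : I -> set R), (forall i, measurable (A i)) ->
    P [set w | forall i, i \in J -> A i (X i w)] =
    (\prod_(i in J) P (X i @^-1` A i))%E.

Definition has_law d (T : measurableType d) (R : realType)
    (P : probability T R) (X : {RV P >-> R}) (mu : set R -> \bar R) : Prop :=
  forall A : set R, measurable A -> distribution P X A = mu A.

Definition measure_support (R : realType) (mu : set R -> \bar R) : set R :=
  [set x | forall U : set R, open U -> U x -> (0 < mu U)%E].

Section tuple_prob.
Context d (T : measurableType d) (R : realType) (P : probability T R).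

Definition tuple_cons n (p : T * n.-tuple T) : n.+1.-tuple T :=
  [the n.+1.-tuple T of p.1 :: p.2].

Lemma measurable_tuple_cons n : measurable_fun [set: T * n.-tuple T] (@tuple_cons n).
Proof. exact: measurable_cons. Qed.

HB.instance Definition _ n := isMeasurableFun.Build _ _ _ _ (@tuple_cons n)
  (@measurable_tuple_cons n).

(** The law on [n.-tuple T] of [n] i.i.d. samples of [P]. *)
Fixpoint tuple_prob n : probability (n.-tuple T) R :=
  match n with
  | 0 => \d_([tuple] : 0.-tuple T)
  | m.+1 => distribution (P \x tuple_prob m)%E (@tuple_cons m)
  end.

End tuple_prob.

Definition edge (n : nat) := {e : 'I_n * 'I_n | (e.1 < e.2)%N}.

Section spiked_wigner.
Context (R : realType) (P0 : probability R R).
Implicit Types (lambda q : R) (n : nat).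

Definition observation lambda n (x : 'I_n -> R) (z : edge n -> R)
    (e : edge n) : R :=
  Num.sqrt (lambda / n%:R) * x (val e).1 * x (val e).2 + z e.

(** Log of the density of the law of [Y] given [X = x] with respect to pure
    Gaussian noise. *)
Definition log_likelihood_ratio lambda n (y : edge n -> R) (x : n.-tuple R) : R :=
  \sum_(e : edge n)
    let xi := tnth x (val e).1 in let xj := tnth x (val e).2 in
    (xi * xj * Num.sqrt (lambda / n%:R) * y e
     - lambda / (2 * n%:R) * xi ^+ 2 * xj ^+ 2).

Definition partition_function lambda n (y : edge n -> R) : R :=
  (\int[tuple_prob P0 n]_x expR (log_likelihood_ratio lambda y x))%R.

Definition posterior_mean lambda n (y : edge n -> R) (g : n.-tuple R -> R) : R :=
  (partition_function lambda y)^-1 *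
  (\int[tuple_prob P0 n]_x (g x * expR (log_likelihood_ratio lambda y x)))%R.

Definition overlap n (u v : 'I_n -> R) : R := n%:R^-1 * \sum_(i < n) u i * v i.

(** In the outer integral, [p.1] is [X ~ P0] and [p.2] is an independent
    standard Gaussian [Z]. *)
Definition potential lambda q : R :=
  - (lambda / 4) * q ^+ 2 +
  (\int[(P0 \x (normal_prob 0 1))%E]_p
     ln (\int[P0]_x expR (Num.sqrt (lambda * q) * p.2 * x
                          + lambda * q * x * p.1
                          - lambda / 2 * q * x ^+ 2)))%R.

(** For bounded [P0] and [0 < lambda] the potential is bounded above on
    [[0, +oo)], so the real-valued [sup] is the actual supremum. *)
Definition sup_potential lambda : R :=
  sup [set potential lambda q | q in [set q | 0 <= q]].

Definition regular_snr : set R :=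
  [set lambda | 0 < lambda /\ derivable sup_potential lambda 1].

(** The default value of [xget] plays no role on [regular_snr], where the
    maximizer exists and is unique. *)
Definition q_star lambda : R :=
  xget 0 [set q | 0 <= q /\
                  forall r, 0 <= r -> potential lambda r <= potential lambda q].

End spiked_wigner.

Definition signal_noise (T : Type) n (X : 'I_n -> T) (Z : edge n -> T)
    (k : ('I_n + edge n)%type) : T :=
  match k with inl i => X i | inr e => Z e end.

(* Main.v *)
(** Write [u] for the overlap [x.X], [F] for the potential, [q] for its maximizer
    and [f u = (u ^+ 2 - q ^+ 2) ^+ 2]. Compare the free energy of the posterior
    with the one tilted by [exp (n * eta * f u)]; by Jensen's inequality their
    difference is at least [n * eta * E<f u>].

    Both are estimated by interpolating between the matrix channel and [n]
    decoupled scalar channels. Along the interpolation the derivative is a sum of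
    squared Gibbs averages, whose sign is controlled by a completed square.
    - Under the null model, interpolating the relative entropy [E[L ln L]] of the
      likelihood ratio [L] bounds the free energy below by [n * F lambda q - O(1)].
    - Interpolating [E ln L], for a fixed signal and with the overlap linearized
      around a random grid point [m], bounds the tilted free energy above by [n]
      times the maximum over [m] of [F lambda |m| + eta * f m], up to the grid
      error and a law of large numbers of order [sqrt n]. Negative [m] are
      dominated by positive ones thanks to Gibbs' inequality.

    Supporting [sup F] from below by [c1 - c2 / lambda] shows that at a point of
    differentiability the maximizer is unique, so for small [eta] the perturbed
    maximum is at most [F lambda q + eta * delta]. Hence [E<f u>] is eventually
    at most a multiple of [delta]. *)

Require Import Defs.
From HB Require Import structures.
From mathcomp Require Import all_boot all_order all_algebra.
From mathcomp Require Import all_classical all_reals all_analysis.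
From mathcomp Require Import measurable_realfun.
From mathcomp Require Import ring lra.

Set Implicit Arguments.
Unset Strict Implicit.
Unset Printing Implicit Defensive.

Import Order.TTheory GRing.Theory Num.Theory.
Import numFieldNormedType.Exports.

Local Open Scope classical_set_scope.
Local Open Scope ring_scope.

(** * Taylor bounds for the exponential *)

Section real_inequalities.
Context (R : realType).
Implicit Types u v x y : R.

(** No derivative of a Gaussian expectation is ever taken. A channel of signal-to-noise ratio
    [tau + eps ^+ 2] is equivalent to two independent channels, so a partition function [L] becomes
    [L * U] with [U] a fresh factor of mean 1. The expected increment is expanded to second order in
    [eps] with a remainder of order [eps ^+ 3], and [1 / eps ^+ 2] such steps leave an error of
    order [eps]. Both [ln u] and [u * ln u] obey a chain rule on products and differ only in the
    sign of the surviving second-order term; this is why one computation serves the lower bound and,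
    with the inequality reversed, the upper bound.

    The signal is therefore frozen and only the noise interpolates. The price is a term quadratic in
    the overlap, which has to be made linear before the spins decouple. The centre of the
    linearization varies with the configuration, so it becomes a coordinate of the Gibbs space,
    uniform on a finite grid. *)

Lemma nonneg_of_deriv (f f' : R -> R) : (forall x : R, is_derive x 1 f (f' x)) ->
  f 0 = 0 -> (forall x, 0 <= x -> 0 <= f' x) -> forall x, 0 <= x -> 0 <= f x.
Proof.
move=> df f0 f'0 x; rewrite le_eqVlt => /predU1P[<-|x0]; first by rewrite f0.
have [|c] := @MVT R f f' 0 x x0 (fun y _ => df y).
  apply: continuous_subspaceT => y; apply: differentiable_continuous.
  by apply/derivable1_diffP; have [] := df y.
rewrite in_itv/= => /andP[c0 _]; rewrite f0 !subr0 => ->.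
by rewrite mulr_ge0 ?f'0 ?(ltW c0)// ltW.
Qed.

Lemma expR_sub1_le u : expR u - 1 <= u * expR u.
Proof.
have := expR_ge1Dx (- u); rewrite expRN => h.
have e0 := expR_gt0 u.
have : (1 - u) * expR u <= 1.
  by rewrite -(ler_pM2r e0) mulVf ?gt_eqF// in h.
by lra.
Qed.

Lemma expR_second u : 0 <= expR u - 1 - u <= u ^+ 2 * expR `|u|.
Proof.
have h1 := expR_ge1Dx u; have h2 := expR_sub1_le u.
apply/andP; split; first by lra.
have [u0|u0] := leP 0 u.
  have h3 : u * (expR u - 1) <= u * (u * expR u) by apply: ler_wpM2l.
  by move: h3; rewrite (ger0_norm u0) expr2 -mulrA; lra.
have h3 : u ^+ 2 * 1 <= u ^+ 2 * expR (- u).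
  by rewrite ler_wpM2l ?sqr_ge0// -expR0 ler_expR; lra.
have h4 : (- u) * (1 - expR u) <= (- u) * (- u) by rewrite ler_wpM2l//; lra.
have h5 : expR u - 1 - u <= u * (expR u - 1) by lra.
by move: h3 h4 h5; rewrite (ltr0_norm u0) expr2; lra.
Qed.

(** The generous constant 1 in place of 1/6 leaves room to bound the derivatives by lower-order
    estimates, so that monotonicity on each half-line suffices. *)
Lemma expR_third u : `|expR u - 1 - u - u ^+ 2 / 2| <= `|u| ^+ 3 * expR `|u|.
Proof.
have [u0|u0] := leP 0 u.
  rewrite (ger0_norm u0).
  have a1 : 0 <= expR u - 1 - u - u ^+ 2 / 2.
    apply: (@nonneg_of_deriv (fun u => expR u - 1 - u - u ^+ 2 / 2) (fun u => expR u - 1 - u)) => //.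
    - move=> x; apply: is_derive_eq; rewrite /GRing.scale/=; by field.
    - by rewrite /= expR0; ring.
    - by move=> x _; have /andP[] := expR_second x.
  have a2 : 0 <= u ^+ 3 * expR u - (expR u - 1 - u - u ^+ 2 / 2).
    apply: (@nonneg_of_deriv (fun u => u ^+ 3 * expR u - (expR u - 1 - u - u ^+ 2 / 2))
      (fun u => (3 * u ^+ 2 + u ^+ 3) * expR u - (expR u - 1 - u))) => //.
    - move=> x; apply: is_derive_eq; rewrite /GRing.scale/=; by field.
    - by rewrite /= expR0; ring.
    - move=> x x0; have /andP[_] := expR_second x; rewrite (ger0_norm x0) => h.
      have : 0 <= (2 * x ^+ 2 + x ^+ 3) * expR x.
        by rewrite mulr_ge0 ?expR_ge0// addr_ge0 ?mulr_ge0 ?exprn_ge0.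
      by move: h; lra.
  by rewrite ger0_norm//; lra.
have [v v0 ->] : exists2 v, 0 <= v & u = - v by exists (- u); lra.
rewrite normrN (ger0_norm v0) sqrrN opprK.
have a1 : 0 <= - (expR (- v) - 1 + v - v ^+ 2 / 2).
  apply: (@nonneg_of_deriv (fun v => - (expR (- v) - 1 + v - v ^+ 2 / 2)) (fun v => expR (- v) - 1 + v)) => //.
  - move=> x; apply: is_derive_eq; rewrite /GRing.scale/=; by field.
  - by rewrite /= oppr0 expR0; ring.
  - by move=> x _; have := expR_ge1Dx (- x); lra.
have a2 : 0 <= v ^+ 3 + (expR (- v) - 1 + v - v ^+ 2 / 2).
  apply: (@nonneg_of_deriv (fun v => v ^+ 3 + (expR (- v) - 1 + v - v ^+ 2 / 2))
     (fun v => 3 * v ^+ 2 - (expR (- v) - 1 + v))) => //.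
  - move=> x; apply: is_derive_eq; rewrite /GRing.scale/=; by field.
  - by rewrite /= oppr0 expR0; ring.
  - move=> x x0.
    have h : x * (1 - expR (- x)) <= x * x.
      by rewrite ler_wpM2l//; have := expR_ge1Dx (- x); lra.
    have := expR_sub1_le (- x); have := sqr_ge0 x.
    by move: h; rewrite expr2; lra.
rewrite ler0_norm; last by lra.
have : v ^+ 3 * 1 <= v ^+ 3 * expR v.
  by rewrite ler_wpM2l ?exprn_ge0// -expR0 ler_expR.
by lra.
Qed.

End real_inequalities.

(** The product measure integrates its sections with the first factor outermost. [normal_add]
    changes variables in the first coordinate and needs it innermost. *)
Lemma prod_prob_swap d1 d2 (T1 : measurableType d1) (T2 : measurableType d2)
    (R : realType) (P1 : probability T1 R) (P2 : probability T2 R) (S : set (T1 * T2)) :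
  measurable S ->
  (P1 \x P2)%E S = (\int[P2]_y \int[P1]_x (\1_S (x, y) : R)%:E)%E.
Proof.
move=> mS.
have mI : measurable_fun setT (fun p : T1 * T2 => (\1_S p : R)%:E).
  by apply/measurable_EFinP; exact: measurable_indic.
have i0 p : (0 <= (\1_S p : R)%:E)%E by [].
by rewrite -(fubini_tonelli _ mI i0) -(fubini_tonelli1 _ mI i0) integral_indic// setIT.
Qed.

(** * The standard Gaussian law *)

Section gauss1.
Context (R : realType).
Local Notation mu := (@lebesgue_measure R).
Local Notation gam := (normal_prob (0 : R) 1).

(** The pushforward of Lebesgue measure under the affine map, rescaled by [a], agrees with Lebesgue
    measure on half-open intervals, hence everywhere. *)
Lemma lebesgue_affine (a b : R) (f : R -> \bar R) : 0 < a ->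
  measurable_fun [set: R] f -> (forall x, 0 <= f x)%E ->
  (a%:E * \int[mu]_x f (a * x + b)%R = \int[mu]_x f x)%E.
Proof.
move=> a0 mf f0.
pose F (x : measurableTypeR R) : measurableTypeR R := a * x + b.
have mF : measurable_fun setT F.
  by apply: measurable_funD => //; apply: measurable_funM.
have pushE A : measurable A ->
    mu A = mscale (NngNum (ltW a0)) (pushforward mu F) A.
  apply: lebesgue_measure_unique => _ [[p q]] _ <-.
  rewrite /mscale/= /pushforward.
  set S := (X in _ = (_ * lebesgue_measure X)%E). have -> : S = [set` `](p - b) / a, (q - b) / a]] :> set R.
    apply/seteqP; split => x; rewrite /S /F /= !in_itv/= ltr_pdivrMr// ler_pdivlMr//.
      by move=> /andP[h1 h2]; apply/andP; split; lra.
    by move=> /andP[h1 h2]; apply/andP; split; lra.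
  rewrite !lebesgue_measure_itv/= !lte_fin ltr_pM2r ?invr_gt0// ltrD2r.
  case: ifP => _; last by rewrite mule0.
  rewrite -!EFinD -EFinM; congr EFin; field; exact: lt0r_neq0.
rewrite [RHS](eq_measure_integral (mscale (NngNum (ltW a0)) (pushforward mu F))).
  by rewrite ge0_integral_mscale// ge0_integral_pushforward//.
by move=> A mA _; exact: (pushE mF A mA).
Qed.

(** A Radon-Nikodym derivative is determined only almost everywhere; equality of integrals over all
    measurable sets identifies it with [normal_pdf]. *)
Lemma ge0_integral_normal (m s : R) (f : R -> \bar R) : s != 0 ->
  measurable_fun [set: R] f -> (forall x, 0 <= f x)%E ->
  (\int[normal_prob m s]_x f x = \int[mu]_x (f x * (normal_pdf m s x)%:E))%E.
Proof.
move=> s0 mf f0.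
rewrite -(Radon_Nikodym_SigmaFinite.change_of_variables (normal_prob_dominates m s))//.
have mRN : measurable_fun setT (Radon_Nikodym_SigmaFinite.f (normal_prob m s) mu).
  apply: (measurable_int mu); apply: Radon_Nikodym_SigmaFinite.f_integrable.
  exact: normal_prob_dominates.
have mpdf : measurable_fun setT (fun x => (normal_pdf m s x)%:E).
  by apply/measurable_EFinP; exact: measurable_normal_pdf.
apply: ae_eq_integral => //.
- exact: emeasurable_funM.
- exact: emeasurable_funM.
- apply: ae_eqe_mul2l; apply: integral_ae_eq => //.
  + apply: Radon_Nikodym_SigmaFinite.f_integrable; exact: normal_prob_dominates.
  + move=> E _ mE; rewrite -Radon_Nikodym_SigmaFinite.f_integral//.
    exact: normal_prob_dominates.
Qed.

Lemma normal_affine (m s : R) (f : R -> \bar R) : 0 < s ->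
  measurable_fun [set: R] f -> (forall x, 0 <= f x)%E ->
  (\int[normal_prob m s]_x f x = \int[gam]_z f (s * z + m)%R)%E.
Proof.
move=> s0 mf f0.
have mff : measurable_fun setT (fun z : R => f (s * z + m)).
  by apply: measurableT_comp => //; apply: measurable_funD => //; apply: measurable_funM.
rewrite (ge0_integral_normal m (lt0r_neq0 s0) mf f0).
rewrite (ge0_integral_normal 0 (oner_neq0 _) mff (fun z => f0 _)).
rewrite -(lebesgue_affine m s0); last 2 first.
- by apply: emeasurable_funM => //; apply/measurable_EFinP; exact: measurable_normal_pdf.
- by move=> x; rewrite mule_ge0// lee_fin normal_pdf_ge0.
rewrite -ge0_integralZl//=; last 3 first.
- apply: emeasurable_funM => //; apply/measurable_EFinP.
  apply: (measurableT_comp (measurable_normal_pdf _ _)).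
  by apply: measurable_funD => //; apply: measurable_funM.
- by move=> x _; rewrite mule_ge0// lee_fin normal_pdf_ge0.
- by rewrite lee_fin ltW.
apply: eq_integral => z _; rewrite muleCA -EFinM; congr (_ * _%:E)%E.
rewrite !normal_pdfE ?lt0r_neq0// /normal_fun /normal_peak.
rewrite mulrA; congr (_ * expR _).
  rewrite expr1n mul1r -[s ^+ 2 * pi *+ 2]mulrnAr sqrtrM ?sqr_ge0// sqrtr_sqr gtr0_norm//.
  by rewrite invfM mulrA divff ?mul1r// lt0r_neq0.
by field; exact: lt0r_neq0.
Qed.

Lemma normal_sym (f : R -> \bar R) :
  measurable_fun [set: R] f -> (forall x, 0 <= f x)%E ->
  (\int[gam]_z f (- z)%R = \int[gam]_z f z)%E.
Proof.
move=> mf f0.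
have mN : measurable_fun setT (-%R : R -> measurableTypeR R) by exact: oppr_measurable.
have mg : measurable_fun setT (fun x => f x * (normal_pdf 0 1 x)%:E)%E.
  by apply: emeasurable_funM => //; apply/measurable_EFinP; exact: measurable_normal_pdf.
rewrite (ge0_integral_normal 0 (oner_neq0 _) (measurableT_comp mf mN) (fun z => f0 _)).
rewrite (ge0_integral_normal 0 (oner_neq0 _) mf f0).
rewrite [RHS](eq_measure_integral (pushforward mu (-%R : _ -> measurableTypeR R))).
  have g0 : {in [set: R], forall x, (0 <= f x * (normal_pdf 0 1 x)%:E)%E}.
    by move=> x _; rewrite mule_ge0// lee_fin normal_pdf_ge0.
  have mN' : measurable_fun setT (-%R : measurableTypeR R -> measurableTypeR R) := mN.
  have mg' : measurable_fun [set: measurableTypeR R] (fun x => f x * (normal_pdf 0 1 x)%:E)%E := mg.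
  rewrite (ge0_integral_pushforward mN' mu measurableT mg' g0).
  apply: eq_integral => x _ /=; congr (_ * _%:E)%E.
  by rewrite (normal_pdfE 0 (oner_neq0 _)) /normal_fun !subr0 sqrrN.
by move=> A mA _; rewrite -[LHS]lebesgue_measureN.
Qed.

(** Cameron-Martin formula. The exponential is the density of the law of mean [c] against the
    centred one; it later turns reweighting by a likelihood ratio into planting a signal. *)
Lemma normal_shift (c : R) (f : R -> \bar R) :
  measurable_fun [set: R] f -> (forall x, 0 <= f x)%E ->
  (\int[gam]_z f (z + c)%R = \int[gam]_z (f z * (expR (c * z - c ^+ 2 / 2))%:E))%E.
Proof.
move=> mf f0.
have me : measurable_fun setT (fun z : R => (expR (c * z - c ^+ 2 / 2))%:E).
  by apply/measurable_EFinP; apply: measurableT_comp => //; apply: measurable_funD => //; apply: measurable_funM.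
transitivity (\int[normal_prob c 1]_z f z)%E.
  by rewrite (@normal_affine c 1)//; under eq_integral do rewrite -[X in (X + _)%R]mul1r.
have fe0 x : (0 <= f x * (expR (c * x - c ^+ 2 / 2))%:E)%E by rewrite mule_ge0// lee_fin expR_ge0.
rewrite (ge0_integral_normal c (oner_neq0 _) mf f0).
rewrite (ge0_integral_normal 0 (oner_neq0 _) (emeasurable_funM mf me) fe0).
apply: eq_integral => z _; rewrite -muleA -EFinM; congr (_ * _%:E)%E.
rewrite !(normal_pdfE _ (oner_neq0 _)) /normal_fun mulrCA -expRD; congr (_ * expR _).
by field.
Qed.

(** The pair [(a * w + b * z, z)] has a joint density that is symmetric in its two arguments.
    Conditioning the other way round turns the integral over [z] into that of a normal density,
    which is 1. *)
Lemma normal_add (a b : R) (A : set R) : 0 < a -> a ^+ 2 + b ^+ 2 = 1 -> measurable A ->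
  (gam \x gam)%E [set p | A (a * p.1 + b * p.2)%R] = gam A.
Proof.
move=> a0 ab mA.
have mfun : measurable_fun setT (fun p : R * R => a * p.1 + b * p.2).
  by apply: measurable_funD; apply: measurable_funM => //.
have mS : measurable [set p : R * R | A (a * p.1 + b * p.2)%R].
  by rewrite -[X in measurable X]setTI; exact: mfun.
have mpdf m s : measurable_fun setT (fun x : R => (normal_pdf m s x)%:E).
  by apply/measurable_EFinP; exact: measurable_normal_pdf.
have mind : measurable_fun setT (fun x : R => (\1_A x : R)%:E).
  by apply/measurable_EFinP; exact: measurable_indic.
have i0 w : (0 <= (\1_A w : R)%:E)%E by [].
have pdf0 m s x : (0 <= (normal_pdf m s x : R)%:E)%E by rewrite lee_fin normal_pdf_ge0.
have aneq : a != 0 by exact: lt0r_neq0.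
have mpdf2 : measurable_fun setT (fun p : R * R => (normal_pdf (b * p.2) a p.1)%:E).
  rewrite (_ : (fun p => _) = fun p : R * R => (normal_pdf 0 a (p.1 - b * p.2))%:E).
    apply: (measurableT_comp (mpdf _ _)); apply: measurable_funB => //.
    exact: measurable_funM.
  apply/funext => p; rewrite !normal_pdfE//; congr (_ * _)%:E.
  by rewrite /normal_fun subr0.
transitivity (\int[gam]_z (\int[gam]_w (\1_A (a * w + b * z)%R : R)%:E))%E.
  exact: (prod_prob_swap gam gam mS).
transitivity (\int[gam]_z (\int[mu]_w ((\1_A w : R)%:E * (normal_pdf (b * z) a w)%:E)))%E.
  apply: eq_integral => z _.
  rewrite -(ge0_integral_normal (b * z) aneq mind i0).
  exact: esym (normal_affine (b * z) a0 mind i0).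
have mF : measurable_fun setT (fun p : R * R => (\1_A p.1 : R)%:E * (normal_pdf (b * p.2) a p.1)%:E)%E.
  by apply: emeasurable_funM => //; exact: (measurableT_comp mind).
have F0 p : (0 <= (\1_A p.1 : R)%:E * (normal_pdf (b * p.2) a p.1)%:E)%E.
  by rewrite mule_ge0.
have iF0 z : (0 <= \int[mu]_w ((\1_A w : R)%:E * (normal_pdf (b * z) a w)%:E))%E.
  by apply: integral_ge0 => w _; exact: (F0 (w, z)).
have miF : measurable_fun [set: R] (fun z => \int[mu]_w ((\1_A w : R)%:E * (normal_pdf (b * z) a w)%:E))%E.
  exact: (@measurable_fun_fubini_tonelli_G _ _ (measurableTypeR R) R R mu _ mF F0).
rewrite (ge0_integral_normal 0 (oner_neq0 _) miF iF0).
pose H (p : R * R) := ((\1_A p.1 : R)%:E * (normal_pdf (b * p.2) a p.1)%:E * (normal_pdf 0 1 p.2)%:E)%E.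
have mH : measurable_fun setT H.
  by apply: emeasurable_funM => //; exact: (measurableT_comp (mpdf _ _)).
have H0 p : (0 <= H p)%E by rewrite mule_ge0.
transitivity (\int[mu]_z \int[mu]_w H (w, z))%E.
  apply: eq_integral => z _; rewrite -ge0_integralZr//.
    by apply: emeasurable_funM; [exact: mind|exact: mpdf].
  by move=> w _; exact: (F0 (w, z)).
rewrite -(@fubini_tonelli _ _ (measurableTypeR R) (measurableTypeR R) R mu mu H mH H0).
transitivity (\int[mu]_w ((\1_A w : R)%:E * (normal_pdf 0 1 w)%:E))%E.
  apply: eq_integral => w _; rewrite /fubini_F /H/=.
  transitivity (\int[mu]_z ((\1_A w * normal_pdf 0 1 w)%:E * (normal_pdf (b * w) a z)%:E))%E.
    apply: eq_integral => z _; rewrite -!EFinM -!mulrA; congr (_ * _)%:E.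
    rewrite !normal_pdfE// /normal_fun mulrACA [RHS]mulrACA -!expRD.
    congr (_ * expR _); first by rewrite mulrC.
    have a2 : a ^+ 2 = 1 - b ^+ 2 by apply/eqP; rewrite eq_sym subr_eq ab.
    have h : 1 - b ^+ 2 != 0 by rewrite -a2 sqrf_eq0.
    by rewrite a2; field.
  rewrite ge0_integralZl//.
  - by rewrite integral_normal_pdf mule1.
  - exact: mpdf.
  - by rewrite lee_fin mulr_ge0// normal_pdf_ge0.
by rewrite -(ge0_integral_normal 0 (oner_neq0 _) mind i0) integral_indic// setIT.
Qed.

End gauss1.

(** * Laws on tuples *)

Section tuple_laws.
Context d (T : measurableType d) (R : realType).

Definition box n (A : 'I_n -> set T) : set (n.-tuple T) :=
  [set z | forall i, A i (tnth z i)].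

Lemma measurable_box n (A : 'I_n -> set T) :
  (forall i, measurable (A i)) -> measurable (box A).
Proof.
move=> mA; rewrite (_ : box A = \bigcap_(i in [set: 'I_n]) ((@tnth n T ^~ i) @^-1` A i)).
  apply: fin_bigcap_measurable; first exact: finite_finset.
  by move=> i _; rewrite -[X in measurable X]setTI; exact: (measurable_tnth i).
by apply/seteqP; split => z /=; [move=> h i _; exact: h|move=> h i; exact: h].
Qed.

(** Boxes form a pi-system which contains the whole space and generates the product
    sigma-algebra. *)
Lemma box_unique n (m1 m2 : {measure set (n.-tuple T) -> \bar R}) :
  (m1 setT < +oo)%E ->
  (forall A, (forall i, measurable (A i)) -> m1 (box A) = m2 (box A)) ->
  forall S, measurable S -> m1 S = m2 S.
Proof.
move=> m1fin mE.
pose G := [set S | exists2 A : 'I_n -> set T, (forall i, measurable (A i)) & S = box A].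
have GT : G setT by exists (fun=> setT) => //; apply/seteqP; split.
apply: (measure_unique G (fun=> setT)) => //.
- apply/seteqP; split.
    apply: smallest_sub; first exact: smallest_sigma_algebra.
    move=> S; rewrite -bigcup_seq => -[i _ [B mB <-]].
    apply: sub_sigma_algebra; exists (fun j => if j == i then B else setT).
      by move=> j; case: ifP.
    apply/seteqP; split => z /=; last by move=> /(_ i); rewrite eqxx; split.
    by move=> [_ Bz] j; case: eqP => // ->.
  apply: smallest_sub; first exact: sigma_algebra_measurable.
  by move=> _ [A mA ->]; exact: measurable_box.
- move=> _ _ [A mA ->] [B mB ->]; exists (fun i => A i `&` B i).
    by move=> i; exact: measurableI.
  apply/seteqP; split => z /=; first by move=> [a b] i; split.
  by move=> h; split=> i; have [] := h i.
- by rewrite bigcup_const.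
- by move=> _ [A mA ->]; exact: mE.
Qed.

Variable P : probability T R.
Local Notation tp := (tuple_prob P).

Lemma ge0_integral_tupleS n (f : n.+1.-tuple T -> \bar R) :
  measurable_fun setT f -> (forall z, 0 <= f z)%E ->
  (\int[tp n.+1]_z f z = \int[P]_x \int[tp n]_y f (tuple_cons (x, y)))%E.
Proof.
move=> mf f0; rewrite [LHS]ge0_integral_distribution//.
rewrite fubini_tonelli1//.
  by apply: (measurableT_comp mf); exact: measurable_tuple_cons.
by move=> x; exact: f0.
Qed.

Lemma tuple_prob_box n (A : 'I_n -> set T) :
  (forall i, measurable (A i)) -> tp n (box A) = (\prod_i P (A i))%E.
Proof.
elim: n A => [|n IH] A mA.
  rewrite big_ord0 /= diracE mem_set//.
  by case.
rewrite big_ord_recl -IH; last by move=> i; exact: mA.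
rewrite [LHS]/= /distribution /pushforward.
rewrite (_ : _ @^-1` _ = A ord0 `*` box (fun i => A (lift ord0 i))).
  by rewrite product_measure1E//; exact: measurable_box.
apply/seteqP; split => -[x y] /= h.
  split; first exact: (h ord0).
  by move=> i; have := h (lift ord0 i); rewrite tnthS.
move=> i; case: (unliftP ord0 i) => [j ->|->]; last by have [] := h.
by rewrite tnthS; have [_] := h; exact.
Qed.

Lemma tuple_prob_law n (m : {measure set (n.-tuple T) -> \bar R}) :
  (forall A, (forall i, measurable (A i)) -> m (box A) = \prod_i P (A i))%E ->
  forall S, measurable S -> m S = tp n S.
Proof.
move=> h S mS; apply/esym/box_unique => //.
  by rewrite [ltLHS](@probability_setT _ _ _ (tp n)) ltry.
by move=> A mA; rewrite h//; exact: tuple_prob_box.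
Qed.

Lemma tuple_prob_tnth n (k : 'I_n) (A : set T) : measurable A ->
  tp n [set z | A (tnth z k)] = P A.
Proof.
move=> mA; rewrite (_ : [set _ | _] = box (fun j => if j == k then A else setT)).
  rewrite tuple_prob_box; last by move=> j; case: ifP.
  rewrite (bigD1 k)//= eqxx big1 ?mule1// => j /negbTE ->.
  exact: probability_setT.
apply/seteqP; split => z /=; last by move=> /(_ k); rewrite eqxx.
by move=> Az j; case: eqP => // ->.
Qed.

End tuple_laws.

Section tuple2.
Context d1 d2 (T1 : measurableType d1) (T2 : measurableType d2) (R : realType).
Context (P1 : probability T1 R) (P2 : probability T2 R) (n1 n2 : nat).

(** Uniqueness is applied twice, once per factor: restricting [m] to a cylinder over a box of the
    first factor and projecting extends the product formula to all measurable sets of the second;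
    the roles are then exchanged. *)
Lemma tuple_prob2_law (m : {measure set (n1.-tuple T1 * n2.-tuple T2) -> \bar R}) :
  (m setT < +oo)%E ->
  (forall A B, (forall i, measurable (A i)) -> (forall i, measurable (B i)) ->
   m (box A `*` box B) = (\prod_i P1 (A i)) * (\prod_i P2 (B i)))%E ->
  forall S, measurable S -> m S = (tuple_prob P1 n1 \x tuple_prob P2 n2)%E S.
Proof.
move=> mfin h S mS; apply/esym; apply: product_measure_unique => // A B mA mB.
have fin_le S' : measurable S' -> (m S' < +oo)%E.
  by move=> mS'; apply: le_lt_trans mfin; apply: le_measure; rewrite ?inE.
pose f2 (x : n1.-tuple T1 * n2.-tuple T2) := x.2.
pose f1 (x : n1.-tuple T1 * n2.-tuple T2) := x.1.
have mf2 : measurable_fun setT f2 by exact: measurable_snd.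
have mf1 : measurable_fun setT f1 by exact: measurable_fst.
have step1 A' B' : (forall i, measurable (A' i)) -> measurable B' ->
    (m (box A' `*` B') = (\prod_i P1 (A' i)) * tuple_prob P2 n2 B')%E.
  move=> mA' mB'.
  have mbA : measurable (box A' `*` [set: n2.-tuple T2]).
    by apply: measurableX => //; exact: measurable_box.
  pose ma := mrestr m mbA.
  have p0 : (0 <= \prod_i P1 (A' i))%E by apply: prode_ge0.
  have pf : (\prod_i P1 (A' i))%E \is a fin_num.
    by rewrite -(tuple_prob_box P1 mA'); exact: fin_num_measure (measurable_box mA').
  have p0' : 0 <= fine (\prod_i P1 (A' i))%E by exact: fine_ge0.
  have E B0 : f2 @^-1` B0 `&` (box A' `*` [set: n2.-tuple T2]) = box A' `*` B0.
    by apply/seteqP; split => -[x y] /=; rewrite /f2/=; tauto.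
  have key : forall S, measurable S ->
      pushforward ma f2 S = mscale (NngNum p0') (tuple_prob P2 n2) S.
    apply: (@box_unique _ T2 R n2 (pushforward ma f2) (mscale (NngNum p0') (tuple_prob P2 n2))).
    - change (m (f2 @^-1` setT `&` (box A' `*` setT)) < +oo)%E; rewrite E; apply: fin_le; apply: measurableX => //.
      exact: measurable_box.
    - move=> B0 mB0; change (m (f2 @^-1` box B0 `&` (box A' `*` setT)) = mscale (NngNum p0') (tuple_prob P2 n2) (box B0)).
      rewrite E h// /mscale/= fineK//.
      by congr (_ * _)%E; rewrite tuple_prob_box.
  by have := key _ mB'; rewrite -[LHS]/(m (f2 @^-1` B' `&` (box A' `*` setT))) E /mscale/= fineK.
have mXB : measurable ([set: n1.-tuple T1] `*` B) by exact: measurableX.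
pose mb := mrestr m mXB.
have q0 : 0 <= fine (tuple_prob P2 n2 B) by exact: fine_ge0.
have E A0 : f1 @^-1` A0 `&` ([set: n1.-tuple T1] `*` B) = A0 `*` B.
  by apply/seteqP; split => -[x y] /=; rewrite /f1/=; tauto.
have pf : tuple_prob P2 n2 B \is a fin_num by exact: fin_num_measure.
have key : forall S, measurable S ->
    pushforward mb f1 S = mscale (NngNum q0) (tuple_prob P1 n1) S.
  apply: (@box_unique _ T1 R n1 (pushforward mb f1) (mscale (NngNum q0) (tuple_prob P1 n1))).
  - by change (m (f1 @^-1` setT `&` (setT `*` B)) < +oo)%E; rewrite E; apply: fin_le; exact: measurableX.
  - move=> A0 mA0; change (m (f1 @^-1` box A0 `&` (setT `*` B)) = mscale (NngNum q0) (tuple_prob P1 n1) (box A0)).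
    rewrite E step1// /mscale/= fineK// muleC.
    by congr (_ * _)%E; rewrite tuple_prob_box.
by have := key _ mA; rewrite -[LHS]/(m (f1 @^-1` A `&` (setT `*` B))) E /mscale/= fineK// muleC.
Qed.

End tuple2.

Notation igl P f := (P.-integrable setT (EFin \o (f : _ -> _))).

(** * Real-valued integrals *)

Section toolkit.
Context d (T : measurableType d) (R : realType) (P : probability T R).
Implicit Types f g : T -> R.

Lemma igl_meas f : igl P f -> measurable_fun setT f.
Proof. by move=> /(measurable_int P) /measurable_EFinP. Qed.

Lemma igl_dom f g : measurable_fun setT f -> igl P g -> (forall x, `|f x| <= g x) ->
  igl P f.
Proof.
move=> mf ig fg; apply: (le_integrable _ _ _ ig) => //; first exact/measurable_EFinP.
by move=> x _ /=; rewrite lee_fin (le_trans (fg x))// ler_norm.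
Qed.

Lemma iglD f g : igl P f -> igl P g -> igl P (fun x => f x + g x).
Proof. by move=> hf hg; apply: (integrableD measurableT hf hg). Qed.

Lemma iglB f g : igl P f -> igl P g -> igl P (fun x => f x - g x).
Proof. by move=> hf hg; apply: (integrableB measurableT hf hg). Qed.

Lemma iglZ (k : R) f : igl P f -> igl P (fun x => k * f x).
Proof. by move=> hf; apply: (integrableZl measurableT k hf). Qed.

Lemma igl_cst (k : R) : igl P (fun=> k).
Proof. exact: finite_measure_integrable_cst. Qed.

Lemma igl_bound f (C : R) : measurable_fun setT f -> (forall x, `|f x| <= C) -> igl P f.
Proof. by move=> mf; apply: igl_dom => //; exact: igl_cst. Qed.

Lemma igl_sum (I : Type) (s : seq I) (p : pred I) (F : I -> T -> R) :
  (forall i, igl P (F i)) -> igl P (fun x => \sum_(i <- s | p i) F i x).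
Proof.
move=> h; elim: s => [|i s IH]; first by under eq_fun do rewrite big_nil; exact: igl_cst.
under eq_fun do rewrite big_cons; case: (p i) => //; exact: iglD.
Qed.

Lemma igl_norm f : igl P f -> igl P (fun x => `|f x|).
Proof. exact: integrable_norm. Qed.

Lemma Rint_cst (k : R) : \int[P]_x k = k.
Proof.
rewrite Rintegral_cst// -[RHS]mulr1; congr (_ * _).
by have /(congr1 fine) := probability_setT P.
Qed.

Lemma RintD f g : igl P f -> igl P g ->
  \int[P]_x (f x + g x) = \int[P]_x f x + \int[P]_x g x.
Proof. exact: RintegralD. Qed.

Lemma RintB f g : igl P f -> igl P g ->
  \int[P]_x (f x - g x) = \int[P]_x f x - \int[P]_x g x.
Proof. exact: RintegralB. Qed.

Lemma RintZ (k : R) f : igl P f -> \int[P]_x (k * f x) = k * \int[P]_x f x.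
Proof. exact: RintegralZl. Qed.

Lemma Rint_sum (I : Type) (s : seq I) (p : pred I) (F : I -> T -> R) :
  (forall i, igl P (F i)) ->
  \int[P]_x (\sum_(i <- s | p i) F i x) = \sum_(i <- s | p i) \int[P]_x F i x.
Proof.
move=> h; elim: s => [|i s IH].
  by under eq_Rintegral do rewrite big_nil; rewrite Rint_cst big_nil.
under eq_Rintegral do rewrite big_cons; rewrite big_cons.
by case: (p i) => //; rewrite RintD ?IH//; exact: igl_sum.
Qed.

Lemma le_Rint f g : igl P f -> igl P g -> (forall x, f x <= g x) ->
  \int[P]_x f x <= \int[P]_x g x.
Proof. by move=> hf hg fg; apply: le_Rintegral. Qed.

Lemma norm_Rint f g : igl P f -> igl P g -> (forall x, `|f x| <= g x) ->
  `|\int[P]_x f x| <= \int[P]_x g x.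
Proof.
move=> hf hg fg; apply: le_trans (le_normr_Rintegral _ hf) _ => //.
by apply: le_Rint => //; exact: igl_norm.
Qed.

Lemma Rint_gt0 f : igl P f -> (forall x, 0 < f x) -> 0 < \int[P]_x f x.
Proof.
move=> hf f0; rewrite lt_neqAle Rintegral_ge0 ?andbT//; last by move=> x _; exact: ltW.
apply/eqP => /esym E.
have mf := measurable_int _ hf.
have i0 : (\int[P]_x (f x)%:E)%E = 0%E.
  by rewrite -[LHS]fineK; [congr EFin|exact: integrable_fin_num].
have := (ae_eq_integral_abs P measurableT mf).1.
under eq_integral => x _ do rewrite /= gtr0_norm//.
move=> /(_ i0) [N [mN PN0 hN]].
(* Strict positivity puts every point into the exceptional null set, against total mass 1. *)
have : N = setT.
  apply/seteqP; split => // x _; apply: hN => /= /(_ I) /eqP.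
  by rewrite eqe gt_eqF.
move=> NT; move: PN0; rewrite NT => PT; have := probability_setT P.
by rewrite PT => /eqP; rewrite eqe eq_sym oner_eq0.
Qed.

Lemma EFin_Rint f : igl P f -> (\int[P]_x f x)%:E = (\int[P]_x (f x)%:E)%E.
Proof. by move=> hf; rewrite /Rintegral fineK//; exact: integrable_fin_num. Qed.

Lemma ge0_igl f : measurable_fun setT f -> (forall x, 0 <= f x) ->
  (\int[P]_x (f x)%:E < +oo)%E -> igl P f.
Proof.
move=> mf f0 h; apply/integrableP; split; first exact/measurable_EFinP.
by under eq_integral => x _ do rewrite /= ger0_norm//.
Qed.

End toolkit.

Section ereal_law.
Context d1 d2 (T1 : measurableType d1) (T2 : measurableType d2) (R : realType).
Context (P : probability T1 R) (Q : probability T2 R) (phi : T1 -> T2).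
Hypothesis mphi : measurable_fun setT phi.
Hypothesis law : forall S, measurable S -> P (phi @^-1` S) = Q S.

Lemma ge0_int_law (f : T2 -> \bar R) : measurable_fun setT f -> (forall x, 0 <= f x)%E ->
  (\int[Q]_y f y = \int[P]_x f (phi x))%E.
Proof.
move=> mf f0; rewrite -[RHS](@ge0_integral_pushforward _ _ _ _ _ _ mphi P setT f)//.
by apply: eq_measure_integral => S mS _; exact: (esym (law mS)).
Qed.

Lemma int_law (f : T2 -> \bar R) : measurable_fun setT f ->
  (\int[Q]_y f y = \int[P]_x f (phi x))%E.
Proof.
move=> mf; rewrite [LHS]integralE [RHS]integralE; congr (_ - _)%E.
  rewrite (ge0_int_law (measurable_funepos mf) (fun x => funepos_ge0 f x)).
  by apply: eq_integral => x _; exact: (esym (congr1 (@^~ x) (funepos_comp f phi))).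
rewrite (ge0_int_law (measurable_funeneg mf) (fun x => funeneg_ge0 f x)).
by apply: eq_integral => x _; exact: (esym (congr1 (@^~ x) (funeneg_comp f phi))).
Qed.

Lemma Rint_law (f : T2 -> R) : measurable_fun setT f ->
  \int[Q]_y f y = \int[P]_x f (phi x).
Proof. by move=> mf; rewrite /Rintegral int_law//; exact/measurable_EFinP. Qed.

Lemma igl_law (f : T2 -> R) : igl Q f -> igl P (fun x => f (phi x)).
Proof.
move=> hf; have mf := igl_meas hf; apply/integrableP; split.
  by apply/measurable_EFinP; apply: measurableT_comp.
move/integrableP : hf => [_]; rewrite ge0_int_law//.
by apply/measurableT_comp => //; exact/measurable_EFinP.
Qed.

Lemma igl_law' (f : T2 -> R) : measurable_fun setT f -> igl P (fun x => f (phi x)) -> igl Q f.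
Proof.
move=> mf hf; apply/integrableP; split; first exact/measurable_EFinP.
move/integrableP : hf => [_]; rewrite ge0_int_law//.
by apply/measurableT_comp => //; exact/measurable_EFinP.
Qed.

End ereal_law.

Section fub.
Context d1 d2 (T1 : measurableType d1) (T2 : measurableType d2) (R : realType).
Context (P : probability T1 R) (Q : probability T2 R).
Implicit Types f : T1 * T2 -> R.

Lemma meas_sec1 f x : measurable_fun setT f -> measurable_fun setT (fun y => f (x, y)).
Proof. by move=> mf; apply: (measurableT_comp mf); exact: measurable_pair1. Qed.

Lemma meas_sec2 f y : measurable_fun setT f -> measurable_fun setT (fun x => f (x, y)).
Proof. by move=> mf; apply: (measurableT_comp mf); exact: measurable_pair2. Qed.

Lemma meas_Rint f : measurable_fun setT f ->
  measurable_fun setT (fun x => \int[Q]_y f (x, y)).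
Proof.
move=> mf; have mEf : measurable_fun setT (EFin \o f) by exact/measurable_EFinP.
apply: (measurableT_comp (fine_measurable _)) => //.
rewrite (_ : (fun x => _) = (fun x => fubini_F Q ((EFin \o f)^\+) x -
    fubini_F Q ((EFin \o f)^\-) x)%E); last first.
  apply/funext => x; rewrite integralE; congr (_ - _)%E.
    by apply: eq_integral => y _; exact: (congr1 (@^~ y) (funepos_comp (EFin \o f) (pair x))).
  by apply: eq_integral => y _; exact: (congr1 (@^~ y) (funeneg_comp (EFin \o f) (pair x))).
apply: emeasurable_funB.
  by apply: measurable_fun_fubini_tonelli_F => //; exact: measurable_funepos.
by apply: measurable_fun_fubini_tonelli_F => //; exact: measurable_funeneg.
Qed.

(** The integrands below have exponential bounds, which factor over independent variables; hence the
    product form of the dominating function. *)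
Lemma igl_prod f (g1 : T1 -> R) (g2 : T2 -> R) : measurable_fun setT f ->
  igl P g1 -> igl Q g2 -> (forall x y, `|f (x, y)| <= g1 x * g2 y) ->
  (forall x, 0 <= g1 x) -> (forall y, 0 <= g2 y) ->
  igl (P \x Q)%E f.
Proof.
move=> mf h1 h2 fg g10 g20.
have mEf : measurable_fun setT (EFin \o f) by exact/measurable_EFinP.
have mA : measurable_fun setT (abse \o (EFin \o f)) by apply: measurableT_comp mEf.
have A0 p : (0 <= (abse \o (EFin \o f)) p)%E by exact: abse_ge0.
apply/integrableP; split => //.
rewrite (fubini_tonelli1 _ mA A0).
apply: (@le_lt_trans _ _ (\int[P]_x (g1 x * \int[Q]_y g2 y)%:E)%E).
  apply: ge0_le_integral => //.
  - by move=> x _; rewrite /fubini_F; apply: integral_ge0 => y _; exact: abse_ge0.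
  - exact: measurable_fun_fubini_tonelli_F.
  - apply/measurable_EFinP; apply: measurable_funM => //; exact: igl_meas h1.
  move=> x _; rewrite EFinM (EFin_Rint h2) -integralZl//.
  apply: ge0_le_integral => //.
  - by apply/measurableT_comp => //; apply/measurable_EFinP; exact: meas_sec1.
  - apply/measurable_EFinP; apply: measurable_funM => //; exact: igl_meas h2.
  - by move=> y _ /=; rewrite lee_fin fg.
have : igl P (fun x => (\int[Q]_y g2 y) * g1 x) by exact: iglZ.
move=> /integrable_lty => /(_ measurableT).
by under eq_integral do rewrite /= mulrC.
Qed.

Lemma Rint_prod f : igl (P \x Q)%E f -> (forall x, igl Q (fun y => f (x, y))) ->
  \int[(P \x Q)%E]_p f p = \int[P]_x \int[Q]_y f (x, y).
Proof.
move=> hf h; rewrite /Rintegral -(integral12_prod_meas1 hf); congr fine.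
by apply: eq_integral => x _; rewrite /fubini_F -EFin_Rint.
Qed.

Lemma Rint_prod21 f : igl (P \x Q)%E f -> (forall y, igl P (fun x => f (x, y))) ->
  \int[(P \x Q)%E]_p f p = \int[Q]_y \int[P]_x f (x, y).
Proof.
move=> hf h; rewrite /Rintegral -(integral21_prod_meas1 hf); congr fine.
by apply: eq_integral => x _; rewrite /fubini_G -EFin_Rint.
Qed.

Lemma Rint_swap f : igl (P \x Q)%E f -> (forall x, igl Q (fun y => f (x, y))) ->
  (forall y, igl P (fun x => f (x, y))) ->
  \int[P]_x \int[Q]_y f (x, y) = \int[Q]_y \int[P]_x f (x, y).
Proof. by move=> hf h1 h2; rewrite -Rint_prod// Rint_prod21. Qed.

Lemma igl_Rint1 f : igl (P \x Q)%E f -> (forall x, igl Q (fun y => f (x, y))) ->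
  igl P (fun x => \int[Q]_y f (x, y)).
Proof.
move=> hf h; apply: eq_integrable (integrable_fubini_F hf) => //.
by move=> x _; rewrite /= EFin_Rint.
Qed.

End fub.

(** * Independent coordinates *)

Section tuple_product.
Context d (T : measurableType d) (R : realType) (P : probability T R).
Local Notation tp := (tuple_prob P).

Let law_cons n (S : set (n.+1.-tuple T)) : measurable S ->
  (P \x tp n)%E ((@tuple_cons d T n) @^-1` S) = tp n.+1 S.
Proof. by []. Qed.

Lemma igl_tupleS n (f : n.+1.-tuple T -> R) : measurable_fun setT f ->
  igl (P \x tp n)%E (fun p => f (tuple_cons p)) -> igl (tp n.+1) f.
Proof.
by move=> mf; apply: (igl_law' (measurable_tuple_cons (n:=n)) (@law_cons n)).
Qed.

Lemma Rint_tupleS n (f : n.+1.-tuple T -> R) : measurable_fun setT f ->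
  \int[tp n.+1]_z f z = \int[(P \x tp n)%E]_p f (tuple_cons p).
Proof. by move=> mf; apply: (Rint_law (measurable_tuple_cons (n:=n)) (@law_cons n)). Qed.

Lemma tuple_prod n (f : 'I_n -> T -> R) : (forall i, igl P (f i)) ->
  igl (tp n) (fun z => \prod_i f i (tnth z i)) /\
  \int[tp n]_z (\prod_i f i (tnth z i)) = \prod_i \int[P]_x f i x.
Proof.
elim: n f => [|n IH] f hf.
  split; first by under eq_fun do rewrite big_ord0; exact: igl_cst.
  by rewrite big_ord0; under eq_Rintegral do rewrite big_ord0; exact: Rint_cst.
have mf i := igl_meas (hf i).
have mprod : measurable_fun setT (fun z : n.+1.-tuple T => \prod_i f i (tnth z i)).
  apply: measurable_prod => i _; apply: (measurableT_comp (mf i)) => //.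
  exact: measurable_tnth.
have [h1 h2] := IH (fun i => f (lift ord0 i)) (fun i => hf _).
have E p : \prod_i f i (tnth (@tuple_cons d T n p) i) =
    f ord0 p.1 * \prod_i f (lift ord0 i) (tnth p.2 i).
  rewrite big_ord_recl; congr (_ * _); apply: eq_bigr => i _.
  by rewrite tnthS.
have ip : igl (P \x tp n)%E
    (fun p => f ord0 p.1 * \prod_i f (lift ord0 i) (tnth p.2 i)).
  apply: (igl_prod _ (igl_norm (hf ord0)) (igl_norm h1)) => //.
    under eq_fun do rewrite -E.
    apply: (measurableT_comp mprod); exact: measurable_tuple_cons.
  by move=> x y; rewrite normrM.
split.
  by apply: igl_tupleS => //; under eq_fun do rewrite E.
rewrite Rint_tupleS//; under eq_Rintegral do rewrite E.
rewrite Rint_prod//=; last by move=> x; exact: iglZ.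
rewrite big_ord_recl -h2.
under eq_Rintegral do rewrite RintZ//.
under eq_Rintegral do rewrite mulrC.
by rewrite RintZ// mulrC.
Qed.

Lemma tnth_prod2 n (f g : T -> R) (i j : 'I_n) : i != j -> igl P f -> igl P g ->
  igl (tp n) (fun z => f (tnth z i) * g (tnth z j)) /\
  \int[tp n]_z (f (tnth z i) * g (tnth z j)) = (\int[P]_x f x) * \int[P]_x g x.
Proof.
move=> ij hf hg.
pose F k := if k == i then f else if k == j then g else fun=> 1.
have hF k : igl P (F k).
  by rewrite /F; case: ifP => // _; case: ifP => // _; exact: igl_cst.
have [h1 h2] := tuple_prod hF.
have E z : \prod_k F k (tnth z k) = f (tnth z i) * g (tnth z j).
  rewrite (bigD1 i)//= (bigD1 j)/=; last by rewrite eq_sym.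
  rewrite big1 ?mulr1; last by move=> k /andP[/negbTE ki /negbTE kj]; rewrite /F ki kj.
  by rewrite /F eqxx (eq_sym j) (negbTE ij) eqxx.
split; first by under eq_fun do rewrite -E.
under eq_Rintegral do rewrite -E.
rewrite h2 (bigD1 i)//= (bigD1 j)/=; last by rewrite eq_sym.
rewrite big1 ?mulr1; last first.
  by move=> k /andP[/negbTE ki /negbTE kj]; rewrite /F ki kj Rint_cst.
by rewrite /F eqxx (eq_sym j) (negbTE ij) eqxx.
Qed.

Lemma igl_tnth n (f : T -> R) (i : 'I_n) : igl P f -> igl (tp n) (fun z => f (tnth z i)).
Proof.
move=> hf; apply: (igl_law (Q := P) (measurable_tnth i)) => // S mS.
exact: tuple_prob_tnth.
Qed.

Lemma Rint_tnth n (f : T -> R) (i : 'I_n) : measurable_fun setT f ->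
  \int[tp n]_z f (tnth z i) = \int[P]_x f x.
Proof.
move=> mf; rewrite -(Rint_law (Q := P) (measurable_tnth i))// => S mS.
exact: tuple_prob_tnth.
Qed.

End tuple_product.

Section iid.
Context d (T : measurableType d) (R : realType) (P : probability T R) (I : finType).
Local Notation gam := (tuple_prob P #|I|).

(** Noise is indexed by a finite type of channels, while [tuple_prob] lives on ordinals; coordinates
    are read through the enumeration. *)
Definition co (z : #|I|.-tuple T) (i : I) : T := tnth z (enum_rank i).

Lemma measurable_co i : measurable_fun setT (co^~ i).
Proof. exact: measurable_tnth. Qed.

Lemma co_prod (f : I -> T -> R) : (forall i, igl P (f i)) ->
  igl gam (fun z => \prod_i f i (co z i)) /\
  \int[gam]_z (\prod_i f i (co z i)) = \prod_i \int[P]_x f i x.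
Proof.
move=> hf; pose f' (k : 'I_#|I|) := f (enum_val k).
have [h1 h2] : _ /\ _ := tuple_prod (f := f') (fun k => hf (enum_val k)).
have bij (F : 'I_#|I| -> R) : \prod_k F k = \prod_i F (enum_rank i).
  by rewrite (reindex (@enum_rank I))//; apply: onW_bij; exact: enum_rank_bij.
have E z : \prod_i f i (co z i) = \prod_k f (enum_val k) (tnth z k).
  by rewrite bij; apply: eq_bigr => i _; rewrite enum_rankK.
split; first by under eq_fun do rewrite E.
under eq_Rintegral do rewrite E.
by rewrite h2 bij; apply: eq_bigr => i _; rewrite /f' enum_rankK.
Qed.

Lemma igl_co (f : T -> R) i : igl P f -> igl gam (fun z => f (co z i)).
Proof. exact: igl_tnth. Qed.

Lemma Rint_co (f : T -> R) i : measurable_fun setT f ->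
  \int[gam]_z f (co z i) = \int[P]_x f x.
Proof. exact: Rint_tnth. Qed.

Lemma Rint_co2 (f g : T -> R) i j : i != j -> igl P f -> igl P g ->
  igl gam (fun z => f (co z i) * g (co z j)) /\
  \int[gam]_z (f (co z i) * g (co z j)) = (\int[P]_x f x) * \int[P]_x g x.
Proof. by move=> ij; apply: tnth_prod2; rewrite (inj_eq enum_rank_inj). Qed.

End iid.

(** The interpolation sees the noise only through these three properties. Symmetry gives the mean,
    the shift gives the Laplace transform and with it all exponential moments, and stability under
    rotation splits a channel into two independent ones. *)
Record gaussian_law (R : realType) (g : probability R R) : Prop := GaussianLaw {
  gaussian_sym : forall f : R -> \bar R, measurable_fun setT f ->
    (forall x, 0 <= f x)%E -> (\int[g]_z f (- z)%R = \int[g]_z f z)%E;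
  gaussian_shift : forall (c : R) (f : R -> \bar R), measurable_fun setT f ->
    (forall x, 0 <= f x)%E ->
    (\int[g]_z f (z + c)%R = \int[g]_z (f z * (expR (c * z - c ^+ 2 / 2))%:E))%E;
  gaussian_add : forall (a b : R) (A : set R), 0 < a -> a ^+ 2 + b ^+ 2 = 1 ->
    measurable A -> (g \x g)%E [set p | A (a * p.1 + b * p.2)%R] = g A }.

Section std_gauss.
Context (R : realType).

Definition mid (x : measurableTypeR R) : R := x.

Lemma measurable_mid : measurable_fun setT mid. Proof. by move=> _ A mA; rewrite setTI. Qed.

HB.instance Definition _ := isMeasurableFun.Build _ _ _ _ mid measurable_mid.

(** [normal_prob 0 1] lives on [measurableTypeR R]; its image under the identity
    is a probability on the canonical measurable space [R]. *)
Definition std_gauss : probability R R :=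
  distribution (normal_prob 0 1 : probability (measurableTypeR R) R) mid.

Lemma ge0_integral_std_gauss (f : R -> \bar R) : measurable_fun setT f ->
  (forall x, 0 <= f x)%E -> (\int[std_gauss]_z f z = \int[normal_prob 0 1]_z f z)%E.
Proof. by move=> mf f0; rewrite ge0_integral_distribution. Qed.

Lemma std_gauss_law : gaussian_law std_gauss.
Proof.
split.
- move=> f mf f0; rewrite !ge0_integral_std_gauss//; first exact: normal_sym.
  by apply: (measurableT_comp mf); exact: oppr_measurable.
- move=> c f mf f0; rewrite !ge0_integral_std_gauss//; first exact: normal_shift.
  + apply: emeasurable_funM => //; apply/measurable_EFinP; apply: measurableT_comp => //.
    by apply: measurable_funD => //; apply: measurable_funM.
  + by move=> x; rewrite mule_ge0// lee_fin expR_ge0.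
  + by apply: (measurableT_comp mf); apply: measurable_funD.
- move=> a b A a0 ab mA; rewrite [RHS](_ : _ = normal_prob 0 1 A)// -(normal_add a0 ab mA).
  have mfun : measurable_fun setT (fun p : R * R => a * p.1 + b * p.2).
    by apply: measurable_funD; apply: measurable_funM => //.
  have mS : measurable [set p : R * R | A (a * p.1 + b * p.2)%R].
    by rewrite -[X in measurable X]setTI; exact: mfun.
  have mI : measurable_fun setT (fun p : R * R => (\1_[set p | A (a * p.1 + b * p.2)] p : R)%:E).
    by apply/measurable_EFinP; exact: measurable_indic.
  have i0 p : (0 <= (\1_[set p | A (a * p.1 + b * p.2)] p : R)%:E)%E by [].
  rewrite (prod_prob_swap _ _ mS) ge0_integral_std_gauss; last 2 first.
  + exact: (@measurable_fun_fubini_tonelli_G _ _ _ _ _ std_gauss _ mI i0).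
  + by move=> z; apply: integral_ge0 => w _; exact: (i0 (w, z)).
  apply: etrans (esym (prod_prob_swap (normal_prob 0 1 : probability (measurableTypeR R) R)
    (normal_prob 0 1 : probability (measurableTypeR R) R) mS)).
  apply: eq_integral => z _; rewrite ge0_integral_std_gauss//.
  by apply: (measurableT_comp mI); exact: measurable_pair2.
Qed.

End std_gauss.

(** * Moments of a Gaussian law *)

Section gaussian_moments.
Context (R : realType) (g : probability R R) (hg : gaussian_law g).

(** The shift property applied to a constant function. *)
Lemma gaussian_exp (c : R) : igl g (fun z => expR (c * z)) /\
  \int[g]_z expR (c * z) = expR (c ^+ 2 / 2).
Proof.
have mexp : measurable_fun setT (fun z : R => expR (c * z)).
  by apply: measurableT_comp => //; apply: measurable_funM.
have E : (\int[g]_z (expR (c * z))%:E = (expR (c ^+ 2 / 2))%:E)%E.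
  have := gaussian_shift hg c (f := cst (expR (c ^+ 2 / 2))%:E)%E.
  rewrite integral_cst//; have := probability_setT g; rewrite /= => ->.
  rewrite mule1 => -> //.
  by apply: eq_integral => z _; rewrite /= -EFinM -expRD; congr (expR _)%:E; ring.
have E' : \int[g]_z expR (c * z) = expR (c ^+ 2 / 2) by rewrite /Rintegral E.
split => //.
by apply: ge0_igl => //; rewrite E ltry.
Qed.

Lemma igl_exp_abs (c : R) : igl g (fun z => expR (c * `|z|)).
Proof.
apply: (igl_dom (g := fun z => expR (c * z) + expR (- c * z))).
- by apply: measurableT_comp => //; apply: measurable_funM => //; exact: measurableT_comp.
- by apply: iglD; exact: (gaussian_exp _).1.
move=> z; rewrite ger0_norm ?expR_ge0//; have [z0|z0] := leP 0 z.
  by rewrite (ger0_norm z0) lerDl expR_ge0.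
by rewrite (ltr0_norm z0) mulrN -mulNr lerDr expR_ge0.
Qed.

Lemma abs_le_exp (u : R) : `|u| <= expR `|u|.
Proof. by apply: le_trans (expR_ge1Dx _); rewrite lerDr. Qed.

Lemma igl_id : igl g id.
Proof.
apply: (igl_dom _ (igl_exp_abs 1)) => //.
by move=> z /=; rewrite mul1r abs_le_exp.
Qed.

Lemma igl_sqr : igl g (fun z => z ^+ 2).
Proof.
apply: (igl_dom _ (igl_exp_abs 2)) => //.
move=> z; rewrite normrX expr2 -[X in expR (X * _)]/(1 + 1) mulrDl mul1r expRD.
by apply: ler_pM => //; exact: abs_le_exp.
Qed.

Lemma gaussian_mean : \int[g]_z z = 0.
Proof.
have E : (\int[g]_z (z%:E) = \int[g]_z (- z)%:E)%E.
  have mp : measurable_fun setT ((@EFin R)^\+)%E by exact: measurable_funepos.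
  have mn : measurable_fun setT ((@EFin R)^\-)%E by exact: measurable_funeneg.
  rewrite [LHS]integralE [RHS]integralE; congr (_ - _)%E.
    rewrite -(gaussian_sym hg mp (fun x => funepos_ge0 _ x)).
    by apply: eq_integral => x _; exact: (esym (congr1 (@^~ x) (funepos_comp _ -%R))).
  rewrite -(gaussian_sym hg mn (fun x => funeneg_ge0 _ x)).
  by apply: eq_integral => x _; exact: (esym (congr1 (@^~ x) (funeneg_comp _ -%R))).
have : \int[g]_z z = \int[g]_z (- 1 * z).
  by rewrite /Rintegral; under [in RHS]eq_integral do rewrite mulN1r; rewrite E.
rewrite RintZ; last exact: igl_id.
by move=> h; lra.
Qed.

(** Expand both sides of [\int[g]_z expR (c * z) = expR (c ^+ 2 / 2)] to second order in [c]. The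
    coefficients [m / 2] and [1 / 2] differ by at most a multiple of [c], for every small [c]. *)
Lemma gaussian_var : \int[g]_z z ^+ 2 = 1.
Proof.
set m := \int[g]_z _.
(* The exponent 4 is 3 + 1: the cube of [|z|] costs [expR (3 * |z|)] and the exponential factor of
   the Taylor remainder one more [expR |z|], as [c <= 1]. *)
set D := \int[g]_z expR (4 * `|z|).
set E1 : R := expR 1.
have key c : 0 < c -> c <= 1 -> `|m - 1| <= c * (2 * (D + E1)).
  move=> c0 c1.
  have [ie Ee] := gaussian_exp c.
  pose r (z : R) := expR (c * z) - 1 - c * z - (c * z) ^+ 2 / 2.
  have iq : igl g (fun z => c ^+ 2 / 2 * z ^+ 2) by exact: iglZ igl_sqr.
  have il : igl g (fun z => c * z) by exact: iglZ igl_id.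
  have ir : igl g r.
    rewrite /r; apply: iglB; first by apply: iglB => //; apply: iglB => //; exact: igl_cst.
    by under eq_fun do rewrite exprMn mulrAC.
  have Er : \int[g]_z r z = expR (c ^+ 2 / 2) - 1 - c ^+ 2 / 2 * m.
    rewrite /r RintB; last 2 first.
    - by apply: iglB => //; apply: iglB => //; exact: igl_cst.
    - by under eq_fun do rewrite exprMn mulrAC.
    rewrite RintB//; last by apply: iglB => //; exact: igl_cst.
    rewrite RintB//; last exact: igl_cst.
    rewrite Rint_cst RintZ; last exact: igl_id.
    rewrite gaussian_mean mulr0 subr0 Ee; congr (_ - _).
    by under eq_Rintegral do rewrite exprMn mulrAC; rewrite RintZ//; exact: igl_sqr.
  have br : `|\int[g]_z r z| <= c ^+ 3 * D.
    rewrite -RintZ; last exact: igl_exp_abs.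
    apply: norm_Rint => //; first by apply: iglZ; exact: igl_exp_abs.
    move=> z; apply: le_trans (expR_third _) _.
    rewrite normrM (gtr0_norm c0) exprMn -mulrA ler_pM2l ?exprn_gt0//.
    rewrite (_ : 4 * `|z| = 3%:R * `|z| + `|z|); last by ring.
    rewrite expRD expRM_natl; apply: ler_pM => //.
    - by rewrite lerXn2r// ?nnegrE ?expR_ge0// abs_le_exp.
    - by rewrite ler_expR ler_piMl.
  have bc : `|expR (c ^+ 2 / 2) - 1 - c ^+ 2 / 2| <= c ^+ 3 * E1.
    have c20 : 0 <= c ^+ 2 by exact: sqr_ge0.
    have c21 : c ^+ 2 <= 1 by rewrite exprn_ile1// ltW.
    have /andP[h0 h1] := expR_second (c ^+ 2 / 2); rewrite ger0_norm//.
    apply: le_trans h1 _; apply: ler_pM => //.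
    - exact: sqr_ge0.
    - have h : c ^+ 3 * (1 - c / 4) >= 0 by rewrite mulr_ge0 ?exprn_ge0 ?(ltW c0)//; lra.
      by move: h; rewrite (_ : (c ^+ 2 / 2) ^+ 2 = c ^+ 3 * (c / 4)); [lra|field].
    - rewrite ler_expR ger0_norm; lra.
  have c2 : 0 < c ^+ 2 / 2 by rewrite divr_gt0// exprn_gt0.
  have : c ^+ 2 / 2 * `|m - 1| <= c ^+ 3 * (D + E1).
    have -> : c ^+ 2 / 2 * `|m - 1| = `|c ^+ 2 / 2 * (m - 1)|.
      by rewrite normrM (gtr0_norm c2).
    have -> : c ^+ 2 / 2 * (m - 1) = (expR (c ^+ 2 / 2) - 1 - c ^+ 2 / 2) - \int[g]_z r z.
      by rewrite Er; ring.
    rewrite mulrDr; apply: le_trans (ler_normB _ _) _.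
    by rewrite [leLHS]addrC; apply: lerD.
  move=> hm; rewrite -(ler_pM2l c2); apply: le_trans hm _.
  by rewrite (_ : c ^+ 2 / 2 * (c * (2 * (D + E1))) = c ^+ 3 * (D + E1))//; field.
have D0 : 0 <= D by apply: Rintegral_ge0 => z _; exact: expR_ge0.
apply/eqP; rewrite -subr_eq0 -normr_le0 leNgt; apply/negP => h.
(* Chosen so that the bound [c * (2 * (D + E1))] is at most half of [|m - 1|]. *)
pose c := Num.min 1 (`|m - 1| / (4 * (D + E1))).
have D1 : 0 < D + E1 by rewrite ltr_wpDl// expR_gt0.
have c0 : 0 < c.
  by rewrite /c lt_min ltr01 /=; apply: divr_gt0; [exact: h|rewrite mulr_gt0 ?ltr0n].
have := key c c0; rewrite [c <= 1]ge_min lexx => /(_ isT).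
apply/negP; rewrite -ltNge.
apply: (@le_lt_trans _ _ (`|m - 1| / (4 * (D + E1)) * (2 * (D + E1)))).
  by rewrite ler_wpM2r ?mulr_ge0 ?(ltW D1)// /c ge_min lexx orbT.
rewrite (_ : _ * _ = `|m - 1| / 2); last by field; exact: lt0r_neq0.
by rewrite ltr_pdivrMr// ltr_pMr// (_ : 2 = 1 + 1)// ltrDl.
Qed.

End gaussian_moments.

(** * Gaussian vectors: translation and rotation *)

Section gaussian_tuple.
Context (R : realType) (g : probability R R) (hg : gaussian_law g).

Definition shift_tuple n (c : 'I_n -> R) (z : n.-tuple R) : n.-tuple R :=
  [tuple tnth z k + c k | k < n].

Lemma measurable_shift_tuple n (c : 'I_n -> R) : measurable_fun setT (shift_tuple c).
Proof.
apply/measurable_fun_tnthP => i.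
rewrite (_ : _ \o _ = fun z : n.-tuple R => tnth z i + c i); last first.
  by apply/funext => z /=; rewrite tnth_mktuple.
by apply: measurable_funD => //; exact: measurable_tnth.
Qed.

Definition shift_dens n (c : 'I_n -> R) (z : n.-tuple R) : R :=
  expR (\sum_k (c k * tnth z k - c k ^+ 2 / 2)).

Lemma measurable_shift_dens n (c : 'I_n -> R) : measurable_fun setT (shift_dens c).
Proof.
apply: measurableT_comp => //; apply: measurable_sum => k.
by apply: measurable_funD => //; apply: measurable_funM => //; exact: measurable_tnth.
Qed.

Lemma ge0_tuple_shift n (c : 'I_n -> R) (F : n.-tuple R -> \bar R) :
  measurable_fun setT F -> (forall z, 0 <= F z)%E ->
  (\int[tuple_prob g n]_z F (shift_tuple c z) =
   \int[tuple_prob g n]_z (F z * (shift_dens c z)%:E))%E.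
Proof.
elim: n c F => [|n IH] c F mF F0.
  apply: eq_integral => z _; rewrite /shift_dens big_ord0 expR0 mule1.
  by congr F; apply: eq_from_tnth => -[].
pose c' (k : 'I_n) := c (lift ord0 k).
have mFs := measurableT_comp mF (measurable_shift_tuple c).
have mFd : measurable_fun setT (fun z => F z * (shift_dens c z)%:E)%E.
  by apply: emeasurable_funM => //; apply/measurable_EFinP; exact: measurable_shift_dens.
have Es x y : shift_tuple c (tuple_cons (x, y)) = tuple_cons (x + c ord0, shift_tuple c' y).
  apply: eq_from_tnth => k; rewrite tnth_mktuple; case: (unliftP ord0 k) => [j ->|->].
    by rewrite !tnthS tnth_mktuple.
  by rewrite !tnth0.
have Ed x y : shift_dens c (tuple_cons (x, y)) =
    expR (c ord0 * x - c ord0 ^+ 2 / 2) * shift_dens c' y.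
  rewrite /shift_dens -expRD big_ord_recl; congr expR; congr (_ + _).
  by apply: eq_bigr => k _; rewrite tnthS.
have mFx x : measurable_fun setT (fun y : n.-tuple R => F (tuple_cons (x, y))).
  apply: (measurableT_comp mF); apply: (measurableT_comp (@measurable_tuple_cons _ _ n)).
  exact: measurable_pair1.
have mdE : measurable_fun setT (fun y => (shift_dens c' y)%:E).
  by apply/measurable_EFinP; exact: measurable_shift_dens.
pose G (x : R) := (\int[tuple_prob g n]_y (F (tuple_cons (x, y)) * (shift_dens c' y)%:E))%E.
have G0 x : (0 <= G x)%E.
  by apply: integral_ge0 => y _; rewrite mule_ge0// lee_fin expR_ge0.
have mG : measurable_fun setT G.
  apply: (@measurable_fun_fubini_tonelli_F _ _ _ _ _ (tuple_prob g n)
    (fun p => F (tuple_cons p) * (shift_dens c' p.2)%:E)%E).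
    apply: emeasurable_funM; first by apply: (measurableT_comp mF); exact: measurable_tuple_cons.
    by apply: (measurableT_comp mdE); exact: measurable_snd.
  by move=> p; rewrite mule_ge0// lee_fin expR_ge0.
rewrite (ge0_integral_tupleS g mFs (fun z => F0 _)).
have Fd0 z : (0 <= F z * (shift_dens c z)%:E)%E by rewrite mule_ge0// lee_fin expR_ge0.
rewrite (ge0_integral_tupleS g mFd Fd0).
transitivity (\int[g]_x G (x + c ord0)%R)%E.
  apply: eq_integral => x _.
  rewrite /G -(IH c' (fun y => F (tuple_cons (x + c ord0, y))) (mFx _) (fun y => F0 _)).
  by apply: eq_integral => y _; exact: (congr1 F (Es x y)).
apply: etrans (gaussian_shift hg (c ord0) mG G0) _; apply: eq_integral => x _.
have k0 : (0 <= (expR (c ord0 * x - c ord0 ^+ 2 / 2))%:E)%E by rewrite lee_fin expR_ge0.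
have mGx : measurable_fun setT (fun y => F (tuple_cons (x, y)) * (shift_dens c' y)%:E)%E.
  exact: emeasurable_funM.
have Gx0 y : (0 <= F (tuple_cons (x, y)) * (shift_dens c' y)%:E)%E.
  by rewrite mule_ge0// lee_fin expR_ge0.
apply: etrans (esym (ge0_integralZr (tuple_prob g n) measurableT mGx (fun y _ => Gx0 y) k0)) _.
by apply: eq_integral => y _; rewrite Ed -muleA -EFinM mulrC.
Qed.

Lemma Rint_tuple_shift n (c : 'I_n -> R) (F : n.-tuple R -> R) : measurable_fun setT F ->
  \int[tuple_prob g n]_z F (shift_tuple c z) =
  \int[tuple_prob g n]_z (F z * shift_dens c z).
Proof.
move=> mF; rewrite /Rintegral; congr fine.
have mE : measurable_fun setT (EFin \o F) by exact/measurable_EFinP.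
rewrite [LHS]integralE [RHS]integralE; congr (_ - _)%E.
- transitivity (\int[tuple_prob g n]_z ((EFin \o F)^\+ (shift_tuple c z)))%E.
    by apply: eq_integral => z _; exact: (congr1 (@^~ z) (funepos_comp (EFin \o F) (shift_tuple c))).
  rewrite (ge0_tuple_shift c (measurable_funepos mE) (fun x => funepos_ge0 _ x)).
  apply: eq_integral => z _; rewrite !funeposE -!EFin_max -EFinM; congr EFin.
  by rewrite maxr_pMl ?expR_ge0// mul0r.
- transitivity (\int[tuple_prob g n]_z ((EFin \o F)^\- (shift_tuple c z)))%E.
    by apply: eq_integral => z _; exact: (congr1 (@^~ z) (funeneg_comp (EFin \o F) (shift_tuple c))).
  rewrite (ge0_tuple_shift c (measurable_funeneg mE) (fun x => funeneg_ge0 _ x)).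
  apply: eq_integral => z _; rewrite !funenegE -!EFinN -!EFin_max -EFinM; congr EFin.
  by rewrite maxr_pMl ?expR_ge0// mul0r mulNr.
Qed.

Definition comb_tuple n (a b : 'I_n -> R) (p : n.-tuple R * n.-tuple R) : n.-tuple R :=
  [tuple a k * tnth p.1 k + b k * tnth p.2 k | k < n].

Lemma measurable_comb_tuple n (a b : 'I_n -> R) : measurable_fun setT (comb_tuple a b).
Proof.
apply/measurable_fun_tnthP => i.
rewrite (_ : _ \o _ = fun p : n.-tuple R * n.-tuple R => a i * tnth p.1 i + b i * tnth p.2 i); last first.
  by apply/funext => z /=; rewrite tnth_mktuple.
apply: measurable_funD; apply: measurable_funM => //.
  by apply: (measurableT_comp (measurable_tnth i)); exact: measurable_fst.
by apply: (measurableT_comp (measurable_tnth i)); exact: measurable_snd.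
Qed.

(** The case [a = 0] occurs when a step raises a channel from signal-to-noise ratio zero; then
    [b >= 0] forces [b = 1]. *)
Lemma gaussian_add0 (a b : R) (A : set R) : 0 <= a -> 0 <= b -> a ^+ 2 + b ^+ 2 = 1 ->
  measurable A -> (g \x g)%E [set p | A (a * p.1 + b * p.2)%R] = g A.
Proof.
rewrite le_eqVlt => /predU1P[<-|a0] b0 ab mA; last exact: gaussian_add.
have -> : b = 1.
  move: ab; rewrite expr0n/= add0r => /eqP; rewrite sqrf_eq1 => /orP[/eqP//|/eqP b1].
  by move: b0; rewrite b1 oppr_ge0 ler10.
rewrite (_ : [set _ | _] = setT `*` A); last first.
  by apply/seteqP; split => -[x y] /=; rewrite mul0r add0r mul1r; tauto.
by rewrite product_measure1E//; have := probability_setT g; rewrite /= => ->; rewrite mul1e.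
Qed.

(** A pair of tuples has the law of an unzipped i.i.d. tuple of pairs. On the latter the combination
    acts coordinatewise, so boxes pull back to boxes and the scalar statement applies to each
    side. *)
Lemma comb_tuple_law n (a b : 'I_n -> R) : (forall k, 0 <= a k) -> (forall k, 0 <= b k) ->
  (forall k, a k ^+ 2 + b k ^+ 2 = 1) ->
  forall S, measurable S ->
  (tuple_prob g n \x tuple_prob g n)%E (comb_tuple a b @^-1` S) = tuple_prob g n S.
Proof.
move=> a0 b0 ab S mS.
pose Q := (g \x g)%E.
pose unz (z : n.-tuple (R * R)) : n.-tuple R * n.-tuple R :=
  ([tuple (tnth z k).1 | k < n], [tuple (tnth z k).2 | k < n]).
have munz : measurable_fun setT unz.
  apply/measurable_fun_pair; apply/measurable_fun_tnthP => i.
    rewrite (_ : _ \o _ = fun z : n.-tuple (R * R) => (tnth z i).1); last first.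
      by apply/funext => z /=; rewrite tnth_mktuple.
    by apply: (measurableT_comp measurable_fst); exact: measurable_tnth.
  rewrite (_ : _ \o _ = fun z : n.-tuple (R * R) => (tnth z i).2); last first.
    by apply/funext => z /=; rewrite tnth_mktuple.
  by apply: (measurableT_comp measurable_snd); exact: measurable_tnth.
pose mun : {mfun n.-tuple (R * R) >-> (n.-tuple R * n.-tuple R)%type} :=
  HB.pack unz (isMeasurableFun.Build _ _ _ _ unz munz).
pose mcm : {mfun (n.-tuple R * n.-tuple R)%type >-> n.-tuple R} :=
  HB.pack (comb_tuple a b) (isMeasurableFun.Build _ _ _ _ _ (measurable_comb_tuple a b)).
pose m1 := distribution (tuple_prob Q n) mun.
have L1 U : measurable U -> m1 U = (tuple_prob g n \x tuple_prob g n)%E U.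
  apply: tuple_prob2_law; first by have := probability_setT m1; rewrite /= => ->; rewrite ltry.
  move=> A B mA mB.
  rewrite -[LHS]/(tuple_prob Q n (unz @^-1` (box A `*` box B))).
  rewrite (_ : _ @^-1` _ = box (fun k => A k `*` B k)).
    rewrite tuple_prob_box; last by move=> k; exact: measurableX.
    rewrite -big_split/=; apply: eq_bigr => k _.
    by rewrite /Q product_measure1E.
  apply/seteqP; split => z /= h.
    by move=> k; have [/(_ k) + /(_ k)] := h; rewrite !tnth_mktuple.
  by split=> k; rewrite tnth_mktuple; have [] := h k.
have mcS : measurable (comb_tuple a b @^-1` S).
  by rewrite -[X in measurable X]setTI; exact: measurable_comb_tuple.
rewrite -L1//.
pose m2 := distribution m1 mcm.
rewrite -[LHS]/(m2 S); apply: tuple_prob_law => // A mA.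
rewrite -[LHS]/(tuple_prob Q n (unz @^-1` (comb_tuple a b @^-1` box A))).
rewrite (_ : _ @^-1` _ = box (fun k => [set p : R * R | A k (a k * p.1 + b k * p.2)])).
  rewrite tuple_prob_box.
    by apply: eq_bigr => k _; exact: (gaussian_add0 (a0 k) (b0 k) (ab k) (mA k)).
  move=> k; rewrite -[X in measurable X]setTI.
  have : measurable_fun setT (fun p : R * R => a k * p.1 + b k * p.2).
    by apply: measurable_funD; apply: measurable_funM => //.
  by apply.
by apply/seteqP; split => z /= h k; have := h k; rewrite !tnth_mktuple.
Qed.

End gaussian_tuple.

Section gaussian_family.
Context (R : realType) (g : probability R R) (hg : gaussian_law g) (I : finType).
Local Notation gam := (tuple_prob g #|I|).
Implicit Types (z : #|I|.-tuple R) (u : I -> R).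

Definition absum z : R := \sum_i `|co z i|.

Lemma absum_ge0 z : 0 <= absum z. Proof. by apply: sumr_ge0 => i _. Qed.

Lemma igl_exp_absum (C : R) : igl gam (fun z => expR (C * absum z)).
Proof.
have [h _] := co_prod (I := I) (f := fun=> fun x : R => expR (C * `|x|)) (fun=> igl_exp_abs hg C).
by under eq_fun do rewrite /absum mulr_sumr expR_sum.
Qed.

Lemma igl_gam_lin u : igl gam (fun z => \sum_i co z i * u i).
Proof.
apply: igl_sum => i; under eq_fun do rewrite mulrC; apply: iglZ.
exact: (igl_co i (igl_id hg)).
Qed.

Lemma gam_lin u : \int[gam]_z (\sum_i co z i * u i) = 0.
Proof.
have ic i := igl_co (P := g) i (igl_id hg).
rewrite Rint_sum; last by move=> i; under eq_fun do rewrite mulrC; exact: iglZ.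
rewrite big1// => i _; under eq_Rintegral do rewrite mulrC.
by rewrite RintZ// (@Rint_co _ _ _ g I id i)// gaussian_mean// mulr0.
Qed.

Lemma gam_cov i j : igl gam (fun z => co z i * co z j) /\
  \int[gam]_z (co z i * co z j) = (i == j)%:R.
Proof.
have [<-|ij] := eqVneq i j.
  split; first by under eq_fun do rewrite -expr2; exact: (igl_co i (igl_sqr hg)).
  under eq_Rintegral do rewrite -expr2.
  by rewrite (@Rint_co _ _ _ g I (fun x => x ^+ 2) i)//; exact: gaussian_var.
have [h1 h2] := Rint_co2 ij (igl_id hg) (igl_id hg).
by split => //; rewrite h2 gaussian_mean// mul0r.
Qed.

Lemma igl_gam_quad (m : I -> I -> R) : igl gam (fun z => \sum_i \sum_j co z i * co z j * m i j).
Proof.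
apply: igl_sum => i; apply: igl_sum => j; under eq_fun do rewrite mulrC.
by apply: iglZ; have [] := gam_cov i j.
Qed.

Lemma gam_quad (m : I -> I -> R) :
  \int[gam]_z (\sum_i \sum_j co z i * co z j * m i j) = \sum_i m i i.
Proof.
have ic i j : igl gam (fun z => co z i * co z j * m i j).
  by under eq_fun do rewrite mulrC; apply: iglZ; have [] := gam_cov i j.
rewrite Rint_sum; last by move=> i; exact: igl_sum.
apply: eq_bigr => i _; rewrite Rint_sum// (bigD1 i)//= big1 ?addr0 => [|j ji].
  under eq_Rintegral do rewrite mulrC; have [h1 h2] := gam_cov i i.
  by rewrite RintZ// h2 eqxx mulr1.
under eq_Rintegral do rewrite mulrC; have [h1 h2] := gam_cov i j.
by rewrite RintZ// h2 eq_sym (negbTE ji) mulr0.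
Qed.

End gaussian_family.

(** * Gibbs averages *)

Section gibbs.
Context d (T : measurableType d) (R : realType) (M : probability T R).
Implicit Types f h w : T -> R.

Definition bmf f := measurable_fun setT f /\ exists C : R, forall x, `|f x| <= C.
Definition ex h : R := \int[M]_x expR (h x).
Definition gibbs h f : R := (\int[M]_x (f x * expR (h x))) / ex h.

Lemma bmf_igl f : bmf f -> igl M f.
Proof. by move=> [mf [C hC]]; exact: igl_bound hC. Qed.

Lemma bmf_cst (c : R) : bmf (fun=> c).
Proof. by split => //; exists `|c|. Qed.

Lemma bmfD f h : bmf f -> bmf h -> bmf (fun x => f x + h x).
Proof.
move=> [mf [C hC]] [mh [D hD]]; split; first exact: measurable_funD.
by exists (C + D) => x; apply: le_trans (ler_normD _ _) _; exact: lerD.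
Qed.

Lemma bmfM f h : bmf f -> bmf h -> bmf (fun x => f x * h x).
Proof.
move=> [mf [C hC]] [mh [D hD]]; split; first exact: measurable_funM.
by exists (C * D) => x; rewrite normrM ler_pM.
Qed.

Lemma bmfZ (c : R) f : bmf f -> bmf (fun x => c * f x).
Proof. by apply: bmfM; exact: bmf_cst. Qed.

Lemma bmfB f h : bmf f -> bmf h -> bmf (fun x => f x - h x).
Proof.
by move=> hf hh; under eq_fun do rewrite -mulN1r; apply: bmfD => //; exact: bmfZ.
Qed.

Lemma bmf_sum (I : Type) (s : seq I) (F : I -> T -> R) :
  (forall i, bmf (F i)) -> bmf (fun x => \sum_(i <- s) F i x).
Proof.
move=> h; elim: s => [|i s IH]; first by under eq_fun do rewrite big_nil; exact: bmf_cst.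
by under eq_fun do rewrite big_cons; exact: bmfD.
Qed.

Lemma bmf_expR f : bmf f -> bmf (fun x => expR (f x)).
Proof.
move=> [mf [C hC]]; split; first exact: measurableT_comp.
exists (expR C) => x; rewrite ger0_norm ?expR_ge0// ler_expR.
by apply: le_trans (hC x); exact: ler_norm.
Qed.

Lemma bmfX f n : bmf f -> bmf (fun x => f x ^+ n).
Proof.
move=> hf; elim: n => [|n IH]; first by under eq_fun do rewrite expr0; exact: bmf_cst.
by under eq_fun do rewrite exprS; exact: bmfM.
Qed.

Lemma ex_gt0 h : bmf h -> 0 < ex h.
Proof.
by move=> hh; apply: Rint_gt0 => [|x]; [exact: bmf_igl (bmf_expR hh)|exact: expR_gt0].
Qed.

Section fixed_h.
Context (h : T -> R) (bh : bmf h).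

Let ig f : bmf f -> igl M (fun x => f x * expR (h x)).
Proof. by move=> bf; apply: bmf_igl; apply: bmfM => //; exact: bmf_expR. Qed.

Lemma gibbs_cst (c : R) : gibbs h (fun=> c) = c.
Proof.
rewrite /gibbs RintZ; last exact: bmf_igl (bmf_expR bh).
by rewrite mulfK// gt_eqF// ex_gt0.
Qed.

Lemma gibbsD f1 f2 : bmf f1 -> bmf f2 ->
  gibbs h (fun x => f1 x + f2 x) = gibbs h f1 + gibbs h f2.
Proof.
move=> b1 b2; rewrite /gibbs -mulrDl -RintD; [|exact: ig..].
by under eq_Rintegral do rewrite mulrDl.
Qed.

Lemma gibbsZ (c : R) f : bmf f -> gibbs h (fun x => c * f x) = c * gibbs h f.
Proof.
move=> bf; rewrite /gibbs mulrA -RintZ; last exact: ig.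
by under eq_Rintegral do rewrite -mulrA.
Qed.

Lemma gibbsB f1 f2 : bmf f1 -> bmf f2 ->
  gibbs h (fun x => f1 x - f2 x) = gibbs h f1 - gibbs h f2.
Proof.
move=> b1 b2; rewrite /gibbs -mulrBl -RintB; [|exact: ig..].
by under eq_Rintegral do rewrite mulrBl.
Qed.

Lemma gibbs_sum (I : Type) (s : seq I) (F : I -> T -> R) : (forall i, bmf (F i)) ->
  gibbs h (fun x => \sum_(i <- s) F i x) = \sum_(i <- s) gibbs h (F i).
Proof.
move=> bF; elim: s => [|i s IH].
  by rewrite big_nil; under eq_fun do rewrite big_nil; exact: gibbs_cst.
rewrite big_cons -IH -gibbsD//; last exact: bmf_sum.
by congr gibbs; apply/funext => x; rewrite big_cons.
Qed.

Lemma le_gibbs f1 f2 : bmf f1 -> bmf f2 -> (forall x, f1 x <= f2 x) ->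
  gibbs h f1 <= gibbs h f2.
Proof.
move=> b1 b2 le12; rewrite ler_pM2r ?invr_gt0 ?ex_gt0//.
by apply: le_Rint; [exact: ig..|move=> x; rewrite ler_wpM2r ?expR_ge0].
Qed.

Lemma gibbs_norm_le f (C : R) : bmf f -> (forall x, `|f x| <= C) -> `|gibbs h f| <= C.
Proof.
move=> bf fC; rewrite ler_norml; apply/andP; split.
  rewrite -[leLHS]gibbs_cst; apply: le_gibbs => //; first exact: bmf_cst.
  by move=> x; have := fC x; rewrite ler_norml => /andP[].
rewrite -[leRHS](gibbs_cst C); apply: le_gibbs => //; first exact: bmf_cst.
by move=> x; have := fC x; rewrite ler_norml => /andP[].
Qed.

(** Adding a field to the Hamiltonian multiplies the partition function by a Gibbs average. This is
    the multiplicative structure on which the interpolation rests. *)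
Lemma ex_add w : bmf w -> ex (fun x => h x + w x) = ex h * gibbs h (fun x => expR (w x)).
Proof.
move=> bw; rewrite /gibbs mulrCA divff ?mulr1 ?gt_eqF ?ex_gt0//.
by rewrite /ex; under eq_Rintegral do rewrite addrC expRD.
Qed.

Lemma gibbs_ge0 f : (forall x, 0 <= f x) -> 0 <= gibbs h f.
Proof.
move=> f0; rewrite divr_ge0 ?(ltW (ex_gt0 bh))//; apply: Rintegral_ge0 => x _.
by rewrite mulr_ge0 ?expR_ge0.
Qed.

End fixed_h.
End gibbs.

(** * Gaussian interpolation *)

Section entropy_step.
Context (R : realType).

(** [false]: the free energy [E ln L]; [true]: the relative entropy [E[L ln L]]. *)
Definition phi (b : bool) (u : R) : R := if b then u * ln u else ln u.
Definition sg (b : bool) : R := if b then 1 else - 1.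
Definition wt (b : bool) (u : R) : R := if b then u else 1.

(** Chain rule: [u] will be the partition function before a step and [v] the fresh factor, whose
    weight [wt b v] has mean 1. *)
Lemma phi_mul b (u v : R) : 0 < u -> 0 < v ->
  phi b (u * v) = wt b v * phi b u + wt b u * phi b v.
Proof.
move=> u0 v0; case: b => /=; rewrite lnM ?posrE//.
  by ring.
by ring.
Qed.

(** Here [e] bounds the exponent, and [w1], [w2] are its first two moments. With [l = ln U], up to
    third order [l = w1 + w2 / 2 - w1 ^+ 2 / 2] while [U * ln U = l + l ^+ 2]; the additional
    [w1 ^+ 2] flips the sign. The constant is 12 = 5 + 6 + 1, the errors of [r1], [lw2] and [r2]. *)
Lemma phi_taylor b (U w1 w2 e : R) : 0 <= e -> `|w1| <= e -> `|w2| <= e ^+ 2 ->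
  expR (- e) <= U <= expR e ->
  `|U - 1 - w1 - w2 / 2| <= e ^+ 3 * expR e ->
  `|phi b U - (w1 + w2 / 2 + sg b * w1 ^+ 2 / 2)| <= 12 * (e ^+ 3 * expR e ^+ 2).
Proof.
move=> e0 h1 h2 /andP[U1 U2] hU.
have U0 : 0 < U by apply: lt_le_trans U1; exact: expR_gt0.
set E := expR e in U2 hU *.
have E1 : 1 <= E by rewrite -expR0 ler_expR.
have eE : e <= E by apply: le_trans (expR_ge1Dx e); rewrite lerDr.
pose l := ln U.
have Ul : U = expR l by rewrite lnK.
have le_ : `|l| <= e.
  rewrite ler_norml; apply/andP; split; first by rewrite -(ler_expR (- e)) -Ul.
  by rewrite -(ler_expR l) -Ul.
have hl3 : `|U - 1 - l - l ^+ 2 / 2| <= e ^+ 3 * E.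
  rewrite Ul; apply: le_trans (expR_third l) _.
  by apply: ler_pM; rewrite ?exprn_ge0 ?expR_ge0 ?ler_expR// lerXn2r ?nnegrE.
have hl2 : `|U - 1 - l| <= e ^+ 2 * E.
  have /andP[a1 a2] := expR_second l; rewrite Ul ger0_norm//; apply: le_trans a2 _.
  rewrite -real_normK ?num_real//.
  by apply: ler_pM; rewrite ?exprn_ge0 ?expR_ge0 ?ler_expR// lerXn2r ?nnegrE.
have EE : E <= E ^+ 2 by rewrite expr2 ler_peMl// (le_trans ler01).
have e3E : e ^+ 3 * E <= e ^+ 2 * E ^+ 2.
  rewrite exprS -mulrA mulrCA ler_wpM2l ?exprn_ge0// expr2 ler_wpM2r//.
  exact: le_trans E1.
have e2E : e ^+ 2 * E <= e ^+ 2 * E ^+ 2 by rewrite ler_wpM2l ?exprn_ge0.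
have e2E1 : e ^+ 2 <= e ^+ 2 * E ^+ 2.
  by rewrite ler_peMr ?exprn_ge0// (le_trans E1).
have e3E2 : e ^+ 3 * E <= e ^+ 3 * E ^+ 2 by rewrite ler_wpM2l ?exprn_ge0.
have lw : `|l - w1| <= 3 * (e ^+ 2 * E ^+ 2).
  move: hl2 hU h2; rewrite !ler_norml => /andP[? ?] /andP[? ?] /andP[? ?].
  by apply/andP; split; lra.
have lw2 : `|l ^+ 2 - w1 ^+ 2| <= 6 * (e ^+ 3 * E ^+ 2).
  rewrite subr_sqr normrM.
  have s2 : `|l + w1| <= 2 * e by apply: le_trans (ler_normD _ _) _; lra.
  have := ler_pM (normr_ge0 _) (normr_ge0 _) lw s2.
  by move=> /le_trans; apply; rewrite le_eqVlt; apply/orP; left; apply/eqP; ring.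
have r1 : `|l - (w1 + w2 / 2 - w1 ^+ 2 / 2)| <= 5 * (e ^+ 3 * E ^+ 2).
  move: hl3 hU lw2; rewrite !ler_norml => /andP[? ?] /andP[? ?] /andP[? ?].
  by apply/andP; split; lra.
have p0 : 0 <= e ^+ 3 * E ^+ 2 by rewrite mulr_ge0 ?exprn_ge0 ?expR_ge0.
case: b => /=.
  have r2 : `|l * (U - 1 - l)| <= e ^+ 3 * E.
    by rewrite normrM exprS -mulrA; apply: ler_pM.
  have -> : U * ln U = l + l ^+ 2 + l * (U - 1 - l) by rewrite -/l; ring.
  move: r1 r2 lw2; rewrite !ler_norml => /andP[? ?] /andP[? ?] /andP[? ?].
  by apply/andP; split; lra.
move: r1; rewrite -/l !ler_norml => /andP[? ?].
by apply/andP; split; lra.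
Qed.

End entropy_step.

Lemma sum_const_card (R : realType) (I : finType) (c : R) : \sum_(i : I) c = #|I|%:R * c.
Proof. by rewrite sumr_const -[LHS]mulr_natl; congr (_%:R * _); exact: eq_card. Qed.

(** * One small step of the interpolation *)

Section step.
Context d (T : measurableType d) (R : realType) (M : probability T R).
Context (g : probability R R) (hg : gaussian_law g) (I : finType).
Local Notation gam := (tuple_prob g #|I|).
Context (a : I -> T -> R) (A : R) (A0 : 0 <= A).
Hypothesis ma : forall i, measurable_fun setT (a i).
Hypothesis aA : forall i x, `|a i x| <= A.

Let ba i : bmf (a i). Proof. by split => //; exists A. Qed.

(** Log-likelihood ratio of fresh channels with coefficients [eps * a i], read on pure noise, so
    that its exponential has mean 1. *)
Definition incr (eps : R) (z : #|I|.-tuple R) (x : T) : R :=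
  \sum_i (eps * co z i * a i x - eps ^+ 2 / 2 * a i x ^+ 2).

Let X (z : #|I|.-tuple R) x : R := \sum_i co z i * a i x.
Let Y x : R := \sum_i (1 / 2) * a i x ^+ 2.

Let bX z : bmf (X z).
Proof. by apply: bmf_sum => i; exact: bmfZ. Qed.

Let bY : bmf Y.
Proof. by apply: bmf_sum => i; apply: bmfZ; exact: bmfX. Qed.

Let incrE eps z x : incr eps z x = eps * X z x - eps ^+ 2 * Y x.
Proof.
by rewrite /incr /X /Y !mulr_sumr -sumrB; apply: eq_bigr => i _; field.
Qed.

Lemma bmf_incr eps z : bmf (incr eps z).
Proof.
rewrite (_ : incr eps z = fun x => eps * X z x - eps ^+ 2 * Y x); last by apply/funext => x; exact: incrE.
by apply: bmfB; exact: bmfZ.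
Qed.

Lemma measurable_incr2 eps :
  measurable_fun setT (fun p : #|I|.-tuple R * T => incr eps p.1 p.2).
Proof.
have m2 i : measurable_fun setT (fun p : #|I|.-tuple R * T => a i p.2).
  by apply: (measurableT_comp (ma i)); exact: measurable_snd.
have m1 i : measurable_fun setT (fun p : #|I|.-tuple R * T => co p.1 i).
  by apply: (measurableT_comp (measurable_co i)); exact: measurable_fst.
apply: measurable_sum => i; apply: measurable_funB; apply: measurable_funM => //.
  exact: measurable_funM.
exact: measurable_funX.
Qed.

Let N : R := #|I|%:R.

Definition step_bound (z : #|I|.-tuple R) : R := A * absum z + N * A ^+ 2 / 2.
(** The exponent 5 is 3 + 2: with [B = step_bound z], [B ^+ 3] and [expR B ^+ 2] are absorbed into
    [expR (5 * B)]. The factor 15 is 12 from [phi_taylor] and 3 / 2 from each of the two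
    second-order terms, whose squares are replaced by their leading parts. *)
Definition step_const : R := 15 * \int[gam]_z expR (5 * step_bound z).

Let B0 z : 0 <= step_bound z.
Proof.
by rewrite addr_ge0 ?divr_ge0 ?mulr_ge0 ?absum_ge0 ?sqr_ge0// ler0n.
Qed.

Let XB z x : `|X z x| <= step_bound z.
Proof.
apply: le_trans (_ : A * absum z <= _); last first.
  by rewrite lerDl divr_ge0 ?mulr_ge0 ?sqr_ge0// ler0n.
apply: le_trans (ler_norm_sum _ _ _) _; rewrite mulr_sumr; apply: ler_sum => i _.
by rewrite normrM mulrC ler_wpM2r.
Qed.

Let YB z x : `|Y x| <= step_bound z.
Proof.
apply: le_trans (_ : N * A ^+ 2 / 2 <= _); last first.
  by rewrite lerDr mulr_ge0 ?absum_ge0.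
apply: le_trans (ler_norm_sum _ _ _) _.
apply: le_trans (_ : \sum_(i : I) A ^+ 2 / 2 <= _); last first.
  by rewrite sum_const_card -[leRHS]mulrA /N.
apply: ler_sum => i _; rewrite normrM ger0_norm// mulrC mul1r ler_wpM2r//.
by rewrite normrX lerXn2r ?nnegrE.
Qed.

Lemma igl_step_bound (c : R) : igl gam (fun z => expR (c * step_bound z)).
Proof.
under eq_fun => z.
  rewrite /step_bound mulrDr expRD mulrA mulrC; over.
by apply: iglZ; exact: (igl_exp_absum hg).
Qed.

Let sqr_diff (eps u v B : R) : 0 <= eps -> eps <= 1 -> `|u| <= B -> `|v| <= B ->
  `|(eps * u - eps ^+ 2 * v) ^+ 2 - eps ^+ 2 * u ^+ 2| <= 3 * (eps ^+ 3 * B ^+ 2).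
Proof.
move=> e0 e1 uB vB.
have B0' : 0 <= B by apply: le_trans uB.
have -> : (eps * u - eps ^+ 2 * v) ^+ 2 - eps ^+ 2 * u ^+ 2 =
   eps ^+ 3 * (eps * v ^+ 2 - 2 * (u * v)) by ring.
rewrite normrM ger0_norm ?exprn_ge0// [leRHS]mulrCA ler_wpM2l ?exprn_ge0//.
apply: le_trans (ler_normB _ _) _.
have h1 : `|u * v| <= B ^+ 2 by rewrite normrM expr2 ler_pM.
have h2 : `|eps * v ^+ 2| <= B ^+ 2.
  rewrite normrM ger0_norm// normrX -[leRHS]mul1r ler_pM ?exprn_ge0//.
  by rewrite lerXn2r ?nnegrE.
by rewrite [X in _ + X]normrM (@ger0_norm _ 2)//; lra.
Qed.

Context (h : T -> R) (bh : bmf h).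
Let ga i := gibbs M h (a i).

Definition step_U (eps : R) (z : #|I|.-tuple R) : R :=
  gibbs M h (fun x => expR (incr eps z x)).

Lemma step_U_gt0 eps z : 0 < step_U eps z.
Proof.
rewrite /step_U.
have := ex_gt0 M (bmfD bh (bmf_incr eps z)); rewrite (ex_add M bh (bmf_incr eps z)).
by rewrite pmulr_rgt0// ex_gt0.
Qed.

Lemma measurable_step_U eps : measurable_fun setT (step_U eps).
Proof.
apply: measurable_funM => //.
apply: (meas_Rint M (f := fun p => expR (incr eps p.1 p.2) * expR (h p.2))).
apply: measurable_funM; apply: measurableT_comp => //; first exact: measurable_incr2.
by apply: (measurableT_comp bh.1); exact: measurable_snd.
Qed.

Let main (b : bool) (eps : R) (z : #|I|.-tuple R) : R := eps * (\sum_i co z i * ga i) - eps ^+ 2 * (\sum_i (1 / 2) * gibbs M h (fun x => a i x ^+ 2))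
   + eps ^+ 2 / 2 * (\sum_i \sum_j co z i * co z j * gibbs M h (fun x => a i x * a j x))
   + sg R b * (eps ^+ 2 / 2) * (\sum_i \sum_j co z i * co z j * (ga i * ga j)).

Let ig_main b eps : igl gam (main b eps).
Proof.
rewrite /main; apply: iglD; last by apply: iglZ; exact: (igl_gam_quad hg).
apply: iglD; last by apply: iglZ; exact: (igl_gam_quad hg).
by apply: iglB; [apply: iglZ; exact: (igl_gam_lin hg)|exact: igl_cst].
Qed.

(** The decisive cancellation: the diagonal of the Gaussian quadratic form reproduces the averages
    of [a i ^+ 2] and cancels the normalization [- eps ^+ 2 / 2 * a i ^+ 2]. Only the square of the
    first-order term survives, with the sign of the functional. *)
Let int_main b eps : \int[gam]_z main b eps z = sg R b * (eps ^+ 2 / 2) * \sum_i ga i ^+ 2.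
Proof.
have i1 := igl_gam_lin hg (I := I) ga.
have i2 := igl_gam_quad hg (I := I) (fun i j => gibbs M h (fun x => a i x * a j x)).
have i3 := igl_gam_quad hg (I := I) (fun i j => ga i * ga j).
rewrite /main RintD; last 2 first.
- apply: iglD; last exact: iglZ.
  by apply: iglB; [exact: iglZ|exact: igl_cst].
- exact: iglZ.
rewrite RintD; last 2 first.
- by apply: iglB; [exact: iglZ|exact: igl_cst].
- exact: iglZ.
rewrite RintB; [|exact: iglZ|exact: igl_cst].
rewrite Rint_cst !RintZ// (gam_lin hg) !(gam_quad hg) mulr0 sub0r.
have e1 : \sum_i gibbs M h (fun x => a i x * a i x) = \sum_i gibbs M h (fun x => a i x ^+ 2).
  by apply: eq_bigr => i _; congr gibbs; apply/funext => x; rewrite expr2.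
have e2 : \sum_i ga i * ga i = \sum_i ga i ^+ 2 by apply: eq_bigr => i _; rewrite expr2.
by rewrite /= e1 e2 -mulr_sumr; field.
Qed.

Let main_err (b : bool) (eps : R) (z : #|I|.-tuple R) : 0 <= eps -> eps <= 1 ->
  `|phi b (step_U eps z) - main b eps z| <= 15 * eps ^+ 3 * expR (5 * step_bound z).
Proof.
move=> e0 e1; set B := step_bound z.
have B0' : 0 <= B := B0 z.
pose e := eps * B.
have eB : e <= B by rewrite /e ler_piMl.
have e_0 : 0 <= e by rewrite mulr_ge0.
have We x : `|incr eps z x| <= e.
  rewrite incrE; have hx := XB z x; have hy := YB z x.
  have S1 : `|X z x| <= A * absum z.
    apply: le_trans (ler_norm_sum _ _ _) _; rewrite mulr_sumr; apply: ler_sum => i _.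
    by rewrite normrM mulrC ler_wpM2r.
  have S2 : `|Y x| <= N * A ^+ 2 / 2.
    apply: le_trans (ler_norm_sum _ _ _) _.
    apply: le_trans (_ : \sum_(i : I) A ^+ 2 / 2 <= _); last first.
      by rewrite sum_const_card -[leRHS]mulrA /N.
    apply: ler_sum => i _; rewrite normrM ger0_norm// mulrC mul1r ler_wpM2r//.
    by rewrite normrX lerXn2r ?nnegrE.
  apply: le_trans (ler_normB _ _) _.
  rewrite /e /B /step_bound mulrDr; apply: lerD.
    by rewrite normrM (ger0_norm e0) ler_wpM2l.
  rewrite normrM normrX (ger0_norm e0); apply: ler_pM => //; first exact: exprn_ge0.
  by rewrite expr2 ler_piMl.
have bW := bmf_incr eps z.
pose w1 := gibbs M h (incr eps z).
pose w2 := gibbs M h (fun x => incr eps z x ^+ 2).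
have hw1 : `|w1| <= e by apply: gibbs_norm_le.
have hw2 : `|w2| <= e ^+ 2.
  apply: gibbs_norm_le => //; first exact: bmfX.
  by move=> x; rewrite normrX lerXn2r ?nnegrE.
have hU : expR (- e) <= step_U eps z <= expR e.
  apply/andP; split.
    rewrite -[leLHS](gibbs_cst M bh); apply: le_gibbs => //; [exact: bmf_cst|exact: bmf_expR|].
    by move=> x; rewrite ler_expR; have := We x; rewrite ler_norml => /andP[].
  rewrite -[leRHS](gibbs_cst M bh); apply: le_gibbs => //; [exact: bmf_expR|exact: bmf_cst|].
  by move=> x; rewrite ler_expR; have := We x; rewrite ler_norml => /andP[].
have hUw : `|step_U eps z - 1 - w1 - w2 / 2| <= e ^+ 3 * expR e.
  rewrite (_ : _ - _ = gibbs M h (fun x => expR (incr eps z x) - 1 - incr eps z x - 2^-1 * incr eps z x ^+ 2)).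
    apply: gibbs_norm_le => //.
      apply: bmfB; last by apply: bmfZ; exact: bmfX.
      by apply: bmfB => //; apply: bmfB; [exact: bmf_expR|exact: bmf_cst].
    move=> x; rewrite [2^-1 * _]mulrC; apply: le_trans (expR_third _) _.
    by apply: ler_pM; rewrite ?exprn_ge0 ?expR_ge0 ?ler_expR// lerXn2r ?nnegrE.
  rewrite gibbsB//; last 2 first.
  - by apply: bmfB => //; apply: bmfB; [exact: bmf_expR|exact: bmf_cst].
  - by apply: bmfZ; exact: bmfX.
  rewrite gibbsB//; last by apply: bmfB; [exact: bmf_expR|exact: bmf_cst].
  rewrite gibbsB//; [|exact: bmf_expR|exact: bmf_cst].
  by rewrite gibbs_cst// gibbsZ//; [rewrite [_ / 2]mulrC|exact: bmfX].
have key := phi_taylor b e_0 hw1 hw2 hU hUw.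
have x1E : gibbs M h (X z) = \sum_i co z i * ga i.
  by rewrite /X gibbs_sum// => [|i]; [apply: eq_bigr => i _; rewrite gibbsZ|exact: bmfZ].
have yE : gibbs M h Y = \sum_i (1 / 2) * gibbs M h (fun x => a i x ^+ 2).
  rewrite /Y gibbs_sum// => [|i]; last by apply: bmfZ; exact: bmfX.
  by apply: eq_bigr => i _; rewrite gibbsZ//; exact: bmfX.
have qE : gibbs M h (fun x => X z x ^+ 2) =
    \sum_i \sum_j co z i * co z j * gibbs M h (fun x => a i x * a j x).
  have -> : (fun x => X z x ^+ 2) = fun x => \sum_i \sum_j co z i * co z j * (a i x * a j x).
    apply/funext => x; rewrite expr2 /X big_distrlr/=; apply: eq_bigr => i _.
    by apply: eq_bigr => j _; rewrite mulrACA.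
  rewrite gibbs_sum// => [|i]; last by apply: bmf_sum => j; apply: bmfZ; exact: bmfM.
  apply: eq_bigr => i _; rewrite gibbs_sum// => [|j]; last by apply: bmfZ; exact: bmfM.
  by apply: eq_bigr => j _; rewrite gibbsZ//; exact: bmfM.
have sqE : \sum_i \sum_j co z i * co z j * (ga i * ga j) = (\sum_i co z i * ga i) ^+ 2.
  rewrite expr2 big_distrlr/=; apply: eq_bigr => i _.
  by apply: eq_bigr => j _; rewrite mulrACA.
have w1E : w1 = eps * gibbs M h (X z) - eps ^+ 2 * gibbs M h Y.
  rewrite -!gibbsZ// -gibbsB//; [|exact: bmfZ|exact: bmfZ].
  by congr gibbs; apply/funext => x; rewrite incrE.
have d2 : `|w2 - eps ^+ 2 * gibbs M h (fun x => X z x ^+ 2)| <= 3 * (eps ^+ 3 * B ^+ 2).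
  rewrite -gibbsZ//; last exact: bmfX.
  rewrite -gibbsB//; [|exact: bmfX|by apply: bmfZ; exact: bmfX].
  apply: gibbs_norm_le => //; first by apply: bmfB; [exact: bmfX|apply: bmfZ; exact: bmfX].
  by move=> x; rewrite incrE; apply: sqr_diff => //; first [exact: XB | exact: YB].
have d1 : `|w1 ^+ 2 - eps ^+ 2 * gibbs M h (X z) ^+ 2| <= 3 * (eps ^+ 3 * B ^+ 2).
  rewrite w1E; apply: sqr_diff => //; apply: gibbs_norm_le => // x; first [exact: XB | exact: YB].
have mainE : main b eps z = w1 + (eps ^+ 2 * gibbs M h (fun x => X z x ^+ 2)) / 2
    + sg R b * (eps ^+ 2 * gibbs M h (X z) ^+ 2) / 2.
  by rewrite /main w1E -x1E -yE -qE sqE -x1E; field.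
have bB : B <= expR B by apply: le_trans (expR_ge1Dx B); rewrite lerDr.
have t1 : e ^+ 3 * expR e ^+ 2 <= eps ^+ 3 * expR (5 * B).
  rewrite /e exprMn -mulrA ler_wpM2l ?exprn_ge0//.
  have -> : 5 * B = 3%:R * B + 2%:R * B by ring.
  rewrite expRD !expRM_natl; apply: ler_pM; rewrite ?exprn_ge0 ?expR_ge0//.
    by rewrite lerXn2r ?nnegrE ?expR_ge0.
  by rewrite lerXn2r ?nnegrE ?expR_ge0// ler_expR.
have t2 : eps ^+ 3 * B ^+ 2 <= eps ^+ 3 * expR (5 * B).
  rewrite ler_wpM2l ?exprn_ge0//; apply: (@le_trans _ _ (expR (2%:R * B))).
    by rewrite expRM_natl lerXn2r ?nnegrE ?expR_ge0.
  by rewrite ler_expR ler_wpM2r// ler_nat.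
rewrite mainE; move: key d1 d2 {mainE}; rewrite /sg; case: b.
  rewrite !ler_norml => /andP[? ?] /andP[? ?] /andP[? ?].
  by apply/andP; split; lra.
rewrite !ler_norml => /andP[? ?] /andP[? ?] /andP[? ?].
by apply/andP; split; lra.
Qed.

Lemma igl_step b eps : 0 <= eps -> eps <= 1 -> igl gam (fun z => phi b (step_U eps z)).
Proof.
move=> e0 e1.
apply: (igl_dom (g := fun z => `|main b eps z| + 15 * eps ^+ 3 * expR (5 * step_bound z))).
- case: b; rewrite /phi; last by apply: (measurableT_comp (@measurable_ln R)); exact: measurable_step_U.
  apply: measurable_funM; first exact: measurable_step_U.
  by apply: (measurableT_comp (@measurable_ln R)); exact: measurable_step_U.
- apply: iglD; first exact: igl_norm.
  by apply: iglZ; exact: igl_step_bound.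
move=> z; have := main_err b z e0 e1.
by move=> /(le_trans (lerB_dist _ _)); lra.
Qed.

(** Finite-difference form of the derivative formula usually obtained by Gaussian integration by
    parts: the rate in the signal-to-noise ratio is half the sum of the squared Gibbs averages. *)
Lemma step b eps : 0 <= eps -> eps <= 1 ->
  `|\int[gam]_z phi b (step_U eps z) - sg R b * (eps ^+ 2 / 2) * \sum_i gibbs M h (a i) ^+ 2|
    <= step_const * eps ^+ 3.
Proof.
move=> e0 e1; rewrite -int_main -RintB//; last exact: igl_step.
rewrite /step_const mulrAC -RintZ; last exact: igl_step_bound.
apply: norm_Rint.
- by apply: iglB => //; exact: igl_step.
- by apply: iglZ; exact: igl_step_bound.
- by move=> z; exact: main_err.
Qed.

End step.

Lemma measurable_inv_ge0 d (T : measurableType d) (R : realType) (f : T -> R) :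
  measurable_fun setT f -> (forall x, 0 <= f x) -> measurable_fun setT (fun x => (f x)^-1).
Proof.
move=> mf f0.
rewrite (_ : (fun x => _) = fun x => if 0 < f x then expR (- ln (f x)) else 0); last first.
  apply/funext => x; case: ifP => [fx|/negbT]; first by rewrite expRN lnK.
  by rewrite -leNgt => fx; rewrite (le_anti (introT andP (conj fx (f0 x)))) invr0.
apply: measurable_fun_ifT => //; first exact: measurable_fun_ltr.
apply: measurableT_comp => //; apply: measurableT_comp => //.
exact: (measurableT_comp (@measurable_ln R) mf).
Qed.

(** * Gaussian Hamiltonians and likelihood ratios *)

Section gaussian_hamiltonian.
Context d (T : measurableType d) (R : realType) (M : probability T R).
Context (g : probability R R) (hg : gaussian_law g) (I : finType).
Local Notation gam := (tuple_prob g #|I|).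

Definition gh (c : I -> T -> R) (z : #|I|.-tuple R) (x : T) : R :=
  \sum_i (co z i * c i x - c i x ^+ 2 / 2).

Lemma exp_mean (c : I -> R) :
  igl gam (fun z : #|I|.-tuple R => expR (\sum_i (co z i * c i - c i ^+ 2 / 2))) /\
  \int[gam]_z expR (\sum_i (co z i * c i - c i ^+ 2 / 2)) = 1.
Proof.
pose f i (x : R) := expR (- (c i ^+ 2 / 2)) * expR (c i * x).
have hf i : igl g (f i) by apply: iglZ; have [] := gaussian_exp hg (c i).
have [h1 h2] := co_prod hf.
have E (z : #|I|.-tuple R) : expR (\sum_i (co z i * c i - c i ^+ 2 / 2)) = \prod_i f i (co z i).
  by rewrite expR_sum; apply: eq_bigr => i _; rewrite /f -expRD; congr expR; ring.
split; first by under eq_fun do rewrite E.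
under eq_Rintegral do rewrite E.
rewrite h2 big1// => i _; have [i1 i2] := gaussian_exp hg (c i).
by rewrite RintZ// i2 -expRD addNr expR0.
Qed.

Context (c : I -> T -> R) (A : R) (A0 : 0 <= A).
Hypothesis mc : forall i, measurable_fun setT (c i).
Hypothesis cA : forall i x, `|c i x| <= A.

Lemma gh_bound z x : `|gh c z x| <= step_bound A z.
Proof.
apply: le_trans (ler_norm_sum _ _ _) _.
apply: (@le_trans _ _ (\sum_i (A * `|co z i| + A ^+ 2 / 2))).
  apply: ler_sum => i _; apply: le_trans (ler_normB _ _) _; apply: lerD.
    by rewrite normrM mulrC ler_wpM2r.
  by rewrite normrM normrX (@ger0_norm _ 2^-1)// ler_wpM2r// lerXn2r ?nnegrE.
by rewrite big_split/= -mulr_sumr sum_const_card /step_bound mulrA.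
Qed.

Lemma bmf_gh z : bmf (gh c z).
Proof.
split; last by exists (step_bound A z) => x; exact: gh_bound.
apply: measurable_sum => i; apply: measurable_funB; first exact: measurable_funM.
by apply: measurable_funM => //; exact: measurable_funX.
Qed.

Lemma measurable_gh2 : measurable_fun setT (fun p : #|I|.-tuple R * T => gh c p.1 p.2).
Proof.
have m2 i : measurable_fun setT (fun p : #|I|.-tuple R * T => c i p.2).
  by apply: (measurableT_comp (mc i)); exact: measurable_snd.
have m1 i : measurable_fun setT (fun p : #|I|.-tuple R * T => co p.1 i).
  by apply: (measurableT_comp (measurable_co i)); exact: measurable_fst.
apply: measurable_sum => i; apply: measurable_funB; first exact: measurable_funM.
by apply: measurable_funM => //; exact: measurable_funX.
Qed.

Lemma measurable_ex_gh (h : T -> R) : measurable_fun setT h ->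
  measurable_fun setT (fun z => ex M (fun x => h x + gh c z x)).
Proof.
move=> mh; apply: (meas_Rint M (f := fun p => expR (h p.2 + gh c p.1 p.2))).
apply: measurableT_comp => //; apply: measurable_funD; last exact: measurable_gh2.
by apply: (measurableT_comp mh); exact: measurable_snd.
Qed.

(** Fubini: each likelihood ratio has mean 1 under pure noise. Hence the mean of the weight [wt b]
    does not move along the interpolation. *)
Lemma mean_ex (h : T -> R) : bmf h ->
  \int[gam]_z ex M (fun x => h x + gh c z x) = ex M h.
Proof.
move=> bh; have [H hH] := bh.2.
pose F (p : #|I|.-tuple R * T) := expR (h p.2 + gh c p.1 p.2).
have mF : measurable_fun setT F.
  apply: measurableT_comp => //; apply: measurable_funD; last exact: measurable_gh2.
  by apply: (measurableT_comp bh.1); exact: measurable_snd.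
have iF : igl (gam \x M)%E F.
  apply: (igl_prod mF (igl_step_bound hg I A 1) (igl_cst M (expR H))).
  - move=> z x; rewrite /F/= ger0_norm ?expR_ge0// -expRD ler_expR mul1r addrC.
    apply: lerD; first exact: le_trans (ler_norm _) (gh_bound z x).
    exact: le_trans (ler_norm _) (hH x).
  - by move=> z; exact: expR_ge0.
  - by move=> z; exact: expR_ge0.
have s1 z : igl M (fun x => F (z, x)).
  by apply: bmf_igl; apply: bmf_expR; apply: bmfD => //; exact: bmf_gh.
have e2 x : igl gam (fun z => F (z, x)) /\ \int[gam]_z F (z, x) = expR (h x).
  have [i1 i2] := exp_mean (c^~ x); rewrite /F/=.
  split; first by under eq_fun do rewrite expRD; exact: iglZ.
  under eq_Rintegral do rewrite expRD.
  by rewrite RintZ// i2 mulr1.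
rewrite /ex (Rint_swap (f := F) iF s1 (fun x => (e2 x).1)).
by apply: eq_Rintegral => x _; have [] := e2 x.
Qed.

End gaussian_hamiltonian.

Section log_bounds.
Context d (T : measurableType d) (R : realType) (M : probability T R).

Lemma ex_bounds (h : T -> R) (C : R) : measurable_fun setT h -> (forall x, `|h x| <= C) ->
  expR (- C) <= ex M h <= expR C.
Proof.
move=> mh hC; have bh : bmf h by split => //; exists C.
rewrite -[X in X <= _ <= _](Rint_cst M) -[X in _ <= _ <= X](Rint_cst M).
apply/andP; split; apply: le_Rint; try exact: igl_cst; try exact: bmf_igl (bmf_expR bh).
  by move=> x; rewrite ler_expR; have := hC x; rewrite ler_norml => /andP[].
by move=> x; rewrite ler_expR; have := hC x; rewrite ler_norml => /andP[].
Qed.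

Lemma phi_bounds b (h : T -> R) (C : R) : measurable_fun setT h ->
  (forall x, `|h x| <= C) ->
  `|phi b (ex M h)| <= expR (2 * C) /\ `|wt b (ex M h)| <= expR (2 * C).
Proof.
move=> mh hC; have C0 : 0 <= C := le_trans (normr_ge0 _) (hC point).
have /andP[l1 l2] := ex_bounds mh hC.
have L0 : 0 < ex M h by apply: lt_le_trans l1; exact: expR_gt0.
have lnC : `|ln (ex M h)| <= C.
  rewrite ler_norml; apply/andP; split.
    by rewrite -(ler_expR (- C)) lnK.
  by rewrite -(ler_expR (ln _)) lnK.
have CE : C <= expR C by apply: le_trans (expR_ge1Dx C); rewrite lerDr.
have -> : 2 * C = C + C by ring.
rewrite expRD.
have E1 : 1 <= expR C by rewrite -expR0 ler_expR.
case: b => /=; split.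
- by rewrite normrM ler_pM// ?(le_trans lnC)// gtr0_norm.
- by rewrite gtr0_norm// (le_trans l2)// ler_peMl ?expR_ge0.
- by rewrite (le_trans lnC)// (le_trans CE)// ler_peMl ?expR_ge0.
- by rewrite normr1 -[leLHS]mulr1 ler_pM.
Qed.

End log_bounds.

Lemma measurable_phi (R : realType) b : measurable_fun setT (@phi R b).
Proof.
case: b; last exact: measurable_ln.
by apply: measurable_funM => //; exact: measurable_ln.
Qed.

Lemma measurable_wt (R : realType) b : measurable_fun setT (@wt R b).
Proof. by case: b; [exact: measurable_id|exact: measurable_cst]. Qed.

(** Stated for plain real variables, so that linear arithmetic does not have to handle the integrals
    that are substituted for them. *)
Lemma sg_arith (R : realType) b (P1 P2 P3 u v y1 y2 : R) :
  - u <= y1 - y2 -> `|P1 - P2 - sg R b * y1| <= v -> `|P3 - P2 - sg R b * y2| <= v ->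
  - (u + 2 * v) <= sg R b * (P1 - P3).
Proof.
by rewrite /sg; case: b; rewrite !ler_norml => d1 /andP[? ?] /andP[? ?]; lra.
Qed.

Lemma step_arith (R : realType) (s y1 y2 y3 v w : R) :
  - w <= s * (y2 - y3) -> - v <= s * (y1 - y2) -> - (w + v) <= s * (y1 - y3).
Proof. by rewrite !mulrBr => *; lra. Qed.

(** * Interpolation along a path of signal-to-noise ratios *)

Section interpolation.
Context d (T : measurableType d) (R : realType) (M : probability T R).
Context (g : probability R R) (hg : gaussian_law g) (I : finType).
Local Notation gam := (tuple_prob g #|I|).
Context (a : I -> T -> R) (A : R) (A0 : 0 <= A).
Hypothesis ma : forall i, measurable_fun setT (a i).
Hypothesis aA : forall i x, `|a i x| <= A.
Context (h : T -> R) (bh : bmf h).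

Definition ham (tau : I -> R) := gh (fun i x => Num.sqrt (tau i) * a i x).
Definition Psi b (tau : I -> R) : R :=
  \int[gam]_z phi b (ex M (fun x => h x + ham tau z x)).

Let in01 (tau : I -> R) := forall i, 0 <= tau i <= 1.

Let mtau tau i : measurable_fun setT (fun x => Num.sqrt (tau i) * a i x).
Proof. exact: measurable_funM. Qed.

Let tauA tau : in01 tau -> forall i x, `|Num.sqrt (tau i) * a i x| <= A.
Proof.
move=> h01 i x; rewrite normrM -[leRHS]mul1r ler_pM// ger0_norm ?sqrtr_ge0//.
by rewrite -sqrtr1 ler_wsqrtr//; have /andP[] := h01 i.
Qed.

Let bham tau z : in01 tau -> bmf (ham tau z).
Proof. by move=> h01; apply: (bmf_gh A0 (mtau tau) (tauA h01)). Qed.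

Lemma measurable_phi_ham b tau :
  measurable_fun setT (fun z => phi b (ex M (fun x => h x + ham tau z x))).
Proof.
apply: (measurableT_comp (@measurable_phi R b)).
by apply: measurable_ex_gh; [exact: mtau|exact: bh.1].
Qed.

Let ham_phi_bounds (H : R) b tau z : (forall x, `|h x| <= H) -> in01 tau ->
  `|phi b (ex M (fun x => h x + ham tau z x))| <= expR (2 * H) * expR (2 * step_bound A z) /\
  `|wt b (ex M (fun x => h x + ham tau z x))| <= expR (2 * H) * expR (2 * step_bound A z).
Proof.
move=> hH h01; rewrite -expRD -mulrDr; apply: phi_bounds.
  by apply: measurable_funD; [exact: bh.1|exact: (bham _ h01).1].
move=> x; apply: le_trans (ler_normD _ _) _; apply: lerD => //.
exact: (gh_bound A0 (tauA h01)).
Qed.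

Lemma igl_phi_ham b tau : (forall i, 0 <= tau i <= 1) -> igl gam (fun z => phi b (ex M (fun x => h x + ham tau z x))).
Proof.
move=> h01; have [H hH] := bh.2.
apply: (igl_dom (g := fun z => expR (2 * H) * expR (2 * step_bound A z))).
- exact: measurable_phi_ham.
- by apply: iglZ; exact: (igl_step_bound hg).
- by move=> z; have [] := ham_phi_bounds b z hH h01.
Qed.

Let ig_wt b tau : in01 tau -> igl gam (fun z => wt b (ex M (fun x => h x + ham tau z x))).
Proof.
move=> h01; have [H hH] := bh.2.
apply: (igl_dom (g := fun z => expR (2 * H) * expR (2 * step_bound A z))).
- apply: (measurableT_comp (@measurable_wt R b)).
  by apply: measurable_ex_gh; [exact: mtau|exact: bh.1].
- by apply: iglZ; exact: (igl_step_bound hg).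
- by move=> z; have [] := ham_phi_bounds b z hH h01.
Qed.

Definition wt_mass b : R := if b then ex M h else 1.

Let int_wt b tau : in01 tau ->
  \int[gam]_z wt b (ex M (fun x => h x + ham tau z x)) = wt_mass b.
Proof.
move=> h01; case: b => /=; last exact: Rint_cst.
exact: (mean_ex M hg A0 (mtau tau) (tauA h01) bh).
Qed.

Let am (th : I -> bool) i x : R := (th i)%:R * a i x.

Let mam th i : measurable_fun setT (am th i).
Proof. exact: measurable_funM. Qed.

Let amA th i x : `|am th i x| <= A.
Proof. by rewrite /am; case: (th i); rewrite ?mul1r// mul0r normr0. Qed.

Definition drift b tau (th : I -> bool) (z : #|I|.-tuple R) : R :=
  wt b (ex M (fun x => h x + ham tau z x)) *
  \sum_i gibbs M (fun x => h x + ham tau z x) (am th i) ^+ 2.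

Let ig_drift b tau (th : I -> bool) : in01 tau -> igl gam (drift b tau th).
Proof.
move=> h01; apply: (igl_dom (g := fun z => (#|I|%:R * A ^+ 2) * `|wt b (ex M (fun x => h x + ham tau z x))|)).
- have mex := measurable_ex_gh M (mtau tau) bh.1.
  apply: measurable_funM; first by apply: (measurableT_comp (@measurable_wt R b)).
  apply: measurable_sum => i; apply: measurable_funX; apply: measurable_funM.
    apply: (meas_Rint M (f := fun p => am th i p.2 * expR (h p.2 + ham tau p.1 p.2))).
    apply: measurable_funM; first by apply: (measurableT_comp (mam th i)); exact: measurable_snd.
    apply: measurableT_comp => //; apply: measurable_funD; last exact: (measurable_gh2 (mtau tau)).
    by apply: (measurableT_comp bh.1); exact: measurable_snd.
  apply: measurable_inv_ge0 => // z; apply: ltW; apply: ex_gt0.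
  by apply: bmfD => //; exact: bham.
- by apply: iglZ; apply: igl_norm; exact: ig_wt.
move=> z; rewrite /drift normrM mulrC ler_wpM2r//.
rewrite ger0_norm; last by apply: sumr_ge0 => i _; exact: sqr_ge0.
rewrite -sum_const_card; apply: ler_sum => i _.
rewrite -real_normK ?num_real// lerXn2r ?nnegrE//.
apply: gibbs_norm_le; last exact: amA.
  by apply: bmfD => //; exact: bham.
by split; [exact: mam|exists A; exact: amA].
Qed.

(** The noise after the step is realized as a rotation of two independent noises [p.1], [p.2]. The
    Hamiltonian then splits into the old one in [p.1] and an increment in [p.2], and [step] applies
    to the increment with [p.1] frozen. *)
Lemma Psi_step b tau (th : I -> bool) (eps : R) : 0 < eps -> eps <= 1 -> in01 tau ->
  in01 (fun i => tau i + eps ^+ 2 * (th i)%:R) ->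
  `|Psi b (fun i => tau i + eps ^+ 2 * (th i)%:R) - Psi b tau
    - sg R b * (eps ^+ 2 / 2) * \int[gam]_z drift b tau th z|
  <= step_const g I A * eps ^+ 3 * wt_mass b.
Proof.
move=> e0 e1 h01 h01'; have [H hH] := bh.2.
set tau' := (fun i => _) in h01' *.
have e2 : 0 < eps ^+ 2 by rewrite exprn_gt0.
have t'E i : Num.sqrt (tau' i) ^+ 2 = Num.sqrt (tau i) ^+ 2 + (eps * (th i)%:R) ^+ 2.
  rewrite !sqr_sqrtr; [|by have /andP[] := h01 i|by have /andP[] := h01' i].
  by rewrite /tau' exprMn; case: (th i); rewrite ?expr1n// expr0n.
(* The angle is fixed by [Num.sqrt (tau' i) * al i = Num.sqrt (tau i)] and [Num.sqrt (tau' i) * be i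
   = eps * (th i)%:R]. If [tau' i = 0] both right-hand sides vanish and any unit vector serves. *)
pose al i := if tau' i == 0 then 1 else Num.sqrt (tau i) / Num.sqrt (tau' i).
pose be i := if tau' i == 0 then 0 else eps * (th i)%:R / Num.sqrt (tau' i).
have s0 i : tau' i != 0 -> Num.sqrt (tau' i) != 0.
  move=> ti; rewrite gt_eqF// sqrtr_gt0 lt_neqAle eq_sym ti/=.
  by have /andP[] := h01' i.
have z0 i : tau' i = 0 -> Num.sqrt (tau i) = 0 /\ eps * (th i)%:R = 0.
  move=> ti; have := t'E i; rewrite ti sqrtr0 expr0n/= => /esym/eqP.
  by rewrite paddr_eq0 ?sqr_ge0// !sqrf_eq0 => /andP[/eqP ? /eqP ?].
have al0 i : 0 <= al i by rewrite /al; case: ifP => // _; rewrite divr_ge0 ?sqrtr_ge0.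
have be0 i : 0 <= be i.
  by rewrite /be; case: ifP => // _; rewrite divr_ge0 ?sqrtr_ge0// mulr_ge0 ?ler0n// ltW.
have ab i : al i ^+ 2 + be i ^+ 2 = 1.
  rewrite /al /be; case: eqP => [_|/eqP ti]; first by rewrite expr1n expr0n addr0.
  by rewrite !expr_div_n -mulrDl -t'E divff// expf_neq0// s0.
have sal i : Num.sqrt (tau' i) * al i = Num.sqrt (tau i).
  rewrite /al; case: eqP => [ti|/eqP ti]; last by rewrite mulrC divfK// s0.
  by rewrite ti sqrtr0 mul0r (z0 _ ti).1.
have sbe i : Num.sqrt (tau' i) * be i = eps * (th i)%:R.
  rewrite /be; case: eqP => [ti|/eqP ti]; last by rewrite mulrC divfK// s0.
  by rewrite mulr0 (z0 _ ti).2.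
pose cb := comb_tuple (fun k : 'I_#|I| => al (enum_val k)) (fun k : 'I_#|I| => be (enum_val k)).
have coE (p : #|I|.-tuple R * #|I|.-tuple R) (i : I) : co (cb p) i = al i * co p.1 i + be i * co p.2 i.
  by rewrite /co /cb tnth_mktuple enum_rankK.
have hamE (p : #|I|.-tuple R * #|I|.-tuple R) (x : T) : ham tau' (cb p) x = ham tau p.1 x + incr (am th) eps p.2 x.
  rewrite /ham /gh /incr -big_split/=; apply: eq_bigr => i _.
  rewrite coE.
  have -> : (al i * co p.1 i + be i * co p.2 i) * (Num.sqrt (tau' i) * a i x) =
     co p.1 i * (Num.sqrt (tau' i) * al i * a i x) + co p.2 i * (Num.sqrt (tau' i) * be i * a i x).
    by ring.
  rewrite sal sbe !exprMn t'E /am !exprMn; ring.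
pose L (z : #|I|.-tuple R) := ex M (fun x => h x + ham tau z x).
pose U (z : #|I|.-tuple R) := step_U M (am th) (fun x => h x + ham tau z x) eps.
have bhz z : bmf (fun x => h x + ham tau z x) by apply: bmfD => //; exact: bham.
have L0 z : 0 < L z by exact: ex_gt0.
have U0 z y : 0 < U z y by exact: (step_U_gt0 M (mam th) (amA th) (bhz z)).
have exE p : ex M (fun x => h x + ham tau' (cb p) x) = L p.1 * U p.1 p.2.
  rewrite /L /U /step_U -(ex_add M (bhz _) (bmf_incr (mam th) (amA th) _ _)).
  by congr ex; apply/funext => x; rewrite hamE addrA.
have Ueq z y : U z y = (L z)^-1 * ex M (fun x => (h x + ham tau z x) + incr (am th) eps y x).
  rewrite (ex_add M (bhz _) (bmf_incr (mam th) (amA th) _ _)) mulrA mulVf ?mul1r//.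
  by rewrite gt_eqF.
have incrgh y : incr (am th) eps y = gh (fun i x => eps * am th i x) y.
  by apply/funext => x; apply: eq_bigr => i _; field.
have meA i : measurable_fun setT (fun x => eps * am th i x) by exact: measurable_funM.
have eA i x : `|eps * am th i x| <= A.
  by rewrite normrM -[leRHS]mul1r ler_pM// ger0_norm// ltW.
have intU z : igl gam (U z) /\ \int[gam]_y U z y = 1.
  have [Hz hHz] := (bhz z).2.
  have iex : igl gam (fun y => ex M (fun x => (h x + ham tau z x) + gh (fun i x => eps * am th i x) y x)).
    apply: (igl_dom (g := fun y => expR Hz * expR (1 * step_bound A y))).
    - by apply: measurable_ex_gh => //; exact: (bhz z).1.
    - by apply: iglZ; exact: (igl_step_bound hg).
    move=> y.
    have /andP[l1 l2] : expR (- (Hz + step_bound A y)) <= ex M (fun x => (h x + ham tau z x) + gh (fun i x => eps * am th i x) y x) <= expR (Hz + step_bound A y).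
      apply: ex_bounds.
        by apply: measurable_funD; [exact: (bhz z).1|exact: (bmf_gh A0 meA eA y).1].
      move=> x; apply: le_trans (ler_normD _ _) _; apply: lerD => //.
      exact: (gh_bound A0 eA).
    rewrite mul1r -expRD ger0_norm//; apply: le_trans l1; exact: expR_ge0.
  split.
    rewrite (_ : U z = fun y => (L z)^-1 * ex M (fun x => (h x + ham tau z x) + gh (fun i x => eps * am th i x) y x)).
      exact: iglZ.
    by apply/funext => y; rewrite Ueq incrgh.
  under eq_Rintegral do rewrite Ueq incrgh.
  by rewrite RintZ// (mean_ex M hg A0 meA eA (bhz z)) mulVf// gt_eqF.
have mphi : measurable_fun setT (fun z => phi b (ex M (fun x => h x + ham tau' z x))).
  exact: measurable_phi_ham.
have mcb : measurable_fun setT cb by exact: measurable_comb_tuple.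
have mF : measurable_fun setT (fun p => phi b (ex M (fun x => h x + ham tau' (cb p) x))).
  exact: (measurableT_comp mphi mcb).
have iF : igl (gam \x gam)%E (fun p => phi b (ex M (fun x => h x + ham tau' (cb p) x))).
  apply: (igl_prod (g1 := fun z => expR (2 * H) * expR (2 * step_bound A z)) (g2 := fun y => expR (2 * step_bound A y)) mF).
  - by apply: iglZ; exact: (igl_step_bound hg).
  - exact: (igl_step_bound hg).
  - move=> z y.
    have -> : (fun x => h x + ham tau' (cb (z, y)) x) = fun x => h x + (ham tau z x + gh (fun i x => eps * am th i x) y x).
      by apply/funext => x; rewrite hamE incrgh.
    rewrite -!expRD -!mulrDr.
    have mk : measurable_fun setT (fun x => h x + (ham tau z x + gh (fun i x => eps * am th i x) y x)).
      apply: measurable_funD; first exact: bh.1.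
      by apply: measurable_funD; [exact: (bham z h01).1|exact: (bmf_gh A0 meA eA y).1].
    have [|//] := phi_bounds M b mk (C := H + step_bound A z + step_bound A y).
    move=> x; apply: le_trans (ler_normD _ _) _; rewrite -addrA; apply: lerD => //.
    apply: le_trans (ler_normD _ _) _; apply: lerD.
      exact: (gh_bound A0 (tauA h01)).
    exact: (gh_bound A0 eA).
  - by move=> z; rewrite mulr_ge0 ?expR_ge0.
  - by move=> z; exact: expR_ge0.
have Fsplit z y : phi b (ex M (fun x => h x + ham tau' (cb (z, y)) x)) =
    phi b (L z) * wt b (U z y) + wt b (L z) * phi b (U z y).
  by rewrite exE/= phi_mul// mulrC.
have iwU z : igl gam (fun y => wt b (U z y)) /\ \int[gam]_y wt b (U z y) = 1.
  by case: (b) => /=; [exact: intU|split; [exact: igl_cst|exact: Rint_cst]].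
have ipU z : igl gam (fun y => phi b (U z y)).
  exact: (igl_step M hg A0 (mam th) (amA th) (bhz z) b (ltW e0) e1).
have isec z : igl gam (fun y => phi b (ex M (fun x => h x + ham tau' (cb (z, y)) x))).
  under eq_fun do rewrite Fsplit.
  by apply: iglD; apply: iglZ => //; exact: (iwU z).1.
(* The fresh weight has mean 1, so the old value reappears exactly and only the increment handled by
   [step] is left. *)
have inner z : \int[gam]_y phi b (ex M (fun x => h x + ham tau' (cb (z, y)) x)) =
    phi b (L z) + wt b (L z) * \int[gam]_y phi b (U z y).
  under eq_Rintegral do rewrite Fsplit.
  rewrite RintD; [|apply: iglZ; exact: (iwU z).1|exact: iglZ].
  by rewrite !RintZ//; [rewrite (iwU z).2 mulr1|exact: (iwU z).1].
have E1 : Psi b tau' = \int[gam]_z (phi b (L z) + wt b (L z) * \int[gam]_y phi b (U z y)).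
  rewrite /Psi (Rint_law (P := (gam \x gam)%E) mcb _ mphi).
    rewrite Rint_prod//; apply: eq_Rintegral => z _; exact: inner.
  move=> S mS; exact: (comb_tuple_law hg (fun k => al0 _) (fun k => be0 _) (fun k => ab _) mS).
have iR : igl gam (fun z => phi b (L z) + wt b (L z) * \int[gam]_y phi b (U z y)).
  have := igl_Rint1 iF isec.
  by under eq_fun do rewrite inner.
have iphiL : igl gam (fun z => phi b (L z)) := igl_phi_ham b h01.
have idr := ig_drift b th h01.
rewrite E1 /Psi -/L -(RintB iR iphiL) -RintZ// -RintB; [|exact: iglB|exact: iglZ].
rewrite -(int_wt b h01) -RintZ; last exact: ig_wt.
apply: norm_Rint.
- by apply: iglB; [exact: iglB|exact: iglZ].
- by apply: iglZ; exact: ig_wt.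
move=> z; rewrite -/(L z).
have -> : phi b (L z) + wt b (L z) * \int[gam]_y phi b (U z y) - phi b (L z) - sg R b * (eps ^+ 2 / 2) * drift b tau th z
   = wt b (L z) * (\int[gam]_y phi b (U z y) - sg R b * (eps ^+ 2 / 2) * \sum_i gibbs M (fun x => h x + ham tau z x) (am th i) ^+ 2).
  by rewrite /drift -/(L z); ring.
have w0 : 0 <= wt b (L z) by case: (b) => //=; exact: ltW.
rewrite normrM ger0_norm// mulrC ler_wpM2r//.
exact: (step M hg A0 (mam th) (amA th) (bhz z) b (ltW e0) e1).
Qed.

Let path (th : I -> bool) (s : R) (i : I) : R := if th i then s else 1 - s.

Let path_step b (th : I -> bool) (kappa s eps : R) :
  (forall k : T -> R, bmf k -> - kappa <= \sum_i (gibbs M k (am th i) ^+ 2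
     - gibbs M k (am (fun j => ~~ th j) i) ^+ 2)) ->
  0 < eps -> eps <= 1 -> 0 <= s -> s + eps ^+ 2 <= 1 ->
  - (eps ^+ 2 * (kappa / 2 + 2 * step_const g I A * eps) * wt_mass b) <=
    sg R b * (Psi b (path th (s + eps ^+ 2)) - Psi b (path th s)).
Proof.
move=> hk e0 e1 s0 s1; have e2 : 0 < eps ^+ 2 by rewrite exprn_gt0.
(* The pointwise minimum of the two path points: each of them is reached from it by raising
   signal-to-noise ratios only, which is the form [Psi_step] requires. The difference of the two
   drifts is then taken under one and the same Gibbs measure. *)
pose be i := if th i then s else 1 - (s + eps ^+ 2).
have h01 : in01 be by move=> i; rewrite /be; case: (th i); apply/andP; split; lra.
have E1 : path th (s + eps ^+ 2) = fun i => be i + eps ^+ 2 * (th i)%:R.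
  by apply/funext => i; rewrite /path /be; case: (th i) => /=; lra.
have E2 : path th s = fun i => be i + eps ^+ 2 * (~~ th i)%:R.
  by apply/funext => i; rewrite /path /be; case: (th i) => /=; lra.
have in1 : in01 (fun i => be i + eps ^+ 2 * (th i)%:R).
  by rewrite -E1 => i; rewrite /path; case: (th i); apply/andP; split; lra.
have in2 : in01 (fun i => be i + eps ^+ 2 * (~~ th i)%:R).
  by rewrite -E2 => i; rewrite /path; case: (th i); apply/andP; split; lra.
have p1 := @Psi_step b be th eps e0 e1 h01 in1.
have p2 := @Psi_step b be (fun j => ~~ th j) eps e0 e1 h01 in2.
have d0 : - kappa * wt_mass b <= \int[gam]_z drift b be th z - \int[gam]_z drift b be (fun j => ~~ th j) z.
  rewrite -RintB; [|exact: ig_drift|exact: ig_drift].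
  rewrite -(int_wt b h01) -RintZ; last exact: ig_wt.
  apply: le_Rint; [by apply: iglZ; exact: ig_wt|by apply: iglB; exact: ig_drift|].
  move=> z; rewrite /drift -mulrBr mulrC; apply: ler_wpM2l.
    by case: (b) => //=; apply: ltW; apply: ex_gt0; apply: bmfD => //; exact: bham.
  rewrite -sumrB; apply: hk; apply: bmfD => //; exact: bham.
have d1 : - (eps ^+ 2 / 2 * (kappa * wt_mass b)) <= eps ^+ 2 / 2 *
   (\int[gam]_z drift b be th z - \int[gam]_z drift b be (fun j => ~~ th j) z).
  by rewrite -mulrN ler_wpM2l// -?mulNr// divr_ge0// ltW.
rewrite E1 E2.
move: p1 p2; set P1 := Psi _ _; set P2 := Psi _ _; set P3 := Psi _ _.
set D1 := Rintegral _ _ _ in d1 *; set D2 := Rintegral _ _ _ in d1 *.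
clearbody P1 P2 P3 D1 D2.
have -> : eps ^+ 2 * (kappa / 2 + 2 * step_const g I A * eps) * wt_mass b =
  eps ^+ 2 / 2 * (kappa * wt_mass b) + 2 * (step_const g I A * eps ^+ 3 * wt_mass b) by field.
rewrite -![sg R b * _ * _]mulrA; rewrite mulrBr in d1.
set W := wt_mass b in d1 *.
by move=> h1 h2; exact: (sg_arith d1 h1 h2).
Qed.

Lemma wt_mass_ge0 b : 0 <= wt_mass b.
Proof. by case: b => //=; apply: ltW; exact: ex_gt0. Qed.

Lemma step_const_ge0 : 0 <= step_const g I A.
Proof. by rewrite mulr_ge0//; apply: Rintegral_ge0 => z _; exact: expR_ge0. Qed.

(** Along the path the channels in [th] are switched on while the others are switched off. With
    [eps = 1 / m] there are [m ^ 2] steps, each with an error of order [m ^ (-3)]; the total is of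
    order [1 / m] and [m] is arbitrary. The factor 1/2 on [kappa] is that of [step]. *)
Lemma interpolation b (th : I -> bool) (kappa : R) :
  (forall k : T -> R, bmf k -> - kappa <= \sum_i (gibbs M k (am th i) ^+ 2
     - gibbs M k (am (fun j => ~~ th j) i) ^+ 2)) ->
  - (kappa / 2) * wt_mass b <=
    sg R b * (Psi b (fun i => (th i)%:R) - Psi b (fun i => (~~ th i)%:R)).
Proof.
move=> hk; set X := sg R b * _.
have E1 : (fun i => (th i)%:R) = path th 1.
  by apply/funext => i; rewrite /path; case: (th i) => //=; rewrite subrr.
have E0 : (fun i => (~~ th i)%:R) = path th 0.
  by apply/funext => i; rewrite /path; case: (th i) => //=; rewrite subr0.
have C0 := step_const_ge0; have W0 := wt_mass_ge0 b.
have key m : (0 < m)%N ->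
    - (kappa / 2) * wt_mass b - 2 * step_const g I A * wt_mass b * m%:R^-1 <= X.
  move=> m0; have mR : 0 < m%:R :> R by rewrite ltr0n.
  pose eps : R := m%:R^-1.
  have e0 : 0 < eps by rewrite invr_gt0.
  have e1 : eps <= 1 by rewrite invf_le1// ler1n.
  have em : (m ^ 2)%:R * eps ^+ 2 = 1 by rewrite natrX -exprMn divff ?expr1n// gt_eqF.
  have ind j : (j <= m ^ 2)%N ->
      - (j%:R * (eps ^+ 2 * (kappa / 2 + 2 * step_const g I A * eps) * wt_mass b)) <=
      sg R b * (Psi b (path th (j%:R * eps ^+ 2)) - Psi b (path th 0)).
    elim: j => [|j IH] jm; first by rewrite !mul0r subrr mulr0 oppr0.
    have s0 : 0 <= j%:R * eps ^+ 2 by rewrite mulr_ge0 ?ler0n ?sqr_ge0.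
    have s1 : j%:R * eps ^+ 2 + eps ^+ 2 <= 1.
      rewrite -[leRHS]em -[X in _ + X]mul1r -mulrDl ler_wpM2r ?sqr_ge0//.
      by rewrite natr1 ler_nat.
    have := path_step b hk e0 e1 s0 s1; have := IH (ltnW jm).
    have jS (u : R) : j.+1%:R * u = j%:R * u + u by rewrite -natr1 mulrDl mul1r.
    by rewrite !jS => h1 h2; exact: (step_arith h1 h2).
  have := ind _ (leqnn _); rewrite em -E1 -E0 -/X mulrA mulrA em mul1r.
  by rewrite -/eps; lra.
rewrite leNgt; apply/negP => hX.
pose D := - (kappa / 2) * wt_mass b - X.
have D0 : 0 < D by rewrite subr_gt0.
pose m := (Num.bound (2 * step_const g I A * wt_mass b / D)).+1.
have := key m isT; apply/negP; rewrite -ltNge.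
have b0 : 0 <= 2 * step_const g I A * wt_mass b / D.
  by apply: divr_ge0; [apply: mulr_ge0 => //; exact: mulr_ge0|exact: ltW].
have : 2 * step_const g I A * wt_mass b / D < m%:R.
  by apply: lt_trans (archi_boundP b0) _; rewrite ltr_nat.
rewrite ltr_pdivrMr// -ltr_pdivrMl ?ltr0n// mulrC => hm.
by rewrite /D in hm; lra.
Qed.

End interpolation.

(** * Matrix and scalar channels *)

Section edge_sums.
Context (R : realType) (n : nat).

Lemma sum_edge (F : 'I_n -> 'I_n -> R) :
  \sum_(e : edge n) F (val e).1 (val e).2 = \sum_(i < n) \sum_(j < n | (i < j)%N) F i j.
Proof.
rewrite pair_big_dep/= (reindex_omap (val : edge n -> 'I_n * 'I_n) insub)/=.
  apply: eq_bigl => e; rewrite valK eqxx andbT; symmetry; exact: (valP e).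
by move=> p hp; rewrite insubT.
Qed.

Lemma sum_sym_edge (F : 'I_n -> 'I_n -> R) : (forall i j, F i j = F j i) ->
  \sum_i \sum_j F i j = 2 * \sum_(e : edge n) F (val e).1 (val e).2 + \sum_i F i i.
Proof.
move=> Fsym; rewrite sum_edge.
have E (i : 'I_n) : \sum_j F i j = \sum_(j < n | (i < j)%N) F i j + \sum_(j < n | (j < i)%N) F i j + F i i.
  rewrite (bigD1 i)//= addrC; congr (_ + _).
  rewrite (bigID (fun j : 'I_n => (i < j)%N))/=; congr (_ + _); apply: eq_bigl => j.
    by rewrite -val_eqE/= neq_ltn orbC; case: ltngtP.
  by rewrite -val_eqE/=; case: ltngtP.
under eq_bigr do rewrite E; rewrite !big_split/=; congr (_ + _).
rewrite mulrDl mul1r; congr (_ + _).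
rewrite (exchange_big_dep predT)//=; apply: eq_bigr => i _.
by apply: eq_bigr => j _; rewrite Fsym.
Qed.

Lemma sum_edge_le (F : 'I_n -> 'I_n -> R) : (forall i j, F i j = F j i) ->
  (forall i, 0 <= F i i) ->
  2 * \sum_(e : edge n) F (val e).1 (val e).2 <= \sum_i \sum_j F i j.
Proof. by move=> Fs F0; rewrite sum_sym_edge// lerDl sumr_ge0. Qed.

End edge_sums.

Definition chan n : finType := ((edge n + unit) + 'I_n)%type.

Section channels.
Context d (T : measurableType d) (R : realType) (M : probability T R) (n : nat).
Context (lambda K : R) (l0 : 0 < lambda) (K0 : 0 <= K) (n0 : (0 < n)%N).
Context (y : 'I_n -> T -> R) (s : T -> R).
Hypothesis my : forall i, measurable_fun setT (y i).
Hypothesis yK : forall i x, `|y i x| <= K.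
Hypothesis ms : measurable_fun setT s.
Context (S : R).
Hypothesis sS : forall x, `|s x| <= S.

(** The matrix side consists of the edges and of one scalar channel for [s ^+ 2],
    the other side of [n] decoupled channels for [s * y i]. The scalar channel
    completes the square in [chan_kappa]. *)
Definition chan_coef (i : chan n) (x : T) : R :=
  match i with
  | inl (inl e) => Num.sqrt (lambda / n%:R) * y (val e).1 x * y (val e).2 x
  | inl (inr _) => Num.sqrt (n%:R * lambda / 2) * s x ^+ 2
  | inr i => Num.sqrt lambda * (s x * y i x)
  end.

Definition matrix_side (i : chan n) : bool := if i is inl _ then true else false.

Let by_ i : bmf (y i). Proof. by split => //; exists K. Qed.
Let bs : bmf s. Proof. by split => //; exists S. Qed.

Lemma bmf_chan i : bmf (chan_coef i).
Proof.
case: i => [[e|[]]|i] /=.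
- by apply: bmfM => //; exact: bmfZ.
- by apply: bmfZ; exact: bmfX.
- by apply: bmfZ; exact: bmfM.
Qed.

Lemma chan_bounded : exists2 A : R, 0 <= A & forall i x, `|chan_coef i x| <= A.
Proof.
have h i : {C : R | forall x, `|chan_coef i x| <= C} := cid (bmf_chan i).2.
exists (\sum_i sval (h i)).
  apply: sumr_ge0 => i _; apply: le_trans (svalP (h i) point); exact: normr_ge0.
move=> i x; apply: le_trans (svalP (h i) x) _.
rewrite (bigD1 i)//= lerDl; apply: sumr_ge0 => j _.
apply: le_trans (svalP (h j) point); exact: normr_ge0.
Qed.

Let nR : 0 < n%:R :> R. Proof. by rewrite ltr0n. Qed.

(** For two independent replicas [x], [t] the mean of the square of
    [\sum_i y i x * y i t - n%:R * s x * s t] is nonnegative. Times [lambda / (2 * n%:R)] it is the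
    sum in question plus the diagonal terms [i = j], which have no matrix channel and cost at most
    [lambda * K ^+ 4 / 2]. *)
Lemma chan_kappa (k : T -> R) : bmf k ->
  - (lambda * K ^+ 4 / 2) <=
  \sum_i (gibbs M k (fun x => (matrix_side i)%:R * chan_coef i x) ^+ 2
    - gibbs M k (fun x => (~~ matrix_side i)%:R * chan_coef i x) ^+ 2).
Proof.
move=> bk.
pose B i j := gibbs M k (fun x => y i x * y j x).
pose u i := gibbs M k (fun x => s x * y i x).
pose q := gibbs M k (fun x => s x ^+ 2).
have b0 : gibbs M k (fun=> 0) = 0 by exact: gibbs_cst.
have e1 (f : T -> R) : (fun x => true%:R * f x) = f by apply/funext => x; rewrite mul1r.
have e0 (f : T -> R) : (fun x => false%:R * f x) = (fun=> 0) by apply/funext => x; rewrite mul0r.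
rewrite big_sumType/= big_sumType/= [\sum_(i : unit) _](_ : _ = n%:R * lambda / 2 * q ^+ 2); last first.
  have -> : forall F : unit -> R, \sum_i F i = F tt.
    by move=> F; rewrite (bigD1 tt)//= big1 ?addr0// => -[].
  rewrite e1 e0 b0 expr0n subr0 gibbsZ//; last exact: bmfX.
  by rewrite exprMn sqr_sqrtr// divr_ge0// mulr_ge0 ?ler0n// ltW.
have -> : \sum_(i : edge n) (gibbs M k (fun x => true%:R * (Num.sqrt (lambda / n%:R) * y (val i).1 x * y (val i).2 x)) ^+ 2
    - gibbs M k (fun x => (~~ true)%:R * (Num.sqrt (lambda / n%:R) * y (val i).1 x * y (val i).2 x)) ^+ 2)
    = lambda / n%:R * \sum_(e : edge n) B (val e).1 (val e).2 ^+ 2.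
  rewrite mulr_sumr; apply: eq_bigr => e _; rewrite e1 e0 b0 expr0n subr0.
  under eq_fun do rewrite -mulrA.
  rewrite gibbsZ//; last exact: bmfM.
  by rewrite exprMn sqr_sqrtr// divr_ge0 ?ler0n// ltW.
have -> : \sum_(i < n) (gibbs M k (fun x => false%:R * (Num.sqrt lambda * (s x * y i x))) ^+ 2
    - gibbs M k (fun x => (~~ false)%:R * (Num.sqrt lambda * (s x * y i x))) ^+ 2)
    = - (lambda * \sum_i u i ^+ 2).
  rewrite mulr_sumr -sumrN; apply: eq_bigr => i _; rewrite e1 e0 b0 expr0n sub0r.
  rewrite gibbsZ//; last exact: bmfM.
  by rewrite exprMn sqr_sqrtr// ltW.
(* [Q x] is already averaged over the second replica, which keeps the argument on a single copy of
   the Gibbs space. *)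
pose Q x := \sum_i \sum_j y i x * y j x * B i j - 2 * n%:R * (\sum_i s x * y i x * u i) + n%:R ^+ 2 * q * s x ^+ 2.
have Q0 x : 0 <= Q x.
  have -> : Q x = gibbs M k (fun t => (\sum_i y i x * y i t - n%:R * s x * s t) ^+ 2).
    have -> : (fun t => (\sum_i y i x * y i t - n%:R * s x * s t) ^+ 2) =
       fun t => (\sum_i \sum_j y i x * y j x * (y i t * y j t) - \sum_i (2 * n%:R * (s x * y i x)) * (s t * y i t))
          + n%:R ^+ 2 * s x ^+ 2 * s t ^+ 2.
      apply/funext => t; rewrite sqrrB exprMn exprMn; congr (_ - _ + _).
        rewrite expr2 big_distrlr/=; apply: eq_bigr => i _; apply: eq_bigr => j _.
        by rewrite mulrACA.
      rewrite mulr_suml -mulr_natr mulr_suml; apply: eq_bigr => i _; ring.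
    rewrite gibbsD//; last 2 first.
    - apply: bmfB; last by apply: bmf_sum => i; apply: bmfZ; exact: bmfM.
      by apply: bmf_sum => i; apply: bmf_sum => j; apply: bmfZ; exact: bmfM.
    - by apply: bmfZ; exact: bmfX.
    rewrite gibbsB//; last 2 first.
    - by apply: bmf_sum => i; apply: bmf_sum => j; apply: bmfZ; exact: bmfM.
    - by apply: bmf_sum => i; apply: bmfZ; exact: bmfM.
    rewrite gibbs_sum// => [|i]; last by apply: bmf_sum => j; apply: bmfZ; exact: bmfM.
    rewrite gibbs_sum// => [|i]; last by apply: bmfZ; exact: bmfM.
    rewrite gibbsZ//; last exact: bmfX.
    rewrite /Q; congr (_ - _ + _); last by rewrite mulrAC.
      apply: eq_bigr => i _; rewrite gibbs_sum// => [|j]; last by apply: bmfZ; exact: bmfM.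
      by apply: eq_bigr => j _; rewrite gibbsZ//; exact: bmfM.
    rewrite mulr_sumr; apply: eq_bigr => i _; rewrite gibbsZ//; last exact: bmfM.
    by rewrite mulrA.
  by apply: gibbs_ge0 => // t; exact: sqr_ge0.
have QE : gibbs M k Q = \sum_i \sum_j B i j ^+ 2 - 2 * n%:R * (\sum_i u i ^+ 2) + n%:R ^+ 2 * q ^+ 2.
  have bB : bmf (fun x => \sum_i \sum_j y i x * y j x * B i j).
    apply: bmf_sum => i; apply: bmf_sum => j; under eq_fun do rewrite mulrC.
    by apply: bmfZ; exact: bmfM.
  have bu i : bmf (fun x => s x * y i x * u i).
    by under eq_fun do rewrite mulrC; apply: bmfZ; exact: bmfM.
  have bsu : bmf (fun x => \sum_i s x * y i x * u i) by exact: bmf_sum.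
  rewrite /Q gibbsD//; last 2 first.
  - by apply: bmfB => //; exact: bmfZ.
  - by apply: bmfZ; exact: bmfX.
  rewrite gibbsB//; last exact: bmfZ.
  rewrite [in X in _ + X]gibbsZ//; last exact: bmfX.
  rewrite -mulrA -expr2 gibbsZ//; congr (_ - _ * _ + _).
    rewrite gibbs_sum// => [|i]; last first.
      apply: bmf_sum => j; under eq_fun do rewrite mulrC.
      by apply: bmfZ; exact: bmfM.
    apply: eq_bigr => i _; rewrite gibbs_sum// => [|j]; last first.
      by under eq_fun do rewrite mulrC; apply: bmfZ; exact: bmfM.
    apply: eq_bigr => j _; under eq_fun do rewrite mulrC.
    by rewrite gibbsZ ?expr2//; exact: bmfM.
  rewrite gibbs_sum//; apply: eq_bigr => i _; under eq_fun do rewrite mulrC.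
  by rewrite gibbsZ ?expr2//; exact: bmfM.
have Qge : 0 <= \sum_i \sum_j B i j ^+ 2 - 2 * n%:R * (\sum_i u i ^+ 2) + n%:R ^+ 2 * q ^+ 2.
  by rewrite -QE; exact: gibbs_ge0.
have Bsym i j : B i j ^+ 2 = B j i ^+ 2.
  by congr (_ ^+ 2); congr gibbs; apply/funext => x; rewrite mulrC.
rewrite (sum_sym_edge Bsym) in Qge.
have Bdiag : \sum_i B i i ^+ 2 <= n%:R * K ^+ 4.
  rewrite -[X in X%:R * _]card_ord -sum_const_card; apply: ler_sum => i _.
  rewrite -real_normK ?num_real// -[4%N]/(2 * 2)%N exprM lerXn2r ?nnegrE ?sqr_ge0//.
  apply: gibbs_norm_le => //; first exact: bmfM.
  by move=> x; rewrite normrM expr2 ler_pM.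
set E2 := \sum_e _ in Qge *; set D2 := \sum_i B i i ^+ 2 in Qge Bdiag.
set U2 := \sum_i u i ^+ 2 in Qge *.
have : 0 <= lambda / (2 * n%:R) * (2 * E2 + D2 - 2 * n%:R * U2 + n%:R ^+ 2 * q ^+ 2).
  by rewrite mulr_ge0// divr_ge0 ?(ltW l0)// mulr_ge0// ltW.
have : lambda / (2 * n%:R) * D2 <= lambda / (2 * n%:R) * (n%:R * K ^+ 4).
  by rewrite ler_wpM2l// divr_ge0 ?(ltW l0)// mulr_ge0// ltW.
have -> : lambda / (2 * n%:R) * (n%:R * K ^+ 4) = lambda * K ^+ 4 / 2 by field; rewrite gt_eqF.
have -> : lambda / (2 * n%:R) * (2 * E2 + D2 - 2 * n%:R * U2 + n%:R ^+ 2 * q ^+ 2) =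
  lambda / (2 * n%:R) * D2 + (lambda / n%:R * E2 + n%:R * lambda / 2 * q ^+ 2 - lambda * U2).
  by field; rewrite gt_eqF.
move: (lambda / (2 * n%:R) * D2) (lambda / n%:R * E2) (n%:R * lambda / 2 * q ^+ 2) (lambda * U2) (lambda * K ^+ 4 / 2).
by move=> *; lra.
Qed.

End channels.

(** * Planted signals and change of measure *)

Section planting.
Context d (T : measurableType d) (R : realType) (M : probability T R).
Context (g : probability R R) (hg : gaussian_law g) (I : finType).
Local Notation gam := (tuple_prob g #|I|).
Context (c : I -> T -> R) (A : R) (A0 : 0 <= A).
Hypothesis mc : forall i, measurable_fun setT (c i).
Hypothesis cA : forall i x, `|c i x| <= A.

Lemma sum_enum (F : 'I_#|I| -> R) : \sum_k F k = \sum_(i : I) F (enum_rank i).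
Proof. by rewrite (reindex (@enum_rank I))//; apply: onW_bij; exact: enum_rank_bij. Qed.

Definition planted (X : T) (z : #|I|.-tuple R) (x : T) : R :=
  \sum_i ((co z i + c i X) * c i x - c i x ^+ 2 / 2).

(** Under the null model [Y] is pure noise and [ex M (gh c Y)] is the likelihood
    ratio, so reweighting by it plants a signal. *)
Lemma planted_mean (F : #|I|.-tuple R -> R) : measurable_fun setT F ->
  (forall z, `|F z| <= expR (2 * step_bound A z)) ->
  \int[gam]_z (F z * ex M (gh c z)) =
  \int[M]_X \int[gam]_z F (shift_tuple (fun k => c (enum_val k) X) z).
Proof.
move=> mF FB; have bg z : bmf (gh c z) by exact: (bmf_gh A0 mc cA).
pose H (p : #|I|.-tuple R * T) := F p.1 * expR (gh c p.1 p.2).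
have mH : measurable_fun setT H.
  apply: measurable_funM; first by apply: (measurableT_comp mF); exact: measurable_fst.
  by apply: measurableT_comp => //; exact: (measurable_gh2 mc).
have HB z x : `|H (z, x)| <= expR (3 * step_bound A z).
  rewrite normrM (ger0_norm (expR_ge0 _)) (_ : 3 * _ = 2 * step_bound A z + step_bound A z); last by ring.
  rewrite expRD ler_pM// ler_expR; apply: le_trans (ler_norm _) _; exact: (gh_bound A0 cA).
have iH : igl (gam \x M)%E H.
  apply: (igl_prod mH (igl_step_bound hg I A 3) (igl_cst M 1)) => //.
  by move=> z x; rewrite mulr1; exact: HB.
have s1 z : igl M (fun x => H (z, x)) by apply: (iglZ (F z) (f := fun x => expR (gh c z x))); apply: bmf_igl; exact: bmf_expR.
have s2 x : igl gam (fun z => H (z, x)).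
  by apply: (igl_dom _ (igl_step_bound hg I A 3)) => //; exact: meas_sec2.
transitivity (\int[gam]_z \int[M]_x H (z, x)).
  by apply: eq_Rintegral => z _; rewrite /= -RintZ//; apply: bmf_igl; exact: bmf_expR.
rewrite (Rint_swap iH s1 s2); apply: eq_Rintegral => X _.
pose cX (k : 'I_#|I|) := c (enum_val k) X.
have E z : H (z, X) = F z * shift_dens cX z.
  rewrite /H/=; congr (_ * expR _); rewrite sum_enum; apply: eq_bigr => i _.
  by rewrite /cX enum_rankK /co mulrC.
under eq_Rintegral do rewrite E.
by rewrite -(Rint_tuple_shift hg cX mF).
Qed.

Lemma gh_shift (b : I -> T -> R) X z x : gh b (shift_tuple (fun k => c (enum_val k) X) z) x =
  \sum_i ((co z i + c i X) * b i x - b i x ^+ 2 / 2).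
Proof. by apply: eq_bigr => i _; rewrite /co tnth_mktuple enum_rankK. Qed.

Lemma ln_ex_gh_le z : `|ln (ex M (gh c z))| <= expR (2 * step_bound A z).
Proof.
have [|//] := phi_bounds M false (bmf_gh A0 mc cA z).1 (C := step_bound A z).
by move=> x; exact: (gh_bound A0 cA).
Qed.

Lemma measurable_ln_ex_gh : measurable_fun setT (fun z => ln (ex M (gh c z))).
Proof.
apply: (measurableT_comp (@measurable_ln R)).
have := measurable_ex_gh M mc (@measurable_cst _ _ _ _ setT (0 : R)).
by under eq_fun do (under eq_fun do rewrite add0r).
Qed.

(** Relative entropy under the null model is the free energy under the planted one: reweight [ln L]
    by [L]. *)
Lemma planting : \int[gam]_z phi true (ex M (gh c z)) =
  \int[M]_X \int[gam]_z ln (ex M (planted X z)).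
Proof.
transitivity (\int[gam]_z (ln (ex M (gh c z)) * ex M (gh c z))).
  by apply: eq_Rintegral => z _; rewrite /= mulrC.
rewrite (planted_mean measurable_ln_ex_gh ln_ex_gh_le).
apply: eq_Rintegral => X _; apply: eq_Rintegral => z _.
by congr (ln (ex _ _)); apply/funext => x; exact: gh_shift.
Qed.

End planting.

(** * The scalar channel *)

Section scalar_channel.
Context (R : realType) (P0 g : probability R R) (hg : gaussian_law g).
Context (cl : R -> R) (K : R) (K0 : 0 <= K).
Hypothesis mcl : measurable_fun setT cl.
Hypothesis clK : forall x, `|cl x| <= K.

(** [r] is the signal-to-noise ratio and [t] the coupling to the planted [X]: [t = r]
    is the matched channel, [t = - r] comes from negative overlaps. *)
Definition sham (r t X z x : R) : R := Num.sqrt r * z * cl x + t * cl x * cl X - r / 2 * cl x ^+ 2.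
Definition slog (r t X z : R) : R := ln (ex P0 (sham r t X z)).

Lemma bmf_cl : bmf cl. Proof. by split => //; exists K. Qed.

Lemma bmf_sham r t X z : bmf (sham r t X z).
Proof.
apply: bmfB; last by apply: bmfZ; apply: bmfX; exact: bmf_cl.
apply: bmfD; first by apply: bmfZ; exact: bmf_cl.
by under eq_fun do rewrite mulrC; apply: bmfZ; apply: bmfZ; exact: bmf_cl.
Qed.

Definition sbound (r t z : R) : R := Num.sqrt r * K * `|z| + (`|t| + `|r| / 2) * K ^+ 2.

Lemma sham_le r t X z x : `|sham r t X z x| <= sbound r t z.
Proof.
rewrite /sbound mulrDl addrA; apply: le_trans (ler_normB _ _) _; apply: lerD.
  apply: le_trans (ler_normD _ _) _; apply: lerD.
    rewrite !normrM (ger0_norm (sqrtr_ge0 r)) -mulrA [leRHS]mulrAC -mulrA.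
    by rewrite ler_wpM2l ?sqrtr_ge0// ler_wpM2l.
  by rewrite !normrM -mulrA ler_wpM2l// expr2 ler_pM.
by rewrite normrM normrX normrM (@ger0_norm _ 2^-1)// ler_wpM2l ?divr_ge0// lerXn2r ?nnegrE.
Qed.

Lemma slog_le r t X z : `|slog r t X z| <= sbound r t z.
Proof.
have /andP[l1 l2] := ex_bounds P0 (bmf_sham r t X z).1 (sham_le r t X z).
have L0 : 0 < ex P0 (sham r t X z) by apply: lt_le_trans l1; exact: expR_gt0.
by rewrite ler_norml -ler_expR lnK// l1 -ler_expR lnK.
Qed.

Lemma measurable_slog r t : measurable_fun setT (fun p : R * R => slog r t p.1 p.2).
Proof.
apply: (measurableT_comp (@measurable_ln R)).
apply: (meas_Rint P0 (f := fun p : (R * R) * R => expR (sham r t p.1.1 p.1.2 p.2))).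
have m2 : measurable_fun setT (fun p : (R * R) * R => cl p.2).
  by apply: (measurableT_comp mcl); exact: measurable_snd.
have m1 : measurable_fun setT (fun p : (R * R) * R => cl p.1.1).
  apply: (measurableT_comp mcl); apply: (measurableT_comp measurable_fst); exact: measurable_fst.
have mz : measurable_fun setT (fun p : (R * R) * R => p.1.2).
  by apply: (measurableT_comp measurable_snd); exact: measurable_fst.
apply: measurableT_comp => //; apply: measurable_funB; last first.
  by apply: measurable_funM => //; exact: measurable_funX.
by apply: measurable_funD; apply: measurable_funM => //; exact: measurable_funM.
Qed.

Lemma igl_sbound r t : igl g (fun z => sbound r t z).
Proof.
apply: iglD; last exact: igl_cst.
by apply: iglZ; apply: igl_norm; exact: (igl_id hg).
Qed.

Lemma igl_sbound2 r t : igl g (fun z => sbound r t z ^+ 2).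
Proof.
pose a := Num.sqrt r * K; pose b := (`|t| + `|r| / 2) * K ^+ 2.
rewrite (_ : (fun z => _) = fun z => a ^+ 2 * z ^+ 2 + (2 * a * b) * `|z| + b ^+ 2); last first.
  apply/funext => z; rewrite /sbound -/a -/b sqrrD exprMn real_normK ?num_real//.
  by congr (_ + _ + _); rewrite -mulr_natl; ring.
apply: iglD; last exact: igl_cst.
by apply: iglD; apply: iglZ; [exact: (igl_sqr hg)|apply: igl_norm; exact: (igl_id hg)].
Qed.

Lemma igl_slog r t X : igl g (fun z => slog r t X z).
Proof.
apply: (igl_dom _ (igl_sbound r t)) => [|z]; last exact: slog_le.
exact: (meas_sec1 X (measurable_slog r t)).
Qed.

Definition smean (r t X : R) : R := \int[g]_z slog r t X z.

Lemma measurable_smean r t : measurable_fun setT (smean r t).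
Proof. exact: (meas_Rint g (measurable_slog r t)). Qed.

Lemma smean_le r t X : `|smean r t X| <= \int[g]_z sbound r t z.
Proof.
by apply: norm_Rint; [exact: igl_slog|exact: igl_sbound|move=> z; exact: slog_le].
Qed.

Lemma igl_smean r t : igl P0 (smean r t).
Proof. exact: igl_bound (measurable_smean r t) (smean_le r t). Qed.

(** At [r = t = lambda * q] this is the logarithmic term of the potential. *)
Definition gmean (r t : R) : R := \int[P0]_X smean r t X.

End scalar_channel.

Section planted_bounds.
Context d (T : measurableType d) (R : realType) (M : probability T R).
Context (g : probability R R) (hg : gaussian_law g) (I : finType).
Local Notation gam := (tuple_prob g #|I|).
Context (c : I -> T -> R) (A : R) (A0 : 0 <= A).
Hypothesis mc : forall i, measurable_fun setT (c i).
Hypothesis cA : forall i x, `|c i x| <= A.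

Context (h : T -> T -> R) (H : R).
Hypothesis mh : measurable_fun setT (fun p : T * T => h p.1 p.2).
Hypothesis hH : forall X x, `|h X x| <= H.

Definition pbound (z : #|I|.-tuple R) : R := H + (A * absum z + #|I|%:R * (2 * A ^+ 2)).

Lemma tilted_le X z x : `|h X x + planted c X z x| <= pbound z.
Proof.
apply: le_trans (ler_normD _ _) _; apply: lerD => //.
apply: le_trans (ler_norm_sum _ _ _) _.
apply: (@le_trans _ _ (\sum_i (A * `|co z i| + 2 * A ^+ 2))).
  apply: ler_sum => i _; apply: le_trans (ler_normB _ _) _.
  have h1 : `|(co z i + c i X) * c i x| <= (`|co z i| + A) * A.
    by rewrite normrM ler_pM// (le_trans (ler_normD _ _))// lerD2l.
  have h2 : `|c i x ^+ 2 / 2| <= A ^+ 2 / 2.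
    by rewrite normrM normrX (@ger0_norm _ 2^-1)// ler_wpM2r// lerXn2r ?nnegrE.
  have := sqr_ge0 A; lra.
by rewrite big_split/= -mulr_sumr sum_const_card.
Qed.

Lemma igl_pbound : igl gam pbound.
Proof.
apply: iglD; first exact: igl_cst.
apply: iglD; last exact: igl_cst.
apply: iglZ; apply: igl_sum => i; apply: igl_norm; exact: (igl_co i (igl_id hg)).
Qed.

Lemma bmf_planted X z : bmf (planted c X z).
Proof.
have bc i : bmf (c i) by split => //; exists A.
apply: bmf_sum => i; apply: bmfB; first exact: bmfZ.
by under eq_fun do rewrite mulrC; apply: bmfZ; exact: bmfX.
Qed.

Lemma measurable_planted3 :
  measurable_fun setT (fun p : (T * #|I|.-tuple R) * T => planted c p.1.1 p.1.2 p.2).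
Proof.
have m2 i : measurable_fun setT (fun p : (T * #|I|.-tuple R) * T => c i p.2).
  by apply: (measurableT_comp (mc i)); exact: measurable_snd.
have m1 i : measurable_fun setT (fun p : (T * #|I|.-tuple R) * T => c i p.1.1).
  by apply: (measurableT_comp (mc i)); apply: (measurableT_comp measurable_fst); exact: measurable_fst.
have mz i : measurable_fun setT (fun p : (T * #|I|.-tuple R) * T => co p.1.2 i).
  apply: (measurableT_comp (measurable_co i)).
  by apply: (measurableT_comp measurable_snd); exact: measurable_fst.
apply: measurable_sum => i; apply: measurable_funB.
  by apply: measurable_funM => //; exact: measurable_funD.
by apply: measurable_funM => //; exact: measurable_funX.
Qed.

Lemma bmf_tilted X z : bmf (fun x => h X x + planted c X z x).
Proof.
apply: bmfD (bmf_planted X z); split; last by exists H.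
exact: (meas_sec1 X mh).
Qed.

(** The extra energy [h] may depend on the signal: zero gives the log partition function of the
    posterior, [tilt] the tilted one. *)
Definition lnp (X : T) (z : #|I|.-tuple R) : R := ln (ex M (fun x => h X x + planted c X z x)).

Lemma lnp_le X z : `|lnp X z| <= pbound z.
Proof.
have /andP[l1 l2] := ex_bounds M (bmf_tilted X z).1 (tilted_le X z).
have L0 : 0 < ex M (fun x => h X x + planted c X z x) by apply: lt_le_trans l1; exact: expR_gt0.
by rewrite /lnp ler_norml -ler_expR lnK// l1 -ler_expR lnK.
Qed.

Lemma measurable_lnp : measurable_fun setT (fun p : T * #|I|.-tuple R => lnp p.1 p.2).
Proof.
apply: (measurableT_comp (@measurable_ln R)).
apply: (meas_Rint M (f := fun p => expR (h p.1.1 p.2 + planted c p.1.1 p.1.2 p.2))).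
apply: measurableT_comp => //; apply: measurable_funD; last exact: measurable_planted3.
apply: (measurableT_comp mh (g := fun p : (T * #|I|.-tuple R) * T => (p.1.1, p.2))).
apply/measurable_fun_pair; last exact: measurable_snd.
by apply: (measurableT_comp measurable_fst); exact: measurable_fst.
Qed.

Lemma igl_lnp X : igl gam (lnp X).
Proof.
apply: (igl_dom _ igl_pbound) => [|z]; last exact: lnp_le.
exact: (meas_sec1 X measurable_lnp).
Qed.

Lemma igl_lnp2 : igl M (fun X => \int[gam]_z lnp X z).
Proof.
apply: igl_bound; first exact: (meas_Rint gam measurable_lnp).
move=> X; apply: (@norm_Rint _ _ _ _ _ pbound).
- exact: igl_lnp.
- exact: igl_pbound.
- exact: lnp_le.
Qed.

End planted_bounds.

Lemma sum_chan (R : realType) n (F : chan n -> R) :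
  \sum_i F i = \sum_(e : edge n) F (inl (inl e)) + F (inl (inr tt)) + \sum_(i < n) F (inr i).
Proof.
rewrite big_sumType/= big_sumType/=; congr (_ + _ + _).
by rewrite (bigD1 tt)//= big1 ?addr0// => -[].
Qed.

Lemma ln_prod_gt0 (R : realType) (I : finType) (F : I -> R) :
  (forall i, 0 < F i) -> ln (\prod_i F i) = \sum_i ln (F i).
Proof.
move=> F0; suff [] : 0 < \prod_i F i /\ ln (\prod_i F i) = \sum_i ln (F i) by [].
elim/big_rec2: _ => [|i x y _ [y0 <-]]; first by rewrite ltr01 ln1.
by rewrite mulr_gt0// lnM ?posrE.
Qed.

Lemma quarter_arith (R : realType) (a b c e : R) : - (e / 2 / 2) <= a + c - b -> b <= a + c + e / 4.
Proof. lra. Qed.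

(** * Lower bound for the free energy of the posterior *)

Section model.
Context (R : realType) (P0 g : probability R R) (hg : gaussian_law g).
Context (cl : R -> R) (K : R) (K0 : 0 <= K).
Hypothesis mcl : measurable_fun setT cl.
Hypothesis clK : forall x, `|cl x| <= K.
Context (lambda : R) (l0 : 0 < lambda) (n : nat) (n0 : (0 < n)%N).
Local Notation M := (tuple_prob P0 n).
Local Notation gam := (tuple_prob g #|chan n|).

Definition spin (i : 'I_n) (x : n.-tuple R) : R := cl (tnth x i).

Lemma measurable_spin i : measurable_fun setT (spin i).
Proof. by apply: (measurableT_comp mcl); exact: measurable_tnth. Qed.

(** The index type remains [chan n], with zero coefficients off the edges, so that the model and the
    interpolation share one noise space. *)
Definition edge_coef (i : chan n) (x : n.-tuple R) : R :=
  match i with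
  | inl (inl e) => Num.sqrt (lambda / n%:R) * spin (val e).1 x * spin (val e).2 x
  | _ => 0
  end.

Lemma edge_coef_bmf : (forall i, measurable_fun setT (edge_coef i)) /\
  forall i x, `|edge_coef i x| <= Num.sqrt (lambda / n%:R) * K ^+ 2.
Proof.
have c0 : 0 <= Num.sqrt (lambda / n%:R) * K ^+ 2 by rewrite mulr_ge0 ?sqrtr_ge0 ?sqr_ge0.
split=> [i|i x]; case: i => [[e|?]|i] /=; rewrite ?normr0//; try exact: measurable_cst.
  by apply: measurable_funM; [apply: measurable_funM => //|]; exact: measurable_spin.
by rewrite !normrM (ger0_norm (sqrtr_ge0 _)) -mulrA ler_wpM2l ?sqrtr_ge0// expr2 ler_pM// clK.
Qed.

Lemma factorization (f : 'I_n -> R -> R) : (forall i, bmf (f i)) ->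
  ex M (fun x => \sum_i f i (tnth x i)) = \prod_i ex P0 (f i).
Proof.
move=> bf.
have [_ <-] := tuple_prod (P := P0) (f := fun i x => expR (f i x)) (fun i => bmf_igl P0 (bmf_expR (bf i))).
by apply: eq_Rintegral => x _; rewrite expR_sum.
Qed.

Lemma igl_slog_co r t X (j : 'I_n) (i : chan n) :
  igl gam (fun z : #|chan n|.-tuple R => slog P0 cl r t (tnth X j) (co z i)).
Proof. exact: (igl_co i (igl_slog P0 hg K0 mcl clK r t (tnth X j))). Qed.

Lemma Rint_slog_co r t X (j : 'I_n) (i : chan n) :
  \int[gam]_z slog P0 cl r t (tnth X j) (co z i) = smean P0 g cl r t (tnth X j).
Proof.
rewrite /smean -(@Rint_co _ _ _ g (chan n) (slog P0 cl r t (tnth X j)) i)//.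
exact: (meas_sec1 _ (measurable_slog P0 mcl r t)).
Qed.

Lemma igl_smean_tnth r t (j : 'I_n) : igl M (fun X : n.-tuple R => smean P0 g cl r t (tnth X j)).
Proof.
apply: igl_bound => [|X]; last exact: (smean_le P0 hg K0 mcl clK).
by apply: (measurableT_comp (measurable_smean P0 g mcl r t)); exact: measurable_tnth.
Qed.

Lemma Rint_smean_tnth r t (j : 'I_n) :
  \int[M]_X smean P0 g cl r t (tnth X j) = gmean P0 g cl r t.
Proof.
rewrite /gmean -(Rint_law (P := M) (Q := P0) (measurable_tnth j))//.
  by move=> S mS; exact: tuple_prob_tnth.
exact: (measurable_smean P0 g mcl).
Qed.

Local Notation lnZ := (lnp M edge_coef (fun _ _ => 0)).

Lemma free_energy_lower (q : R) : 0 <= q ->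
  n%:R * gmean P0 g cl (lambda * q) (lambda * q) <=
  \int[M]_X \int[gam]_z lnZ X z + n%:R * lambda * q ^+ 2 / 4 + lambda * K ^+ 4 / 4.
Proof.
move=> q0; set sq := Num.sqrt q.
have sq2 : sq ^+ 2 = q by rewrite sqr_sqrtr.
(* A constant amplitude [Num.sqrt q] makes [s * y i] a scalar channel of signal-to-noise ratio
   [lambda * q], and leaves nothing random in the signal of the extra channel. *)
pose s (_ : n.-tuple R) := sq.
have ms : measurable_fun setT s by exact: measurable_cst.
have sS x : `|s x| <= sq by rewrite ger0_norm ?sqrtr_ge0.
have sK i x : `|spin i x| <= K by exact: clK.
pose a := chan_coef lambda spin s.
have ba i : bmf (a i) by exact: (bmf_chan lambda measurable_spin sK ms sS).
have [A A0 aA] := chan_bounded lambda measurable_spin sK ms sS.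
have ma i : measurable_fun setT (a i) := (ba i).1.
have := interpolation hg A0 ma aA (bmf_cst _ 0) true
  (chan_kappa M l0 n0 measurable_spin sK ms sS).
rewrite /wt_mass /ex expR0 Rint_cst mulr1 /sg mul1r.
pose L (th : chan n -> bool) :=
  \int[M]_X \int[gam]_z ln (ex M (planted (fun i x => (th i)%:R * a i x) X z)).
have PsiE (th : chan n -> bool) : Psi M g a (fun=> 0) true (fun i => (th i)%:R) = L th.
  have sth i : Num.sqrt ((th i)%:R : R) = (th i)%:R by case: (th i); rewrite ?sqrtr1 ?sqrtr0.
  rewrite /Psi /L -(planting M hg A0).
  - apply: eq_Rintegral => z _; congr (phi _ (ex _ _)); apply/funext => x.
    by rewrite add0r /ham /gh; apply: eq_bigr => i _; rewrite sth.
  - by move=> i; exact: measurable_funM.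
  - by move=> i x; case: (th i); rewrite ?mul1r// mul0r normr0.
rewrite !PsiE => main.
have [me eA] := edge_coef_bmf.
have cA0 : 0 <= Num.sqrt (lambda / n%:R) * K ^+ 2 by rewrite mulr_ge0 ?sqrtr_ge0 ?sqr_ge0.
pose c0 := Num.sqrt (n%:R * lambda / 2) * sq ^+ 2.
have c02 : c0 ^+ 2 / 2 = n%:R * lambda * q ^+ 2 / 4.
  by rewrite /c0 sq2 exprMn sqr_sqrtr ?divr_ge0 ?mulr_ge0 ?ler0n ?(ltW l0)//; field.
have m0 : measurable_fun setT (fun p : n.-tuple R * n.-tuple R => 0 : R) by exact: measurable_cst.
have h0 (X x : n.-tuple R) : `|0 : R| <= 0 by rewrite normr0.
(* The coefficient of the extra channel is constant and leaves the Gibbs average: it contributes a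
   noise of mean zero and [c0 ^+ 2 / 2], which is [n] times the quadratic term of the potential with
   its sign reversed. *)
have E1 : L (@matrix_side n) = \int[M]_X \int[gam]_z lnZ X z + n%:R * lambda * q ^+ 2 / 4.
  pose D (z : #|chan n|.-tuple R) := c0 * co z (inl (inr tt)) + c0 ^+ 2 / 2.
  have iD : igl gam D by apply: iglD; [apply: iglZ; exact: (igl_co _ (igl_id hg))|exact: igl_cst].
  have intD : \int[gam]_z D z = n%:R * lambda * q ^+ 2 / 4.
    rewrite RintD; [|by apply: iglZ; exact: (igl_co _ (igl_id hg))|exact: igl_cst].
    rewrite Rint_cst RintZ; last exact: (igl_co _ (igl_id hg)).
    by rewrite (@Rint_co _ _ _ g (chan n) id)// gaussian_mean// mulr0 add0r c02.
  rewrite -intD -[X in _ + X](Rint_cst M) -RintD; [|exact: (igl_lnp2 M hg cA0 me eA m0 h0)|exact: igl_cst].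
  apply: eq_Rintegral => X _; rewrite -RintD//; last exact: (igl_lnp M hg cA0 me eA m0 h0).
  apply: eq_Rintegral => z _.
  have -> : planted (fun i x => (matrix_side i)%:R * a i x) X z = fun x => D z + planted edge_coef X z x.
    apply/funext => x; rewrite /planted !sum_chan /=.
    rewrite [X in _ + X = _]big1 => [|i _]; last by rewrite !mul0r mulr0 expr0n/= mul0r subr0.
    rewrite [X in _ = D z + (_ + _ + X)]big1 => [|i _]; last by rewrite mulr0 expr0n/= mul0r subr0.
    rewrite !addr0 mulr0 expr0n/= mul0r subr0 addr0 addrC; congr (_ + _); first by rewrite /D /c0 /s; field.
    by apply: eq_bigr => e _; rewrite !mul1r.
  rewrite /lnp /ex; under eq_Rintegral do rewrite expRD.
  under [in RHS]eq_Rintegral do rewrite add0r.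
  have be := bmf_planted me eA X z.
  rewrite RintZ; last exact: bmf_igl (bmf_expR be).
  rewrite lnM ?posrE ?expR_gt0//; last exact: (ex_gt0 M be).
  by rewrite expRK addrC.
have E2 : L (fun i => ~~ matrix_side i) = n%:R * gmean P0 g cl (lambda * q) (lambda * q).
  have E X z : ln (ex M (planted (fun i x => (~~ matrix_side i)%:R * a i x) X z)) =
      \sum_(i < n) slog P0 cl (lambda * q) (lambda * q) (tnth X i) (co z (inr i)).
    have -> : planted (fun i x => (~~ matrix_side i)%:R * a i x) X z =
        fun x => \sum_(i < n) sham cl (lambda * q) (lambda * q) (tnth X i) (co z (inr i)) (tnth x i).
      apply/funext => x; rewrite /planted sum_chan /= [X in X + _ + _]big1 => [|e _]; last first.
        by rewrite !mul0r mulr0 expr0n/= mul0r subr0.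
      rewrite !mul0r mulr0 expr0n/= mul0r subr0 !add0r; apply: eq_bigr => i _.
      rewrite !mul1r /sham -/(spin i x) -/(spin i X) /s sqrtrM ?(ltW l0)// -/sq.
      rewrite -[in RHS]sq2 -[lambda in RHS](@sqr_sqrtr _ lambda) ?(ltW l0)//.
      by rewrite sqrtr_sqr (ger0_norm (sqrtr_ge0 _)); field.
    rewrite (factorization (f := fun i => sham cl (lambda * q) (lambda * q) (tnth X i) (co z (inr i)))); last by move=> i; exact: (bmf_sham mcl clK).
    by rewrite ln_prod_gt0// => i; apply: ex_gt0; exact: (bmf_sham mcl clK).
  transitivity (\int[M]_X \sum_(i < n) smean P0 g cl (lambda * q) (lambda * q) (tnth X i)).
    apply: eq_Rintegral => X _.
    transitivity (\int[gam]_z \sum_(i < n) slog P0 cl (lambda * q) (lambda * q) (tnth X i) (co z (inr i))).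
      by apply: eq_Rintegral => z _; exact: E.
    rewrite Rint_sum => [|i]; last exact: igl_slog_co.
    by apply: eq_bigr => i _; exact: Rint_slog_co.
  rewrite Rint_sum => [|i]; last exact: igl_smean_tnth.
  under eq_bigr do rewrite Rint_smean_tnth.
  by rewrite sumr_const card_ord mulr_natl.
move: main; rewrite E1 E2.
move: (\int[M]_X _) (n%:R * gmean _ _ _ _ _) (n%:R * lambda * q ^+ 2 / 4) (lambda * K ^+ 4) => a1 a2 a3 a4.
exact: quarter_arith.
Qed.

End model.

(** * Upper bound for the tilted free energy *)

Section law_of_large_numbers.
Context d (T : measurableType d) (R : realType) (Q : probability T R).
Context (N : nat) (J : finType) (e : J -> 'I_N) (e_inj : injective e).
Local Notation tq := (tuple_prob Q N).
Context (v : J -> T -> R) (C : R).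
Hypothesis iv : forall j, igl Q (v j).
Hypothesis iv2 : forall j, igl Q (fun x => v j x ^+ 2).
Hypothesis v0 : forall j, \int[Q]_x v j x = 0.
Hypothesis vC : forall j, \int[Q]_x (v j x ^+ 2) <= C.

Lemma igl_lln : igl tq (fun z => \sum_j v j (tnth z (e j))).
Proof. by apply: igl_sum => j; exact: (igl_tnth (e j) (iv j)). Qed.

Lemma second_moment : igl tq (fun z => (\sum_j v j (tnth z (e j))) ^+ 2) /\
  \int[tq]_z ((\sum_j v j (tnth z (e j))) ^+ 2) <= #|J|%:R * C.
Proof.
have E z : (\sum_j v j (tnth z (e j))) ^+ 2 =
    \sum_i \sum_j v i (tnth z (e i)) * v j (tnth z (e j)).
  by rewrite expr2 big_distrlr.
have ip i j : igl tq (fun z => v i (tnth z (e i)) * v j (tnth z (e j))).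
  have [<-|ij] := eqVneq i j.
    by under eq_fun do rewrite -expr2; exact: (igl_tnth (e i) (iv2 i)).
  by have [] := @tnth_prod2 _ _ _ Q N (v i) (v j) (e i) (e j); rewrite ?(inj_eq e_inj).
split.
  by under eq_fun do rewrite E; apply: igl_sum => i; exact: igl_sum.
under eq_Rintegral do rewrite E.
rewrite Rint_sum => [|i]; last exact: igl_sum.
rewrite -sum_const_card; apply: ler_sum => i _.
rewrite Rint_sum// (bigD1 i)//= [X in _ + X]big1 ?addr0 => [|j ji].
  under eq_Rintegral do rewrite -expr2.
  rewrite (@Rint_tnth _ _ _ Q N (fun x => v i x ^+ 2) (e i))//.
  exact: igl_meas (iv2 i).
have eij : e i != e j by rewrite (inj_eq e_inj) eq_sym.
have [_ ->] := tnth_prod2 eij (iv i) (iv j).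
by rewrite v0 mul0r.
Qed.

Lemma amgm_abs (y s : R) : 0 < s -> `|y| <= (s^-1 * y ^+ 2 + s) / 2.
Proof.
move=> s0; have : 0 <= s^-1 * (`|y| - s) ^+ 2 by rewrite mulr_ge0 ?sqr_ge0// invr_ge0 ltW.
rewrite -[y ^+ 2]real_normK ?num_real//; move: `|y| => a.
have -> : s^-1 * (a - s) ^+ 2 = s^-1 * a ^+ 2 + s - 2 * a by field; rewrite gt_eqF.
lra.
Qed.

(** The second moment is turned into a first moment by the arithmetic-geometric inequality with
    weight [Num.sqrt #|J|%:R]; only the rate matters. *)
Lemma lln : (0 < #|J|)%N ->
  \int[tq]_z `|\sum_j v j (tnth z (e j))| <= Num.sqrt #|J|%:R * ((C + 1) / 2).
Proof.
move=> J0; have [i2 m2] := second_moment.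
set s := Num.sqrt _; have s0 : 0 < s by rewrite sqrtr_gt0 ltr0n.
have s2 : s ^+ 2 = #|J|%:R by rewrite sqr_sqrtr.
have ib : igl tq (fun z => 2^-1 * (s^-1 * (\sum_j v j (tnth z (e j))) ^+ 2 + s)).
  by apply: iglZ; apply: iglD; [exact: iglZ|exact: igl_cst].
apply: (@le_trans _ _ (\int[tq]_z (2^-1 * (s^-1 * (\sum_j v j (tnth z (e j))) ^+ 2 + s)))).
  apply: le_Rint => //; first exact: igl_norm igl_lln.
  by move=> z; rewrite mulrC; exact: amgm_abs.
rewrite RintZ; last by apply: iglD; [exact: iglZ|exact: igl_cst].
rewrite RintD; [|exact: iglZ|exact: igl_cst].
rewrite Rint_cst RintZ// mulrC mulrA ler_wpM2r ?invr_ge0// mulrDr mulr1 lerD2r.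
by rewrite ler_pdivrMl// mulrA -expr2 s2.
Qed.

End law_of_large_numbers.

Section uniform_law.
Context d (T : measurableType d) (R : realType) (m : nat -> T) (N : nat).

Let w : {nonneg R} := (N.+1%:R^-1 : R)%:nng.

(** Prior of the random grid point. Keeping a single one of its atoms costs [ln N.+1%:R] in a free
    energy, independently of [n]. *)
Definition finite_unif : set T -> \bar R := mscale w (msum (fun l => \d_(m l)) N.+1).

HB.instance Definition _ := Measure.on finite_unif.

Let finite_unif_setT : finite_unif setT = 1%E.
Proof.
rewrite /finite_unif /mscale/= /msum/=.
under eq_bigr do rewrite diracT.
rewrite sumEFin sumr_const card_ord -EFinM; congr (_%:E).
by rewrite -mulr_natl mulr1 mulVf.
Qed.

HB.instance Definition _ := Measure_isProbability.Build _ _ _ finite_unif finite_unif_setT.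

Lemma Rint_finite_unif (f : T -> R) : measurable_fun setT f -> (forall x, 0 <= f x) ->
  \int[finite_unif]_x f x = N.+1%:R^-1 * \sum_(l < N.+1) f (m l).
Proof.
move=> mf f0; rewrite /Rintegral.
have mE : measurable_fun setT (EFin \o f) by exact/measurable_EFinP.
have E0 x : setT x -> (0 <= (EFin \o f) x)%E by move=> _; rewrite lee_fin.
have -> : (\int[finite_unif]_x (f x)%:E = (N.+1%:R^-1)%:E * \int[msum (fun l => \d_(m l)) N.+1]_x (f x)%:E)%E.
  exact: (ge0_integral_mscale _ measurableT w mE E0).
rewrite (ge0_integral_measure_sum (fun l => \d_(m l) : {measure set T -> \bar R}) measurableT E0 mE)//.
under eq_bigr do rewrite integral_dirac// diracT mul1e.
by rewrite sumEFin -EFinM.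
Qed.

End uniform_law.

Lemma grid_le (R : realType) (B : R) (N l : nat) : 0 < B -> (0 < N)%N -> (l <= N)%N ->
  `|B * (2 * l%:R / N%:R) - B| <= B.
Proof.
move=> B0 N0 lN; have N0' : 0 < N%:R :> R by rewrite ltr0n.
rewrite ler_norml lerBrDr addNr lerBlDr; apply/andP; split.
  by rewrite mulr_ge0 ?(ltW B0)// divr_ge0 ?ler0n// mulr_ge0.
rewrite (_ : B + B = B * 2); last by ring.
by rewrite ler_pM2l// ler_pdivrMr// ler_pM2l// ler_nat.
Qed.

Lemma grid_dense (R : realType) (B : R) (N : nat) (u : R) : 0 < B -> (0 < N)%N -> `|u| <= B ->
  exists l : 'I_N.+1, `|u - (B * (2 * l%:R / N%:R) - B)| <= 2 * B / N%:R.
Proof.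
move=> B0 N0 /[!ler_norml] /andP[u1 u2].
have N0' : 0 < N%:R :> R by rewrite ltr0n.
(* Rescaled so that the grid becomes 0, ..., [N]. The integer part of [v] is the index; it reaches
   [N] at [u = B], whence [N.+1] points. *)
pose v := (u + B) * N%:R / (2 * B).
have v0 : 0 <= v by rewrite divr_ge0 ?mulr_ge0 ?ler0n ?(ltW B0)// -lerBlDr sub0r.
have /andP[t1 t2] := truncn_itv v0.
set t := Num.truncn v in t1 t2.
have vN : v <= N%:R by rewrite ler_pdivrMr ?mulr_gt0// mulrC ler_wpM2l ?ler0n//; lra.
have tN : (t < N.+1)%N by rewrite ltnS -(ler_nat R) (le_trans t1).
have ut : u = B * (2 * v / N%:R) - B by rewrite /v; field; rewrite !gt_eqF.
exists (Ordinal tN) => /=.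
  rewrite {1}ut (_ : _ - _ = (2 * B / N%:R) * (v - t%:R)); last by field; rewrite gt_eqF.
  rewrite normrM ger0_norm; last by rewrite divr_ge0 ?ler0n// mulr_ge0// ltW.
  rewrite ler_piMr//; first by rewrite divr_ge0 ?ler0n// mulr_ge0// ltW.
  by rewrite ger0_norm ?subr_ge0// lerBlDl; apply: ltW; rewrite -natr1 in t2.
Qed.

Lemma ex_mixture d1 d2 (U : measurableType d1) (T : measurableType d2) (R : realType)
    (M : probability T R) (m : nat -> U) (N : nat) (G : U * T -> R) : bmf G ->
  ex (finite_unif R m N \x M)%E G = N.+1%:R^-1 * \sum_(l < N.+1) ex M (fun x => G (m l, x)).
Proof.
move=> bG; have be := bmf_expR bG.
have i1 u : igl M (fun x => expR (G (u, x))).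
  by apply: bmf_igl; apply: bmf_expR; split; [exact: (meas_sec1 u bG.1)|have [C hC] := bG.2; exists C].
rewrite /ex (Rint_prod (bmf_igl (finite_unif R m N \x M)%E be))//.
rewrite Rint_finite_unif//; first exact: (meas_Rint M (f := fun p => expR (G p)) be.1).
by move=> u; apply: Rintegral_ge0 => x _; exact: expR_ge0.
Qed.

Lemma centered_sq d (T : measurableType d) (R : realType) (Q : probability T R) (f : T -> R) :
  igl Q f -> igl Q (fun x => f x ^+ 2) ->
  let m := \int[Q]_x f x in
  [/\ igl Q (fun x => f x - m), igl Q (fun x => (f x - m) ^+ 2),
     \int[Q]_x (f x - m) = 0 &
     \int[Q]_x ((f x - m) ^+ 2) = \int[Q]_x (f x ^+ 2) - m ^+ 2].
Proof.
move=> i1 i2 m.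
have ic := iglB i1 (igl_cst Q m).
have E x : (f x - m) ^+ 2 = f x ^+ 2 - (2 * m) * f x + m ^+ 2 by ring.
have i3 : igl Q (fun x => f x ^+ 2 - (2 * m) * f x) by apply: iglB => //; exact: iglZ.
split => //.
- by under eq_fun do rewrite E; apply: iglD => //; exact: igl_cst.
- by rewrite RintB//; [rewrite Rint_cst subrr|exact: igl_cst].
- under eq_Rintegral do rewrite E.
  rewrite RintD//; last exact: igl_cst.
  by rewrite RintB//; [rewrite RintZ// Rint_cst -/m; ring|exact: iglZ].
Qed.

Section scalar_lln.
Context (R : realType) (P0 g : probability R R) (hg : gaussian_law g).
Context (cl : R -> R) (K : R) (K0 : 0 <= K).
Hypothesis mcl : measurable_fun setT cl.
Hypothesis clK : forall x, `|cl x| <= K.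
Context (n : nat) (n0 : (0 < n)%N) (r t : R).
Local Notation M := (tuple_prob P0 n).
Local Notation gam := (tuple_prob g #|chan n|).
Local Notation sl := (slog P0 cl r t).
Local Notation sm := (smean P0 g cl r t).
Local Notation gm := (gmean P0 g cl r t).

Definition msq : R := \int[g]_z (sbound K r t z ^+ 2).

Let slog2 X z : sl X z ^+ 2 <= sbound K r t z ^+ 2.
Proof.
have h := slog_le P0 K0 mcl clK r t X z.
by rewrite -[leLHS]real_normK ?num_real// lerXn2r// nnegrE// (le_trans _ h).
Qed.

Let igl_slog2 X : igl g (fun z => sl X z ^+ 2).
Proof.
apply: (igl_dom _ (igl_sbound2 hg K r t)).
  by apply: measurable_funX; exact: (meas_sec1 X (measurable_slog P0 mcl r t)).
by move=> z; rewrite ger0_norm ?sqr_ge0.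
Qed.

Let msq_slog X : \int[g]_z (sl X z ^+ 2) <= msq.
Proof. by apply: le_Rint => //; exact: igl_sbound2. Qed.

Let smean2 X : sm X ^+ 2 <= msq.
Proof.
have [_ i2 _ E] := centered_sq (igl_slog P0 hg K0 mcl clK r t X) (igl_slog2 X).
apply: le_trans (msq_slog X); rewrite -subr_ge0 -E.
by apply: Rintegral_ge0 => z _; exact: sqr_ge0.
Qed.

Lemma lln_noise (X : n.-tuple R) :
  \int[gam]_z `|\sum_(i < n) (sl (tnth X i) (co z (inr i)) - sm (tnth X i))| <=
  Num.sqrt n%:R * ((msq + 1) / 2).
Proof.
have hc i := centered_sq (igl_slog P0 hg K0 mcl clK r t (tnth X i)) (igl_slog2 (tnth X i)).
have e_inj : injective (fun i : 'I_n => enum_rank (inr i : chan n)).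
  by move=> i j /enum_rank_inj[].
have := @lln _ _ _ g _ _ _ e_inj (fun i z => sl (tnth X i) z - sm (tnth X i)) msq.
rewrite card_ord; apply => // i; have [//h1 h2 h3 h4] := hc i.
by rewrite h4; apply: le_trans (msq_slog (tnth X i)); rewrite gerBl sqr_ge0.
Qed.

Lemma lln_signal :
  \int[M]_X `|\sum_(i < n) (sm (tnth X i) - gm)| <= Num.sqrt n%:R * ((msq + 1) / 2).
Proof.
have i1 := igl_smean P0 hg K0 mcl clK r t.
have s0 : 0 <= msq := le_trans (sqr_ge0 _) (smean2 point).
have i2 : igl P0 (fun X => sm X ^+ 2).
  apply: igl_bound => [|X]; last by rewrite ger0_norm ?sqr_ge0//; exact: smean2.
  by apply: measurable_funX; exact: measurable_smean.
have [h1 h2 h3 h4] := centered_sq i1 i2.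
have := @lln _ _ _ P0 n 'I_n id (fun _ _ => id) (fun i X => sm X - gm) msq.
rewrite card_ord; apply => // i.
rewrite h4; apply: (@le_trans _ _ (\int[P0]_X (sm X ^+ 2))); first by rewrite gerBl sqr_ge0.
by rewrite -[leRHS](Rint_cst P0); apply: le_Rint => //; exact: igl_cst.
Qed.

Lemma igl_lln_noise (X : n.-tuple R) (c : R) :
  igl gam (fun z => `|\sum_(i < n) (sl (tnth X i) (co z (inr i)) - c)|).
Proof.
apply: igl_norm; apply: igl_sum => i; apply: iglB; last exact: igl_cst.
exact: (igl_slog_co _ hg K0 mcl clK).
Qed.

Lemma igl_lln_signal : igl M (fun X => `|\sum_(i < n) (sm (tnth X i) - gm)|).
Proof.
apply: igl_norm; apply: igl_sum => i; apply: iglB; last exact: igl_cst.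
exact: (igl_smean_tnth _ hg K0 mcl clK).
Qed.

(** With the signal frozen, the sum concentrates around the mean over the noise, which itself
    fluctuates with [X]. The second fluctuation is carried along and averaged afterwards by
    [lln_signal]. *)
Lemma lln_noise_gmean (X : n.-tuple R) :
  \int[gam]_z `|\sum_(i < n) (sl (tnth X i) (co z (inr i)) - gm)| <=
  Num.sqrt n%:R * ((msq + 1) / 2) + `|\sum_(i < n) (sm (tnth X i) - gm)|.
Proof.
have i1 : igl gam (fun z => `|\sum_(i < n) (sl (tnth X i) (co z (inr i)) - sm (tnth X i))|).
  apply: igl_norm; apply: igl_sum => i; apply: iglB; last exact: igl_cst.
  exact: (igl_slog_co _ hg K0 mcl clK).
apply: le_trans (lerD (lln_noise X) (lexx _)).
rewrite -[X in _ <= _ + X](Rint_cst gam) -RintD//; last exact: igl_cst.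
apply: le_Rint; first exact: igl_lln_noise.
  by apply: iglD => //; exact: igl_cst.
move=> z; apply: le_trans (ler_normD _ _); rewrite -big_split/=.
by rewrite le_eqVlt; apply/orP; left; apply/eqP; congr (`| _ |); apply: eq_bigr => i _; rewrite addrA subrK.
Qed.

End scalar_lln.

Section clip.
Context (R : realType) (B : R) (B0 : 0 <= B).

(** Used twice: on the grid variable, which ranges over all reals although its law lives in
    [[-B, B]], and on the spins, which are bounded only almost surely. In both places it gives
    pointwise bounds. *)
Definition clip (u : R) : R := Num.max (- B) (Num.min u B).

Lemma clip_id u : `|u| <= B -> clip u = u.
Proof. by rewrite ler_norml => /andP[h1 h2]; rewrite /clip (min_idPl h2); exact/max_idPr. Qed.

Lemma clip_le u : `|clip u| <= B.
Proof. by rewrite ler_norml /clip le_max lexx/= ge_max ge_min lexx orbT andbT ge0_cp. Qed.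

Lemma measurable_clip : measurable_fun setT clip.
Proof. by apply: measurable_maxr => //; exact: measurable_minr. Qed.

End clip.

Lemma ln_sum_le (R : realType) (N : nat) (F : 'I_N.+1 -> R) (b : R) : (forall l, 0 < F l) ->
  (forall l, ln (F l) <= b) -> ln (N.+1%:R^-1 * \sum_l F l) <= b.
Proof.
move=> F0 Fb; rewrite -ler_expR lnK; last first.
  rewrite posrE mulr_gt0 ?invr_gt0 ?ltr0n// big_ord_recl ltr_pwDl// sumr_ge0// => i _.
  exact: ltW.
rewrite ler_pdivrMl ?ltr0n// -[N.+1 in leRHS]card_ord -sum_const_card.
by apply: ler_sum => l _; rewrite -[leLHS]lnK ?posrE// ler_expR.
Qed.

Lemma ln_mixture_ge (R : realType) (N : nat) (F : 'I_N.+1 -> R) (a b : R) : (forall l, 0 < F l) ->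
  expR a <= expR b * \sum_l F l -> a - b - ln N.+1%:R <= ln (N.+1%:R^-1 * \sum_l F l).
Proof.
move=> F0 h; have S0 : 0 < \sum_l F l.
  rewrite big_ord_recl ltr_pwDl// sumr_ge0// => i _; exact: ltW.
rewrite lnM ?posrE ?invr_gt0 ?ltr0n// lnV ?posrE ?ltr0n// [leRHS]addrC lerD2r lerBlDl.
by rewrite -ler_expR expRD lnK// posrE.
Qed.

(** From [u ^+ 2 = 2 * m * u - m ^+ 2 + (u - m) ^+ 2]: near [m] the quadratic energy is linear in
    the overlap up to [lambda * eps ^+ 2 / 2]. *)
Lemma linearization (R : realType) (k lambda u m fu fm eps C : R) : 0 <= k -> 0 <= lambda ->
  `|u - m| <= eps -> `|fu - fm| <= C * eps ->
  k * fu + k * lambda * u ^+ 2 / 2 <= k * (lambda * m * u - lambda * m ^+ 2 / 2 + fm) +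
    k * (lambda * eps ^+ 2 / 2 + C * eps).
Proof.
move=> k0 l0 h1 h2.
have e1 : (u - m) ^+ 2 <= eps ^+ 2.
  by rewrite -[leLHS]real_normK ?num_real// lerXn2r// nnegrE// (le_trans _ h1).
have e2 := ler_wpM2l l0 e1.
have e3 : fu - fm <= C * eps := le_trans (ler_norm _) h2.
have -> : k * fu + k * lambda * u ^+ 2 / 2 = k * (fu + lambda * u ^+ 2 / 2) by ring.
rewrite -mulrDr ler_wpM2l//.
have : lambda * (u - m) ^+ 2 = lambda * u ^+ 2 - 2 * (lambda * m * u) + lambda * m ^+ 2 by ring.
by move: e2 => /[swap] ->; lra.
Qed.

Section overlap.
Context (R : realType) (cl : R -> R) (K : R) (K0 : 0 <= K).
Hypothesis mcl : measurable_fun setT cl.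
Hypothesis clK : forall x, `|cl x| <= K.
Context (lambda : R) (l0 : 0 < lambda) (n : nat) (n0 : (0 < n)%N).

Definition ov (X x : n.-tuple R) : R := n%:R^-1 * \sum_(i < n) spin cl i x * spin cl i X.

Let nR : 0 < n%:R :> R. Proof. by rewrite ltr0n. Qed.

Lemma ov_le X x : `|ov X x| <= K ^+ 2.
Proof.
rewrite normrM ger0_norm ?invr_ge0 ?ler0n// ler_pdivrMl//.
apply: le_trans (ler_norm_sum _ _ _) _.
rewrite -[X in X%:R]card_ord -sum_const_card; apply: ler_sum => i _.
by rewrite normrM expr2 ler_pM// clK.
Qed.

Lemma measurable_ov : measurable_fun setT (fun p : n.-tuple R * n.-tuple R => ov p.1 p.2).
Proof.
apply: measurable_funM => //; apply: measurable_sum => i; apply: measurable_funM.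
  by apply: (measurableT_comp (measurable_spin mcl i)); exact: measurable_snd.
by apply: (measurableT_comp (measurable_spin mcl i)); exact: measurable_fst.
Qed.

(** The cross term of signal and configuration is a sum over [i < j] of [w i * w j]. The missing
    diagonal consists of squares, so it is at most half of the full square. *)
Lemma edge_cross X x :
  \sum_(e : edge n) edge_coef cl lambda (inl (inl e)) X * edge_coef cl lambda (inl (inl e)) x <=
  n%:R * lambda * ov X x ^+ 2 / 2.
Proof.
pose w i := spin cl i x * spin cl i X.
have := @sum_edge_le R n (fun i j => w i * w j) (fun i j => mulrC _ _) (fun i => sqr_ge0 (w i)).
rewrite -(big_distrlr _ _ _ predT predT w w)/= -expr2 => h.
have -> : \sum_(e : edge n) edge_coef cl lambda (inl (inl e)) X * edge_coef cl lambda (inl (inl e)) x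
    = lambda / n%:R * \sum_(e : edge n) w (val e).1 * w (val e).2.
  rewrite mulr_sumr; apply: eq_bigr => e _; rewrite /= /w.
  have s2 : Num.sqrt (lambda / n%:R) ^+ 2 = lambda / n%:R.
    by rewrite sqr_sqrtr// divr_ge0 ?ler0n// ltW.
  rewrite -[in RHS]s2; ring.
have S : \sum_i w i = n%:R * ov X x by rewrite /ov mulrA mulfV ?mul1r// gt_eqF.
rewrite S in h.
rewrite [leRHS](_ : _ = lambda / n%:R * ((n%:R * ov X x) ^+ 2 / 2)); last by field; rewrite gt_eqF.
rewrite ler_wpM2l ?divr_ge0 ?ler0n ?(ltW l0)// ler_pdivlMr//.
by rewrite mulrC.
Qed.

End overlap.

Lemma cancel_arith (R : realType) (a b c : R) : a <= b -> - a <= c -> 0 <= c + b.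
Proof. lra. Qed.

Lemma tilted_arith (R : realType) (cr U t1 E S t2 t3 G W D : R) :
  cr <= U -> t1 + U <= E + S -> 0 <= t2 + t3 -> G = E + W ->
  t1 + (D + cr) <= S + t3 + (G + (D + (t2 - W))).
Proof. by move=> h1 h2 h3 ->; lra. Qed.

Lemma scalar_arith (R : realType) (a b c s S : R) : a + b <= c -> s - b <= S -> a + s <= c + S.
Proof. lra. Qed.

Lemma step_upper_arith (R : realType) (L s t k v w p1 p2 u : R) : L - (s + t + k) <= p1 ->
  p2 <= v + u -> - (w / 2 / 2) <= - (p1 - p2) -> L <= (s + t + k + v + w / 4) + u.
Proof. lra. Qed.

(** * Interpolation for a fixed signal with a random grid point *)

Section upper.
Context (R : realType) (P0 g : probability R R) (hg : gaussian_law g).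
Context (cl : R -> R) (K : R) (K0 : 0 < K).
Hypothesis mcl : measurable_fun setT cl.
Hypothesis clK : forall x, `|cl x| <= K.
Context (lambda : R) (l0 : 0 < lambda) (n : nat) (n0 : (0 < n)%N).
Context (f : R -> R) (C F : R) (C0 : 0 <= C) (mf : measurable_fun setT f).
Hypothesis fC : forall u v, `|u| <= K ^+ 2 -> `|v| <= K ^+ 2 -> `|f u - f v| <= C * `|u - v|.
Hypothesis fF : forall u, `|u| <= K ^+ 2 -> `|f u| <= F.
Context (V : R).
Hypothesis fV : forall m, `|m| <= K ^+ 2 ->
  - lambda / 4 * m ^+ 2 + f m + gmean P0 g cl (lambda * `|m|) (lambda * m) <= V.
Context (N : nat) (N0 : (0 < N)%N).
Local Notation M := (tuple_prob P0 n).
Local Notation gam := (tuple_prob g #|chan n|).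
Local Notation B := (K ^+ 2).
Local Notation T' := (R * n.-tuple R)%type.

Let B0 : 0 < B. Proof. by rewrite exprn_gt0. Qed.

Definition grid (l : nat) : R := B * (2 * l%:R / N%:R) - B.
Local Notation M' := (finite_unif R grid N \x M)%E.
Local Notation eps := (2 * B / N%:R).

Let ext_spin (i : 'I_n) (p : T') := spin cl i p.2.
(** A signal-to-noise ratio cannot be negative, so the amplitude uses the absolute value of the grid
    variable; its sign survives only in the coupling to [X] in [side]. *)
Let amp (p : T') := Num.sqrt `|clip B p.1|.
Let a := chan_coef lambda ext_spin amp.

Let mspin i : measurable_fun setT (ext_spin i).
Proof. by apply: (measurableT_comp (measurable_spin mcl i)); exact: measurable_snd. Qed.

Let spinK i p : `|ext_spin i p| <= K. Proof. exact: clK. Qed.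

Let mclip : measurable_fun setT (fun p : T' => clip B p.1).
Proof. by apply: (measurableT_comp (measurable_clip B)); exact: measurable_fst. Qed.

Let mamp : measurable_fun setT amp.
Proof.
apply: (measurableT_comp (f := @Num.sqrt R)); last exact: measurableT_comp.
by apply: continuous_measurable_fun; exact: sqrt_continuous.
Qed.

Let ampB p : `|amp p| <= Num.sqrt B.
Proof. by rewrite ger0_norm ?sqrtr_ge0// ler_wsqrtr// clip_le// ltW. Qed.

Let bclip : bmf (fun p : T' => clip B p.1).
Proof. by split => //; exists B => p; rewrite clip_le// ltW. Qed.

(** The linearized energy has [- lambda / 2] in front of the squared grid variable, here it is
    [- lambda / 4]. On the matrix side the missing half is the normalization of the extra channel,
    see [ham_matrix]; on the scalar side what remains is the quadratic term of the potential. *)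
Definition side (X : n.-tuple R) (p : T') : R :=
  n%:R * (lambda * clip B p.1 * ov cl X p.2 - lambda / 4 * clip B p.1 ^+ 2 + f (clip B p.1)).

Let bside X : bmf (side X).
Proof.
apply: bmfZ; apply: bmfD; last first.
  by split; [exact: (measurableT_comp mf)|exists F => p; apply: fF; rewrite clip_le// ltW].
apply: bmfB; last by apply: bmfZ; exact: bmfX.
apply: bmfM; first exact: bmfZ.
split; last by exists B => p; apply: ov_le => //; exact: ltW.
apply: (measurableT_comp (meas_sec1 X (measurable_ov mcl (n := n)))); exact: measurable_snd.
Qed.

Let ba i : bmf (a i). Proof. exact: (bmf_chan lambda mspin spinK mamp ampB). Qed.

Definition tilt (X x : n.-tuple R) : R := n%:R * f (ov cl X x).

Definition slack : R := lambda * eps ^+ 2 / 2 + C * eps.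

Let c0 := Num.sqrt (n%:R * lambda / 2).
Let c02 : c0 ^+ 2 = n%:R * lambda / 2.
Proof. by rewrite sqr_sqrtr// divr_ge0// mulr_ge0 ?ler0n// ltW. Qed.

Let hamE th (z : #|chan n|.-tuple R) p : ham a (fun i => ((th i : bool)%:R : R)) z p =
  \sum_i (co z i * ((th i)%:R * a i p) - ((th i)%:R * a i p) ^+ 2 / 2).
Proof.
apply: eq_bigr => i _.
by have -> : Num.sqrt ((th i)%:R : R) = (th i)%:R by case: (th i); rewrite ?sqrtr1 ?sqrtr0.
Qed.

Let ham_matrix (z : #|chan n|.-tuple R) p : ham a (fun i => ((matrix_side i)%:R : R)) z p =
  \sum_(e : edge n) (co z (inl (inl e)) * edge_coef cl lambda (inl (inl e)) p.2
     - edge_coef cl lambda (inl (inl e)) p.2 ^+ 2 / 2) +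
  (c0 * `|clip B p.1| * co z (inl (inr tt)) - n%:R * lambda / 4 * clip B p.1 ^+ 2).
Proof.
rewrite hamE sum_chan /= [X in _ + X]big1 => [|i _]; last first.
  by rewrite mul0r mulr0 expr0n/= mul0r subr0.
rewrite addr0; congr (_ + _).
  by apply: eq_bigr => e _; rewrite !mul1r.
have s2 : amp p ^+ 2 = `|clip B p.1| by rewrite sqr_sqrtr.
by rewrite !mul1r -/c0 s2 exprMn c02 real_normK ?num_real//; field.
Qed.

(** Three losses: the linearization error, the diagonal dropped in [edge_cross], and the noise of
    the extra channel, which is absent from the model. The last may be negative and is compensated
    by [c0 * B] times its absolute value, of order [sqrt n]. *)
Let tilted_matrix X z x (l : nat) : `|ov cl X x - grid l| <= eps -> `|grid l| <= B ->
  tilt X x + planted (@edge_coef R cl lambda n) X z x <=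
  (n%:R * slack + c0 * B * `|co z (inl (inr tt))|) +
  (side X (grid l, x) + ham a (fun i => ((matrix_side i)%:R : R)) z (grid l, x)).
Proof.
move=> h1 h2; rewrite ham_matrix /side /= !clip_id//.
set D := \sum_e _; set zz := co z (inl (inr tt)).
have -> : planted (@edge_coef R cl lambda n) X z x = D +
    \sum_(e : edge n) edge_coef cl lambda (inl (inl e)) X * edge_coef cl lambda (inl (inl e)) x.
  rewrite /planted sum_chan [X in _ + X]big1 => [|i _]; last by rewrite /= mulr0 expr0n/= mul0r subr0.
  rewrite [X in _ + X + _]/= mulr0 expr0n/= mul0r subr0 !addr0 -big_split/=.
  by apply: eq_bigr => e _; ring.
have hc := edge_cross cl l0 n0 X x.
have hl := @linearization R n%:R lambda (ov cl X x) (grid l) (f (ov cl X x)) (f (grid l)) eps C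
  (ler0n _ _) (ltW l0) h1.
have hf : `|f (ov cl X x) - f (grid l)| <= C * eps.
  apply: le_trans (fC _ h2) _; first by apply: ov_le => //; exact: ltW.
  by rewrite ler_wpM2l.
have hz : 0 <= c0 * `|grid l| * zz + c0 * B * `|zz|.
  rewrite -[c0 * _ * zz]mulrA -[c0 * _ * `|zz|]mulrA -mulrDr mulr_ge0 ?sqrtr_ge0//.
  have : - (`|grid l| * `|zz|) <= `|grid l| * zz by rewrite -mulrN ler_wpM2l// lerNl -normrN ler_norm.
  have : `|grid l| * `|zz| <= B * `|zz| by rewrite ler_wpM2r.
  move=> h3 h4; exact: cancel_arith h3 h4.
move: hc hl hz => /=; rewrite /tilt /slack.
move: (\sum_e _) (n%:R * f (ov cl X x)) (c0 * `|grid l| * zz) (c0 * B * `|zz|) => cr t1 t2 t3.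
move=> hc /(_ hf) hl hz.
have h3 := tilted_arith (G := n%:R * (lambda * grid l * ov cl X x - lambda / 4 * grid l ^+ 2 + f (grid l))) (W := n%:R * lambda / 4 * grid l ^+ 2) D hc hl hz; apply: h3; by field.
Qed.

Let bham th z : bmf (ham a (fun i => ((th i : bool)%:R : R)) z).
Proof.
rewrite (_ : ham _ _ _ = fun p =>
  \sum_i (co z i * ((th i)%:R * a i p) - ((th i)%:R * a i p) ^+ 2 / 2)); last by apply/funext.
apply: bmf_sum => i; apply: bmfB; first by apply: bmfZ; exact: bmfZ.
by under eq_fun do rewrite mulrC; apply: bmfZ; apply: bmfX; exact: bmfZ.
Qed.

Let bfull th X z : bmf (fun p => side X p + ham a (fun i => ((th i : bool)%:R : R)) z p).
Proof. exact: bmfD. Qed.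

Let bsec th X z m : bmf (fun x => side X (m, x) + ham a (fun i => ((th i : bool)%:R : R)) z (m, x)).
Proof.
have [h1 [D hD]] := bfull th X z.
by split; [exact: (meas_sec1 m h1)|exists D => x; exact: hD].
Qed.

Lemma measurable_tilt : measurable_fun setT (fun p : n.-tuple R * n.-tuple R => tilt p.1 p.2).
Proof.
apply: measurable_funM => //; apply: (measurableT_comp mf).
exact: (measurable_ov mcl (n := n)).
Qed.

Lemma tilt_le X x : `|tilt X x| <= n%:R * F.
Proof.
rewrite normrM ger0_norm ?ler0n// ler_wpM2l ?ler0n//; apply: fF.
by apply: ov_le => //; exact: ltW.
Qed.

Let edge_A : R := Num.sqrt (lambda / n%:R) * K ^+ 2.
Let edge_A0 : 0 <= edge_A. Proof. by rewrite mulr_ge0 ?sqrtr_ge0 ?sqr_ge0. Qed.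

(** For each configuration a grid point close to its overlap with [X] exists; the other atoms of the
    mixture are dropped, at the cost of [ln N.+1%:R]. *)
Let matrix_lower X (z : #|chan n|.-tuple R) :
  lnp M (@edge_coef R cl lambda n) tilt X z - (n%:R * slack + c0 * B * `|co z (inl (inr tt))|) - ln N.+1%:R <=
  ln (ex M' (fun p => side X p + ham a (fun i => ((matrix_side i)%:R : R)) z p)).
Proof.
have [me eA] := edge_coef_bmf mcl clK lambda n.
rewrite ex_mixture//; apply: ln_mixture_ge => [l|]; first exact: ex_gt0.
have bt := bmf_tilted me eA measurable_tilt tilt_le X z.
rewrite lnK; last by rewrite posrE; exact: ex_gt0.
have iE l : igl M (fun x => expR (side X (grid l, x) + ham a (fun i => ((matrix_side i)%:R : R)) z (grid l, x))).
  by apply: bmf_igl; exact: bmf_expR.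
rewrite /ex -Rint_sum// -RintZ; last exact: igl_sum.
apply: le_Rint.
- by apply: bmf_igl; exact: bmf_expR.
- by apply: iglZ; exact: igl_sum.
move=> x; have [l hl] := grid_dense B0 N0 (ov_le clK n0 X x).
have lN : (l <= N)%N by rewrite -ltnS.
apply: (@le_trans _ _ (expR (n%:R * slack + c0 * B * `|co z (inl (inr tt))|) *
  expR (side X (grid l, x) + ham a (fun i => ((matrix_side i)%:R : R)) z (grid l, x)))).
  by rewrite -expRD ler_expR; apply: tilted_matrix => //; exact: grid_le.
rewrite ler_wpM2l ?expR_ge0// (bigD1 l)//= lerDl sumr_ge0// => i _; exact: expR_ge0.
Qed.

Let gr (l : nat) := lambda * `|grid l|.
Let gt (l : nat) := lambda * grid l.

(** A mixture is at most its largest term, and each term factorizes over the spins. The largest term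
    depends on the noise, so its fluctuation is bounded by the sum of the fluctuations over the
    whole grid. *)
Let scalar_upper X (z : #|chan n|.-tuple R) :
  ln (ex M' (fun p => side X p + ham a (fun i => ((~~ matrix_side i)%:R : R)) z p)) <=
  n%:R * V + \sum_(l < N.+1)
    `|\sum_(i < n) (slog P0 cl (gr l) (gt l) (tnth X i) (co z (inr i)) - gmean P0 g cl (gr l) (gt l))|.
Proof.
rewrite (ex_mixture _ _ _ (bfull (fun i => ~~ matrix_side i) X z)); apply: ln_sum_le => l.
  exact: (ex_gt0 M (bsec (fun i => ~~ matrix_side i) X z (grid l))).
have lB : `|grid l| <= B by apply: grid_le => //; rewrite -ltnS.
have -> : (fun x => side X (grid l, x) + ham a (fun i => ((~~ matrix_side i)%:R : R)) z (grid l, x)) =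
    fun x => n%:R * (- lambda / 4 * grid l ^+ 2 + f (grid l)) +
      \sum_(i < n) sham cl (gr l) (gt l) (tnth X i) (co z (inr i)) (tnth x i).
  apply/funext => x; rewrite hamE sum_chan /= [X in _ + (X + _ + _)]big1 => [|e _]; last first.
    by rewrite mul0r mulr0 expr0n/= mul0r subr0.
  rewrite !mul0r mulr0 expr0n/= mul0r subr0 !add0r /side /= clip_id//.
  rewrite (_ : n%:R * (lambda * grid l * ov cl X x - lambda / 4 * grid l ^+ 2 + f (grid l)) =
    n%:R * (- lambda / 4 * grid l ^+ 2 + f (grid l)) + (n%:R * ov cl X x) * (lambda * grid l)); last by field.
  rewrite -addrA; congr (_ + _).
  have -> : n%:R * ov cl X x = \sum_(i < n) spin cl i x * spin cl i X.
    by rewrite /ov mulrA mulfV ?mul1r// pnatr_eq0 -lt0n.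
  rewrite mulr_suml -big_split/=; apply: eq_bigr => i _.
  rewrite !mul1r /sham /gr /gt /amp /ext_spin /= clip_id// sqrtrM ?(ltW l0)// !exprMn !sqr_sqrtr ?(ltW l0)//.
  by rewrite /spin; field.
rewrite /ex; under eq_Rintegral do rewrite expRD.
have bs i := bmf_sham mcl clK (gr l) (gt l) (tnth X i) (co z (inr i)).
have bS : bmf (fun x : n.-tuple R => \sum_(i < n) sham cl (gr l) (gt l) (tnth X i) (co z (inr i)) (tnth x i)).
  apply: bmf_sum => i; have [h1 [D hD]] := bs i; split; last by exists D.
  by apply: (measurableT_comp h1); exact: measurable_tnth.
rewrite RintZ; last by apply: bmf_igl; exact: bmf_expR.
rewrite lnM ?posrE ?expR_gt0//; last exact: (ex_gt0 M bS).
rewrite expRK -/(ex M _) (factorization P0 (f := fun i => sham cl (gr l) (gt l) (tnth X i) (co z (inr i))))//.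
rewrite ln_prod_gt0 => [|i]; last exact: ex_gt0.
set Sl := \sum_i _.
have hV := ler_wpM2l (ler0n R n) (fV lB).
have hS : Sl - n%:R * gmean P0 g cl (gr l) (gt l) <= \sum_(l < N.+1)
    `|\sum_(i < n) (slog P0 cl (gr l) (gt l) (tnth X i) (co z (inr i)) - gmean P0 g cl (gr l) (gt l))|.
  rewrite (bigD1 l)//=; apply: le_trans (_ : `|Sl - n%:R * gmean P0 g cl (gr l) (gt l)| <= _).
    exact: ler_norm.
  rewrite [X in X - _](_ : Sl = \sum_(i < n) slog P0 cl (gr l) (gt l) (tnth X i) (co z (inr i)))//.
  rewrite -[n in n%:R]card_ord -sum_const_card -sumrB lerDl.
  by apply: sumr_ge0.
by move: hV hS; rewrite -/(gr l) -/(gt l) mulrDr; exact: scalar_arith.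
Qed.

Local Notation lnZf := (lnp M (@edge_coef R cl lambda n) tilt).
Local Notation slk l := (msq g K (gr l) (gt l)).
Local Notation smk l := (smean P0 g cl (gr l) (gt l)).
Local Notation gmk l := (gmean P0 g cl (gr l) (gt l)).

Let abs_mean : R := \int[g]_z `|z|.

Let igl_abs0 : igl gam (fun z : #|chan n|.-tuple R => `|co z (inl (inr tt))|).
Proof. exact: (igl_co _ (igl_norm (igl_id hg))). Qed.

Let igl_psi th X : igl gam (fun z => phi false
  (ex M' (fun p => side X p + ham a (fun i => ((th i : bool)%:R : R)) z p))).
Proof.
have [A A0 aA] := chan_bounded lambda mspin spinK mamp ampB.
apply: (igl_phi_ham M' hg A0 (fun i => (ba i).1) aA (bside X) false) => i.
by case: (th i); rewrite ?lexx ?ler01.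
Qed.

Let psi_lower X : \int[gam]_z lnZf X z - (n%:R * slack + c0 * B * abs_mean + ln N.+1%:R) <=
  Psi M' g a (side X) false (fun i => (matrix_side i)%:R).
Proof.
have [me eA] := edge_coef_bmf mcl clK lambda n.
have iL : igl gam (lnZf X) := igl_lnp M hg edge_A0 me eA measurable_tilt tilt_le X.
pose W (z : #|chan n|.-tuple R) := n%:R * slack + ln N.+1%:R + c0 * B * `|co z (inl (inr tt))|.
have iz : igl gam W by apply: iglD; [exact: igl_cst|exact: iglZ].
have -> : n%:R * slack + c0 * B * abs_mean + ln N.+1%:R = \int[gam]_z W z.
  rewrite RintD; [|exact: igl_cst|exact: iglZ].
  rewrite Rint_cst RintZ// (@Rint_co _ _ _ g (chan n) (fun z => `|z|)); last exact: measurableT_comp.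
  by rewrite addrAC.
rewrite -RintB//; apply: le_Rint; first exact: iglB.
  exact: igl_psi.
move=> z; apply: le_trans (matrix_lower X z); rewrite -addrA -opprD.
by rewrite lerD2l lerN2 /W addrAC.
Qed.

Let psi_upper X : Psi M' g a (side X) false (fun i => (~~ matrix_side i)%:R) <=
  n%:R * V + \sum_(l < N.+1) (Num.sqrt n%:R * ((slk l + 1) / 2) + `|\sum_(i < n) (smk l (tnth X i) - gmk l)|).
Proof.
have iN (l : 'I_N.+1) : igl gam (fun z =>
    `|\sum_(i < n) (slog P0 cl (gr l) (gt l) (tnth X i) (co z (inr i)) - gmk l)|).
  exact: (igl_lln_noise P0 hg (ltW K0) mcl clK (gr l) (gt l) X (gmk l)).
apply: (@le_trans _ _ (\int[gam]_z (n%:R * V + \sum_(l < N.+1)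
    `|\sum_(i < n) (slog P0 cl (gr l) (gt l) (tnth X i) (co z (inr i)) - gmk l)|))).
  apply: le_Rint; last by move=> z; exact: scalar_upper.
    exact: igl_psi.
  by apply: iglD; [exact: igl_cst|apply: igl_sum].
rewrite RintD; [|exact: igl_cst|by apply: igl_sum].
rewrite Rint_cst lerD2l Rint_sum//; apply: ler_sum => l _.
exact: (lln_noise_gmean P0 hg (ltW K0) mcl clK n0 (gr l) (gt l) X).
Qed.

(** For frozen [X] the signal enters only through [side X], so the interpolation runs over pure
    noise. With the functional [ln] the sign is reversed, and [chan_kappa] puts the matrix side
    below the scalar side up to [lambda * K ^+ 4 / 4]. The average over [X] comes last. *)
Lemma free_energy_upper : \int[M]_X \int[gam]_z lnZf X z <=
  n%:R * (V + slack) + Num.sqrt n%:R * (Num.sqrt (lambda / 2) * B * abs_mean + \sum_(l < N.+1) (slk l + 1)) +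
  (lambda * K ^+ 4 / 4 + ln N.+1%:R).
Proof.
have [me eA] := edge_coef_bmf mcl clK lambda n.
have [A A0 aA] := chan_bounded lambda mspin spinK mamp ampB.
pose U X := \sum_(l < N.+1) (Num.sqrt n%:R * ((slk l + 1) / 2) + `|\sum_(i < n) (smk l (tnth X i) - gmk l)|).
have iS (l : 'I_N.+1) : igl M (fun X => Num.sqrt n%:R * ((slk l + 1) / 2) + `|\sum_(i < n) (smk l (tnth X i) - gmk l)|).
  apply: iglD; [exact: igl_cst|exact: (igl_lln_signal P0 hg (ltW K0) mcl clK n (gr l) (gt l))].
have iU : igl M U by apply: igl_sum.
have step X : \int[gam]_z lnZf X z <=
    (n%:R * slack + c0 * B * abs_mean + ln N.+1%:R + n%:R * V + lambda * K ^+ 4 / 4) + U X.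
  have := interpolation hg A0 (fun i => (ba i).1) aA (bside X) false
    (chan_kappa M' l0 n0 mspin spinK mamp ampB).
  rewrite /wt_mass /sg mulr1 mulN1r; move: (psi_lower X) (psi_upper X); rewrite -/(U X).
  exact: step_upper_arith.
apply: (@le_trans _ _ (\int[M]_X ((n%:R * slack + c0 * B * abs_mean + ln N.+1%:R + n%:R * V + lambda * K ^+ 4 / 4) + U X))).
  apply: le_Rint => //; last by apply: iglD => //; exact: igl_cst.
  exact: (igl_lnp2 M hg edge_A0 me eA measurable_tilt tilt_le).
rewrite RintD//; last exact: igl_cst.
have UE : \int[M]_X U X <= Num.sqrt n%:R * \sum_(l < N.+1) (slk l + 1).
  rewrite /U Rint_sum// mulr_sumr; apply: ler_sum => l _.
  rewrite RintD//; [|exact: igl_cst|exact: (igl_lln_signal P0 hg (ltW K0) mcl clK n (gr l) (gt l))].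
  rewrite Rint_cst [leRHS](_ : _ = Num.sqrt n%:R * ((slk l + 1) / 2) + Num.sqrt n%:R * ((slk l + 1) / 2)); last by field.
  by rewrite lerD2l; exact: (lln_signal P0 hg (ltW K0) mcl clK n0 (gr l) (gt l)).
have c0E : c0 = Num.sqrt n%:R * Num.sqrt (lambda / 2) by rewrite -sqrtrM ?ler0n// mulrA.
rewrite Rint_cst c0E; apply: le_trans (lerD (lexx _) UE) _.
by rewrite le_eqVlt; apply/orP; left; apply/eqP; ring.
Qed.

End upper.

(** * Negative overlaps *)

(** This is [ln t <= t - 1] at [t = v / u], times [u]. Between two likelihood ratios the correction
    [v - u] has mean zero. *)
Lemma xlny_le (R : realType) (u v : R) : 0 < u -> 0 < v -> ln v * u <= ln u * u + (v - u).
Proof.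
move=> u0 v0; have h : ln (v / u) <= v / u - 1.
  by have := @le_ln1Dx R (v / u - 1); rewrite addrCA subrr addr0; apply; rewrite ltrBrDl subrr divr_gt0.
rewrite ln_div ?posrE// in h.
have := ler_wpM2r (ltW u0) h; rewrite !mulrBl mul1r divfK ?gt_eqF//; lra.
Qed.

Section sign.
Context (R : realType) (P0 g : probability R R) (hg : gaussian_law g).
Context (cl : R -> R) (K : R) (K0 : 0 <= K).
Hypothesis mcl : measurable_fun setT cl.
Hypothesis clK : forall x, `|cl x| <= K.
Context (r : R) (r0 : 0 <= r).
Local Notation I := Datatypes_unit__canonical__fintype_Finite.
Local Notation gam := (tuple_prob g #|I|).

Let c (_ : I) (x : R) : R := Num.sqrt r * cl x.
Let c' (_ : I) (x : R) : R := - (Num.sqrt r * cl x).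
Let A := Num.sqrt r * K.
Let A0 : 0 <= A. Proof. by rewrite mulr_ge0 ?sqrtr_ge0. Qed.
Let mc i : measurable_fun setT (c i). Proof. exact: measurable_funM. Qed.
Let cA i x : `|c i x| <= A.
Proof. by rewrite /c normrM ger0_norm ?sqrtr_ge0// ler_wpM2l ?sqrtr_ge0. Qed.
Let mc' i : measurable_fun setT (c' i).
Proof. exact: measurableT_comp (mc i). Qed.
Let cA' i x : `|c' i x| <= A. Proof. by rewrite normrN cA. Qed.

Let sumI (F : I -> R) : \sum_i F i = F tt.
Proof. by rewrite (bigD1 tt)//= big1 ?addr0// => -[]. Qed.

Let sr2 : Num.sqrt r ^+ 2 = r. Proof. exact: sqr_sqrtr. Qed.

Lemma gaussian_opp (f : R -> R) : measurable_fun setT f ->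
  \int[g]_z f (- z) = \int[g]_z f z.
Proof.
move=> mf; have mo : measurable_fun setT (@GRing.opp R) by exact: oppr_measurable.
symmetry; apply: (Rint_law (P := g) (Q := g) mo _ mf) => S mS.
have mi : measurable_fun setT (fun x : R => (\1_S x : R)%:E) by apply/measurable_EFinP; exact: measurable_indic.
have h0 : (\int[g]_z (\1_S (- z) : R)%:E = \int[g]_z (\1_S z : R)%:E)%E.
  by apply: (gaussian_sym hg mi) => x; rewrite lee_fin.
rewrite -[X in _ = g X]setIT -integral_indic// -h0 -[X in g X = _]setIT.
have mS' : measurable ((@GRing.opp R) @^-1` S) by rewrite -[X in measurable X]setTI; exact: mo.
by rewrite -integral_indic.
Qed.

Let smeanE t X (z : #|I|.-tuple R) (b : I -> R -> R) s :
  (forall x, (co z tt + c tt X) * b tt x - b tt x ^+ 2 / 2 = sham cl r t X s x) ->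
  ln (ex P0 (gh b (shift_tuple (fun k => c (enum_val k) X) z))) = slog P0 cl r t X s.
Proof.
by move=> h; congr (ln (ex _ _)); apply/funext => x; rewrite gh_shift sumI.
Qed.

Let L z := ex P0 (gh c z).
Let L' z := ex P0 (gh c' z).

Let gmean_plus : gmean P0 g cl r r = \int[gam]_z (ln (L z) * L z).
Proof.
rewrite (planted_mean P0 hg A0 mc cA (measurable_ln_ex_gh P0 mc) (ln_ex_gh_le P0 A0 mc cA)).
apply: eq_Rintegral => X _.
rewrite /smean -(@Rint_co _ _ _ g I (slog P0 cl r r X) tt); last first.
  exact: (meas_sec1 X (measurable_slog P0 mcl r r)).
apply: eq_Rintegral => z _; apply/esym/smeanE => x.
by rewrite /c /sham; move: (Num.sqrt r) sr2 => s <-; field.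
Qed.

Let gmean_minus : gmean P0 g cl r (- r) = \int[gam]_z (ln (L' z) * L z).
Proof.
rewrite (planted_mean P0 hg A0 mc cA (measurable_ln_ex_gh P0 mc') (ln_ex_gh_le P0 A0 mc' cA')).
apply: eq_Rintegral => X _.
have ms : measurable_fun setT (slog P0 cl r (- r) X).
  exact: (meas_sec1 X (measurable_slog P0 mcl r (- r))).
(* Reflecting the noise turns the coupling [- r] into the likelihood ratio of the opposite
   coefficient [c']. *)
rewrite /smean -(gaussian_opp ms) -(@Rint_co _ _ _ g I (fun z => slog P0 cl r (- r) X (- z)) tt); last first.
  by apply: measurableT_comp => //; exact: oppr_measurable.
apply: eq_Rintegral => z _; apply/esym/smeanE => x.
by rewrite /c /c' /sham; move: (Num.sqrt r) sr2 => s <-; field.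
Qed.

Let igl_ex (b : I -> R -> R) : (forall i, measurable_fun setT (b i)) -> (forall i x, `|b i x| <= A) ->
  igl gam (fun z => ex P0 (gh b z)) /\ \int[gam]_z ex P0 (gh b z) = 1.
Proof.
move=> mb bA; split.
  apply: (igl_dom (g := fun z => expR (1 * step_bound A z))).
  - have := measurable_ex_gh P0 mb (@measurable_cst _ _ _ _ setT (0 : R)).
    by under eq_fun do (under eq_fun do rewrite add0r).
  - exact: (igl_step_bound hg).
  - move=> z; rewrite mul1r.
    have /andP[_ h] := ex_bounds P0 (bmf_gh A0 mb bA z).1 (gh_bound A0 bA z).
    by rewrite gtr0_norm//; apply: ex_gt0; exact: (bmf_gh A0 mb bA).
have e1 : ex P0 (fun=> 0) = 1 by rewrite /ex expR0 Rint_cst.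
rewrite -[RHS]e1 -(mean_ex P0 hg A0 mb bA (bmf_cst _ 0)).
by apply: eq_Rintegral => z _; congr (ex _ _); apply/funext => x; rewrite add0r.
Qed.

Let igl_lnL (b : I -> R -> R) : (forall i, measurable_fun setT (b i)) -> (forall i x, `|b i x| <= A) ->
  igl gam (fun z => ln (ex P0 (gh b z)) * L z).
Proof.
move=> mb bA; apply: (igl_dom (g := fun z => expR (3 * step_bound A z))).
- apply: measurable_funM; first exact: measurable_ln_ex_gh.
  exact: (igl_meas (igl_ex mc cA).1).
- exact: (igl_step_bound hg).
- move=> z; rewrite normrM (_ : 3 * _ = 2 * step_bound A z + step_bound A z); last by ring.
  have /andP[_ h] := ex_bounds P0 (bmf_gh A0 mc cA z).1 (gh_bound A0 cA z).
  rewrite expRD ler_pM//; first exact: (ln_ex_gh_le P0 A0 mb bA).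
  by rewrite gtr0_norm//; apply: ex_gt0; exact: (bmf_gh A0 mc cA).
Qed.

(** Gibbs' inequality between the laws of [sqrt r * X + Z] and [- (sqrt r * X + Z)]. *)
Lemma gmean_sign : gmean P0 g cl r (- r) <= gmean P0 g cl r r.
Proof.
have [iL mL] := igl_ex mc cA; have [iL' mL'] := igl_ex mc' cA'.
have i1 : igl gam (fun z => ln (L z) * L z) := igl_lnL mc cA.
have i2 : igl gam (fun z => ln (L' z) * L z) := igl_lnL mc' cA'.
have i3 : igl gam (fun z => L' z - L z) := iglB iL' iL.
rewrite gmean_minus gmean_plus.
apply: (@le_trans _ _ (\int[gam]_z (ln (L z) * L z + (L' z - L z)))).
  apply: (le_Rint i2 (iglD i1 i3)).
  by move=> z; apply: xlny_le; apply: ex_gt0; [exact: (bmf_gh A0 mc cA)|exact: (bmf_gh A0 mc' cA')].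
by rewrite (RintD i1 i3) (RintB iL' iL) mL mL' subrr addr0.
Qed.

End sign.

(** * The variational problem *)

(** A differentiable function lying above a smooth one and touching it at [lam] has the same slope
    there. The minorant [b * h / (lam + h)], which equals [b - b * lam / (lam + h)], has slope
    [b / lam] at [h = 0]. *)
Lemma slope_of_support (R : realType) (psi : R -> R) (lam b : R) : 0 < lam ->
  derivable psi lam 1 ->
  (forall h, 0 < lam + h -> b * h / (lam + h) <= psi (lam + h) - psi lam) ->
  'D_1 psi lam = b / lam.
Proof.
move=> l0 dpsi H.
pose D h := h^-1 *: (psi (h *: 1 + lam) - psi lam).
pose c (h : R) := b / (lam + h).
have DL : D h @[h --> 0^'] --> 'D_1 psi lam by exact: dpsi.
have cc : c h @[h --> (0 : R)] --> b / (lam + 0).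
  apply: cvgM; first exact: cvg_cst.
  apply: cvgV; first by rewrite addr0 gt_eqF.
  by apply: cvgD; [exact: cvg_cst|exact: cvg_id].
rewrite addr0 in cc.
have nl : \forall h \near (0 : R), 0 < lam + h.
  have : (lam + h : R) @[h --> (0 : R)] --> lam + 0 by apply: cvgD; [exact: cvg_cst|exact: cvg_id].
  by rewrite addr0 => /cvgr_gt; exact.
apply/eqP; rewrite eq_le; apply/andP; split.
- have D1 := cvg_dnbhs_at_left DL; have c1 := cvg_at_left_filter cc.
  apply: (ler_cvg_to D1 c1); near=> h.
  have h0 : h < 0 by near: h; exact: nbhs_left_lt.
  have lh : 0 < lam + h by near: h; apply: cvg_at_left_filter nl => //.
  have e : c h = h^-1 * (b * h / (lam + h)) by rewrite /c; field; rewrite (lt_eqF h0) (gt_eqF lh).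
  by rewrite e /D /GRing.scale/= mulr1 (addrC h) ler_nM2l ?invr_lt0//; exact: H.
- have D1 := cvg_dnbhs_at_right DL; have c1 := cvg_at_right_filter cc.
  apply: (ler_cvg_to c1 D1); near=> h.
  have h0 : 0 < h by near: h; exact: nbhs_right_gt.
  have lh : 0 < lam + h by rewrite addr_gt0.
  have e : c h = h^-1 * (b * h / (lam + h)) by rewrite /c; field; rewrite (gt_eqF h0) (gt_eqF lh).
  by rewrite e /D /GRing.scale/= mulr1 (addrC h) ler_pM2l ?invr_gt0//; exact: H.
Unshelve. all: end_near.
Qed.

Section variational.
Context (R : realType) (G : R -> R) (c1 c2 : R).
Hypothesis (c10 : 0 <= c1) (c20 : 0 <= c2) (G0 : G 0 = 0).
Hypothesis G_mod : forall s t, 0 <= s -> 0 <= t ->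
  `|G s - G t| <= c1 * `|Num.sqrt s - Num.sqrt t| + c2 * `|s - t|.
Context (F : R -> R -> R).
Hypothesis FE : forall lam q, F lam q = - (lam / 4) * q ^+ 2 + G (lam * q).

Lemma sqrt_le1D (s : R) : 0 <= s -> Num.sqrt s <= 1 + s.
Proof.
move=> s0; rewrite -[X in 1 + X]sqr_sqrtr//; move: (Num.sqrt s) => u.
by have := sqr_ge0 (u - 1); have := sqr_ge0 u; rewrite sqrrB; lra.
Qed.

Lemma growth s : 0 <= s -> G s <= c1 * (1 + s) + c2 * s.
Proof.
move=> s0; have := G_mod s0 (lexx 0); rewrite G0 !subr0 sqrtr0 subr0.
rewrite (ger0_norm (sqrtr_ge0 s)) (ger0_norm s0) => h.
apply: le_trans (ler_norm _) (le_trans h _); rewrite lerD2r ler_wpM2l//.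
exact: sqrt_le1D.
Qed.

Lemma coercive lam : 0 < lam -> exists2 S, 0 <= S & forall q, S <= q -> F lam q <= F lam 0.
Proof.
move=> l0; pose S := 4 * (c1 + c2) + 4 * c1 / lam + 1.
have u0 : 0 <= c1 / lam by rewrite divr_ge0// ltW.
have S1 : 1 <= S by rewrite lerDr addr_ge0 ?divr_ge0 ?mulr_ge0 ?addr_ge0// ltW.
exists S; first by rewrite (le_trans _ S1).
move=> q Sq; have q1 : 1 <= q := le_trans S1 Sq.
have q0 : 0 <= q by rewrite (le_trans _ q1).
rewrite !FE expr0n/= !mulr0 G0 add0r.
have h := growth (mulr_ge0 (ltW l0) q0).
have h2 : lam / 4 * S <= lam / 4 * q by rewrite ler_wpM2l// divr_ge0// ltW.
have h3 : lam / 4 * S = (c1 + c2) * lam + c1 + lam / 4.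
  by rewrite /S; field; rewrite gt_eqF.
have h4 : (lam / 4 * S) * q <= (lam / 4 * q) * q by rewrite ler_wpM2r.
have h5 : (c1 + lam / 4) * 1 <= (c1 + lam / 4) * q by rewrite ler_wpM2l// addr_ge0// divr_ge0// ltW.
move: h4; rewrite h3 expr2; move: h h5; move: (G _) => Gq; nra.
Qed.

(** The absolute value extends the potential continuously to the line, so that the extreme value
    theorem applies on every segment starting at 0. *)
Lemma continuous_pot lam : 0 < lam -> continuous (fun q : R => F lam `|q|).
Proof.
move=> l0 x.
have cn : `|q| @[q --> x] --> `|x| by apply: norm_continuous.
have cl : (lam * `|q|) @[q --> x] --> lam * `|x| by apply: cvgM => //; exact: cvg_cst.
have cs : Num.sqrt (lam * `|q|) @[q --> x] --> Num.sqrt (lam * `|x|).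
  by apply: (cvg_comp _ _ cl); exact: sqrt_continuous.
have d1 : (Num.sqrt (lam * `|q|) - Num.sqrt (lam * `|x|)) @[q --> x] --> (0 : R).
  by have := cvgB cs (cvg_cst (Num.sqrt (lam * `|x|))); rewrite subrr; exact.
have d2 : (lam * `|q| - lam * `|x|) @[q --> x] --> (0 : R).
  by have := cvgB cl (cvg_cst (lam * `|x|)); rewrite subrr; exact.
have cH : (c1 * `|Num.sqrt (lam * `|q|) - Num.sqrt (lam * `|x|)| + c2 * `|lam * `|q| - lam * `|x| |) @[q --> x] --> (0 : R).
  have := cvgD (cvgM (cvg_cst c1) (cvg_norm d1)) (cvgM (cvg_cst c2) (cvg_norm d2)).
  by rewrite normr0 !mulr0 addr0; exact.
have cG : G (lam * `|q|) @[q --> x] --> G (lam * `|x|).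
  apply/cvgrPdist_le => e e0; have := cH.
  move=> /cvgr_lt/(_ _ e0); apply: filterS => q h.
  rewrite distrC; apply: le_trans (ltW h).
  by apply: G_mod; rewrite mulr_ge0// ltW.
rewrite /continuous_at FE; under eq_cvg do rewrite FE.
by apply: cvgD => //; apply: cvgM; [exact: cvg_cst|rewrite expr2; exact: cvgM].
Qed.

Lemma exists_max lam : 0 < lam -> exists2 q, 0 <= q & forall r, 0 <= r -> F lam r <= F lam q.
Proof.
move=> l0; have [S S0 hS] := coercive l0.
have [|q qS hq] := @EVT_max R (fun q : R => F lam `|q|) 0 S S0.
  by apply: continuous_subspaceT; exact: continuous_pot.
move: qS; rewrite in_itv/= => /andP[q0 _]; rewrite ger0_norm// in hq.
exists q => // r r0; have [rS|/ltW Sr] := leP r S.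
  by have := hq r; rewrite in_itv/= r0 rS ger0_norm//; apply.
apply: le_trans (hS r Sr) _; have := hq 0; rewrite in_itv/= lexx S0 normr0; exact.
Qed.

Let psi lam := sup [set F lam q | q in [set q | 0 <= q]].

Lemma psi_ge lam q : 0 < lam -> 0 <= q -> F lam q <= psi lam.
Proof.
move=> l0 q0; apply: ub_le_sup; last by exists q.
by have [m _ hm] := exists_max l0; exists (F lam m) => _ [r r0 <-]; exact: hm.
Qed.

Lemma psi_max lam q : 0 <= q -> (forall r, 0 <= r -> F lam r <= F lam q) -> psi lam = F lam q.
Proof.
move=> q0 hq; apply/eqP; rewrite eq_le; apply/andP; split.
  by apply: ge_sup; [exists (F lam q), q|move=> _ [r r0 <-]; exact: hq].
apply: ub_le_sup; last by exists q.
by exists (F lam q) => _ [r r0 <-]; exact: hq.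
Qed.

Lemma psi_derive lam q : 0 < lam -> derivable psi lam 1 -> 0 <= q ->
  (forall r, 0 <= r -> F lam r <= F lam q) -> 'D_1 psi lam = q ^+ 2 / 4.
Proof.
move=> l0 dpsi q0 hq.
rewrite (@slope_of_support _ psi lam (q ^+ 2 * lam / 4) l0 dpsi).
  by field; rewrite gt_eqF.
(* The competitor at [lam + h] is chosen with [(lam + h) * r = lam * q]: the terms in [G] cancel and
   only the explicit quadratic ones remain. Since every maximizer gives [q ^+ 2 / 4] as the
   derivative, differentiability leaves room for only one. *)
move=> h lh; pose r := lam * q / (lam + h).
have r0 : 0 <= r by rewrite divr_ge0 ?mulr_ge0 ?(ltW l0)// ltW.
rewrite (psi_max q0 hq); apply: le_trans (lerB (psi_ge lh r0) (lexx _)).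
rewrite !FE (_ : (lam + h) * r = lam * q); last by rewrite /r; field; rewrite gt_eqF.
rewrite le_eqVlt; apply/orP; left; apply/eqP; rewrite /r; field; rewrite gt_eqF//.
Qed.

Lemma unique_max lam q r : 0 < lam -> derivable psi lam 1 -> 0 <= q -> 0 <= r ->
  (forall t, 0 <= t -> F lam t <= F lam q) -> F lam r = F lam q -> r = q.
Proof.
move=> l0 dpsi q0 r0 hq rq.
have h1 := psi_derive l0 dpsi q0 hq.
have h2 : 'D_1 psi lam = r ^+ 2 / 4 by apply: psi_derive => // t; rewrite rq; exact: hq.
have h3 : r ^+ 2 = q ^+ 2 by move: h1; rewrite h2; lra.
by apply/eqP; rewrite -(@eqrXn2 _ 2)// h3.
Qed.

(** Where the perturbation exceeds [delta], compactness makes the potential smaller than its maximum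
    by a uniform gap; [eta] is taken so small that the perturbation cannot fill it. *)
Lemma perturbed_max lam q B delta : 0 < lam -> derivable psi lam 1 -> 0 <= q -> 0 <= B -> 0 < delta ->
  (forall t, 0 <= t -> F lam t <= F lam q) ->
  exists2 eta, 0 < eta & forall s, 0 <= s -> s <= B ->
    F lam s + eta * (s ^+ 2 - q ^+ 2) ^+ 2 <= F lam q + eta * delta.
Proof.
move=> l0 dpsi q0 B0 d0 hq.
pose u (s : R) := delta - (s ^+ 2 - q ^+ 2) ^+ 2.
(* The positive part of [u]: continuous, equal to [delta] at [q], and zero wherever the perturbation
   exceeds [delta]. *)
pose w (s : R) := (u s + `|u s|) / 2.
have w0 s : 0 <= w s by rewrite /w; have := ler_norm (- u s); rewrite normrN; lra.
(* [k < 0] on [[0, B]]: because of [w] near [q], by uniqueness of the maximizer elsewhere. *)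
pose k (s : R) := F lam `|s| - F lam q - w s.
have ck : continuous k.
  move=> x; apply: cvgB; first by apply: cvgB; [exact: continuous_pot|exact: cvg_cst].
  have c2' : (y ^+ 2 - q ^+ 2) @[y --> x] --> x ^+ 2 - q ^+ 2.
    by apply: cvgB; [rewrite !expr2; apply: cvgM; exact: cvg_id|exact: cvg_cst].
  have c3 : (delta - (y ^+ 2 - q ^+ 2) ^+ 2) @[y --> x] --> delta - (x ^+ 2 - q ^+ 2) ^+ 2.
    by apply: cvgB; [exact: cvg_cst|rewrite !(expr2 (_ - _)); exact: cvgM].
  apply: cvgM; last exact: cvg_cst.
  by apply: cvgD; [exact: c3|exact: cvg_norm c3].
have [|m mB hm] := @EVT_max R k 0 B B0; first by apply: continuous_subspaceT.
move: mB; rewrite in_itv/= => /andP[m0 _].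
have km : k m < 0.
  rewrite /k ger0_norm//; have [e|ne] := eqVneq m q.
    by rewrite e subrr sub0r oppr_lt0 /w /u subrr expr0n/= subr0 gtr0_norm//; lra.
  have : F lam m < F lam q.
    rewrite lt_neqAle hq// andbT; apply: contra ne => /eqP e.
    by apply/eqP; exact: unique_max hq e.
  by have := w0 m; lra.
pose D := B ^+ 2 + q ^+ 2.
have D0 : 0 <= D by rewrite addr_ge0 ?sqr_ge0.
have D1 : 0 < D ^+ 2 + 1 by have := sqr_ge0 D; lra.
(* [D ^+ 2] bounds the perturbation on [[0, B]] and [- k m] is the uniform gap; the added 1 keeps
   the denominator positive. *)
pose eta := Num.min 1 (- k m / (D ^+ 2 + 1)).
have e0 : 0 < eta by rewrite lt_min ltr01 divr_gt0// oppr_gt0.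
have e1 : eta <= 1 by rewrite ge_min lexx.
have e2 : eta * (D ^+ 2 + 1) <= - k m by rewrite -ler_pdivlMr// ge_min lexx orbT.
exists eta => // s s0 sB.
have ks : k s <= k m by apply: hm; rewrite in_itv/= s0.
have ksE : k s = F lam s - F lam q - w s by rewrite /k ger0_norm.
have sD : (s ^+ 2 - q ^+ 2) ^+ 2 <= D ^+ 2.
  rewrite -[leLHS]real_normK ?num_real// lerXn2r ?nnegrE//.
  apply: le_trans (ler_normB _ _) _; rewrite !ger0_norm ?sqr_ge0// lerD2r.
  by rewrite lerXn2r ?nnegrE.
have [ud|ud] := leP 0 (u s).
  have h1 : (s ^+ 2 - q ^+ 2) ^+ 2 <= delta by move: ud; rewrite /u subr_ge0.
  by apply: lerD; [exact: hq|rewrite ler_wpM2l// ltW].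
have ws : w s = 0 by rewrite /w ltr0_norm// subrr mul0r.
have h2 : eta * (s ^+ 2 - q ^+ 2) ^+ 2 <= eta * (D ^+ 2 + 1).
  by rewrite ler_wpM2l ?(ltW e0)// (le_trans sD)// lerDl.
have h3 : 0 <= eta * delta by rewrite mulr_ge0 ?ltW.
by move: ks; rewrite ksE ws; lra.
Qed.

End variational.

(** * Concentration of the overlap *)

Section log_partition.
Context d (T : measurableType d) (R : realType) (M : probability T R).

Lemma ln_ex_le (h h' : T -> R) (c : R) : bmf h -> bmf h' -> (forall x, h x <= c + h' x) ->
  ln (ex M h) <= c + ln (ex M h').
Proof.
move=> bh bh' hc.
have e0 : ex M h \is Num.pos by rewrite posrE ex_gt0.
have e0' : ex M h' \is Num.pos by rewrite posrE ex_gt0.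
rewrite -ler_expR expRD (lnK e0) (lnK e0').
rewrite /ex -RintZ; last exact: bmf_igl (bmf_expR bh').
apply: le_Rint; first exact: bmf_igl (bmf_expR bh).
  by apply: iglZ; exact: bmf_igl (bmf_expR bh').
by move=> x; rewrite -expRD ler_expR.
Qed.

Lemma ln_ex_lip (h h' : T -> R) (c : R) : bmf h -> bmf h' -> (forall x, `|h x - h' x| <= c) ->
  `|ln (ex M h) - ln (ex M h')| <= c.
Proof.
move=> bh bh' hc; rewrite ler_distlC lerBlDl; apply/andP; split.
  by apply: ln_ex_le => // x; have := hc x; rewrite ler_norml => /andP[]; lra.
by rewrite addrC; apply: ln_ex_le => // x; have := hc x; rewrite ler_norml => /andP[]; lra.
Qed.

(** The exponential lies above its tangent at the Gibbs mean of [w], and the linear part of the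
    tangent averages to zero. *)
Lemma jensen_ln_ex (h w : T -> R) : bmf h -> bmf w ->
  ln (ex M h) + gibbs M h w <= ln (ex M (fun x => h x + w x)).
Proof.
move=> bh bw; rewrite ex_add//.
have g0 : expR (gibbs M h w) <= gibbs M h (fun x => expR (w x)).
  have bc : bmf (fun x => expR (gibbs M h w) * (1 + (w x - gibbs M h w))).
    by apply: bmfZ; apply: bmfD; [exact: bmf_cst|apply: bmfB => //; exact: bmf_cst].
  rewrite -[leLHS](_ : gibbs M h (fun x => expR (gibbs M h w) * (1 + (w x - gibbs M h w))) = _).
    apply: le_gibbs => //; first exact: bmf_expR.
    move=> x; rewrite (_ : expR (w x) = expR (gibbs M h w) * expR (w x - gibbs M h w)); last first.
      by rewrite -expRD addrC subrK.
    rewrite ler_wpM2l ?expR_ge0//.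
    exact: expR_ge1Dx.
  have b1 : bmf (fun x => w x - gibbs M h w) by apply: bmfB => //; exact: bmf_cst.
  rewrite gibbsZ//; last by apply: bmfD => //; exact: bmf_cst.
  rewrite gibbsD//; last exact: bmf_cst.
  rewrite gibbs_cst// gibbsB//; last exact: bmf_cst.
  by rewrite gibbs_cst// subrr addr0 mulr1.
have gp : 0 < gibbs M h (fun x => expR (w x)) by apply: lt_le_trans g0; exact: expR_gt0.
by rewrite lnM ?posrE//; [rewrite lerD2l -ler_expR lnK|exact: ex_gt0].
Qed.

End log_partition.

Section gmean_modulus.
Context (R : realType) (P0 g : probability R R) (hg : gaussian_law g).
Context (cl : R -> R) (K : R) (K0 : 0 <= K).
Hypothesis mcl : measurable_fun setT cl.
Hypothesis clK : forall x, `|cl x| <= K.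

Lemma gmean0 : gmean P0 g cl 0 0 = 0.
Proof.
have sl X z : slog P0 cl 0 0 X z = 0.
  rewrite /slog (_ : sham cl 0 0 X z = fun=> 0); last first.
    by apply/funext => x; rewrite /sham sqrtr0 !mul0r addr0 subr0.
  by rewrite /ex expR0 Rint_cst ln1.
have sm X : smean P0 g cl 0 0 X = 0.
  by rewrite /smean -[RHS](Rint_cst g); apply: eq_Rintegral => z _; exact: sl.
by rewrite /gmean -[RHS](Rint_cst P0); apply: eq_Rintegral => X _; exact: sm.
Qed.

Lemma sham_lip s t X z x : `|sham cl s s X z x - sham cl t t X z x| <=
  `|Num.sqrt s - Num.sqrt t| * K * `|z| + 3 / 2 * K ^+ 2 * `|s - t|.
Proof.
rewrite (_ : _ - _ = (Num.sqrt s - Num.sqrt t) * cl x * z + (s - t) * (cl x * cl X - cl x ^+ 2 / 2)); last first.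
  by rewrite /sham; field.
apply: le_trans (ler_normD _ _) _; apply: lerD.
  by rewrite !normrM ler_wpM2r// ler_wpM2l.
rewrite normrM mulrC ler_wpM2r//; apply: le_trans (ler_normB _ _) _.
rewrite (_ : 3 / 2 * K ^+ 2 = K ^+ 2 + K ^+ 2 / 2); last by field.
apply: lerD; first by rewrite normrM expr2 ler_pM.
by rewrite normrM normrX (@ger0_norm _ 2^-1)// ler_wpM2r// lerXn2r ?nnegrE.
Qed.

(** The logarithm of a partition function is 1-Lipschitz in the uniform norm of the Hamiltonian. The
    noise enters with amplitude [Num.sqrt s], whence the square-root term in the modulus. *)
Lemma gmean_modulus s t : `|gmean P0 g cl s s - gmean P0 g cl t t| <=
  (K * \int[g]_z `|z|) * `|Num.sqrt s - Num.sqrt t| + 3 / 2 * K ^+ 2 * `|s - t|.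
Proof.
pose b (z : R) := `|Num.sqrt s - Num.sqrt t| * K * `|z| + 3 / 2 * K ^+ 2 * `|s - t|.
have iz : igl g (fun z => `|z|) := igl_norm (igl_id hg).
have ib : igl g b by apply: iglD; [exact: iglZ|exact: igl_cst].
have bE : \int[g]_z b z = (K * \int[g]_z `|z|) * `|Num.sqrt s - Num.sqrt t| + 3 / 2 * K ^+ 2 * `|s - t|.
  rewrite RintD; [|exact: iglZ|exact: igl_cst].
  by rewrite Rint_cst RintZ//; ring.
have is_ u X := igl_slog P0 hg K0 mcl clK u u X.
have h X : `|smean P0 g cl s s X - smean P0 g cl t t X| <= \int[g]_z b z.
  rewrite /smean -RintB//; apply: norm_Rint => //; first exact: iglB.
  move=> z; apply: ln_ex_lip; [exact: (bmf_sham mcl clK)|exact: (bmf_sham mcl clK)|].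
  by move=> x; exact: sham_lip.
have im u := igl_smean P0 hg K0 mcl clK u u.
rewrite /gmean -RintB// -bE -[leRHS](Rint_cst P0).
by apply: norm_Rint => //; [exact: iglB|exact: igl_cst].
Qed.

End gmean_modulus.

Lemma sqrt_eventually (R : realType) (a b c : R) : 0 < c ->
  exists n1 : nat, (0 < n1)%N /\ forall n : nat, (n1 <= n)%N -> Num.sqrt n%:R * a + b <= n%:R * c.
Proof.
(* For [sqrt n >= A], the final 1 gives [b <= sqrt n * |b|] and the quotient gives
   [|a| + |b| <= sqrt n * c]. *)
move=> c0; pose A := (`|a| + `|b|) / c + 1.
have A1 : 1 <= A by rewrite lerDr divr_ge0 ?addr_ge0// ltW.
have A0 : 0 <= A by rewrite (le_trans _ A1).
exists (Num.truncn (A ^+ 2)).+1; split => // n hn.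
have An : A ^+ 2 <= n%:R.
  have /andP[_ /ltW h] := truncn_itv (sqr_ge0 A).
  by apply: le_trans h _; rewrite ler_nat.
have sA : A <= Num.sqrt n%:R by rewrite -(ger0_norm A0) -sqrtr_sqr ler_wsqrtr.
have s2 : Num.sqrt n%:R ^+ 2 = n%:R :> R by rewrite sqr_sqrtr.
move: sA s2; move: (Num.sqrt n%:R) => u uA <-.
have u1 : 1 <= u := le_trans A1 uA.
have h1 : u * a + b <= u * (`|a| + `|b|).
  rewrite mulrDr; apply: lerD; first by rewrite ler_wpM2l ?ler_norm// (le_trans _ u1).
  by apply: le_trans (ler_norm b) _; rewrite ler_peMl.
apply: le_trans h1 _; rewrite expr2 -mulrA ler_wpM2l ?(le_trans _ u1)//.
have : (`|a| + `|b|) / c <= u by apply: le_trans uA; rewrite lerDl.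
by rewrite ler_pdivrMr.
Qed.

Lemma gap_arith (R : realType) (n u z V f s x k y w : R) :
  u <= n * (V + s) + x + (k / 4 + y) -> n * f + w <= z + w + k / 4 ->
  u - z <= n * (V - f + s) + (x + (k / 2 + y)).
Proof. by rewrite !mulrDr mulrN; lra. Qed.

(** * Convergence of the overlap error *)

Section model_limit.
Context (R : realType) (P0 g : probability R R) (hg : gaussian_law g).
Context (cl : R -> R) (K : R) (K0 : 0 < K).
Hypothesis mcl : measurable_fun setT cl.
Hypothesis clK : forall x, `|cl x| <= K.
Context (lambda : R) (l0 : 0 < lambda).
Local Notation B := (K ^+ 2).
Context (F : R -> R -> R).
Hypothesis FE : forall lam q, F lam q = - (lam / 4) * q ^+ 2 + gmean P0 g cl (lam * q) (lam * q).
Let psi lam := sup [set F lam q | q in [set q | 0 <= q]].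
Hypothesis dpsi : derivable psi lambda 1.
Context (q : R) (q0 : 0 <= q).
Hypothesis hq : forall r, 0 <= r -> F lambda r <= F lambda q.

Definition sqdev (u : R) : R := (u ^+ 2 - q ^+ 2) ^+ 2.

Let B0 : 0 <= B. Proof. exact: sqr_ge0. Qed.

Let D := B ^+ 2 + q ^+ 2.

Let D0 : 0 <= D. Proof. by rewrite addr_ge0 ?sqr_ge0. Qed.
Let lip_ge0 eta : 0 < eta -> 0 <= eta * (4 * B * D).
Proof. by move=> h; rewrite mulr_ge0 ?(ltW h)// mulr_ge0 ?D0// mulr_ge0 ?B0. Qed.

Lemma sqdev_le u : `|u| <= B -> `|sqdev u| <= D ^+ 2.
Proof.
move=> uB; rewrite ger0_norm ?sqr_ge0// -[leLHS]real_normK ?num_real//.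
rewrite lerXn2r ?nnegrE//.
apply: le_trans (ler_normB _ _) _; rewrite (ger0_norm (sqr_ge0 q)) lerD2r normrX.
by rewrite lerXn2r ?nnegrE.
Qed.

Lemma sqdev_lip u v : `|u| <= B -> `|v| <= B ->
  `|sqdev u - sqdev v| <= (4 * B * D) * `|u - v|.
Proof.
move=> uB vB.
rewrite (_ : _ - _ = ((u + v) * (u ^+ 2 - q ^+ 2 + (v ^+ 2 - q ^+ 2))) * (u - v)); last by rewrite /sqdev; ring.
rewrite normrM ler_wpM2r// normrM (_ : 4 * B * D = (2 * B) * (2 * D)); last by ring.
have sq w : `|w| <= B -> `|w ^+ 2 - q ^+ 2| <= D.
  move=> wB; apply: le_trans (ler_normB _ _) _; rewrite (ger0_norm (sqr_ge0 q)) lerD2r normrX.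
  by rewrite lerXn2r ?nnegrE.
apply: ler_pM => //.
  by apply: le_trans (ler_normD _ _) _; rewrite mulrDl mul1r lerD.
by apply: le_trans (ler_normD _ _) _; rewrite mulrDl mul1r lerD// sq.
Qed.

Lemma measurable_sqdev : measurable_fun setT sqdev.
Proof. by apply: measurable_funX; apply: measurable_funB => //; exact: measurable_funX. Qed.

(** The expectation of the theorem written with bounded spins and the noise space of the
    interpolation; [expectation_posterior] identifies the two. *)
Definition overlap_error n : R :=
  \int[tuple_prob P0 n]_X \int[tuple_prob g #|chan n|]_z
    gibbs (tuple_prob P0 n) (planted (@edge_coef R cl lambda n) X z) (fun x => sqdev (ov cl X x)).

Section fixed_size.
Context (n : nat) (n0 : (0 < n)%N) (eta : R) (eta0 : 0 < eta) (V : R).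
Hypothesis fV : forall m, `|m| <= B ->
  - lambda / 4 * m ^+ 2 + eta * sqdev m + gmean P0 g cl (lambda * `|m|) (lambda * m) <= V.
Context (N : nat) (N0 : (0 < N)%N).
Local Notation M := (tuple_prob P0 n).
Local Notation gam := (tuple_prob g #|chan n|).
Local Notation ec := (@edge_coef R cl lambda n).
Local Notation f := (fun u => eta * sqdev u).
Local Notation tl := (@tilt R cl n f).

Let mf : measurable_fun setT f.
Proof. by apply: measurable_funM => //; exact: measurable_sqdev. Qed.

Let fF u : `|u| <= B -> `|f u| <= eta * D ^+ 2.
Proof. by move=> uB; rewrite normrM (ger0_norm (ltW eta0)) ler_wpM2l ?(ltW eta0)// sqdev_le. Qed.

Let fC u v : `|u| <= B -> `|v| <= B -> `|f u - f v| <= (eta * (4 * B * D)) * `|u - v|.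
Proof.
move=> uB vB; rewrite -mulrBr normrM (ger0_norm (ltW eta0)) -mulrA.
by rewrite ler_wpM2l ?(ltW eta0)// sqdev_lip.
Qed.

Let bt X : bmf (tl X).
Proof.
split; first exact: (meas_sec1 X (measurable_tilt mcl mf (n := n))).
by exists (n%:R * (eta * D ^+ 2)) => x; exact: (tilt_le clK n0 fF X x).
Qed.

Let gibbs_le X z : (n%:R * eta) * gibbs M (planted ec X z) (fun x => sqdev (ov cl X x)) <=
  lnp M ec tl X z - lnp M ec (fun _ _ => 0) X z.
Proof.
have [me eA] := edge_coef_bmf mcl clK lambda n.
have bp := bmf_planted me eA X z.
have bs : bmf (fun x => sqdev (ov cl X x)).
  split; last by exists (D ^+ 2) => x; apply: sqdev_le; exact: ov_le.
  apply: (measurableT_comp measurable_sqdev).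
  exact: (meas_sec1 X (measurable_ov mcl (n := n))).
have := jensen_ln_ex M bp (bt X).
rewrite (_ : tl X = fun x => (n%:R * eta) * sqdev (ov cl X x)); last first.
  by apply/funext => x; rewrite /tilt mulrA.
rewrite gibbsZ// => h; rewrite lerBrDl.
rewrite (_ : lnp M ec (fun _ _ => 0) X z = ln (ex M (planted ec X z))); last first.
  by congr (ln (ex _ _)); apply/funext => x; rewrite add0r.
apply: le_trans h _; rewrite le_eqVlt; apply/orP; left; apply/eqP.
by congr (ln (ex _ _)); apply/funext => x; rewrite addrC /tilt mulrA.
Qed.

Let measurable_gibbs :
  measurable_fun setT (fun p => gibbs M (planted ec p.1 p.2) (fun x => sqdev (ov cl p.1 x))).
Proof.
have [me eA] := edge_coef_bmf mcl clK lambda n.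
have mp := measurable_planted3 me.
have mn : measurable_fun setT (fun p : n.-tuple R * #|chan n|.-tuple R => ex M (planted ec p.1 p.2)).
  apply: (meas_Rint M (f := fun p => expR (planted ec p.1.1 p.1.2 p.2))).
  exact: measurableT_comp.
apply: measurable_funM.
  apply: (meas_Rint M (f := fun p => sqdev (ov cl p.1.1 p.2) * expR (planted ec p.1.1 p.1.2 p.2))).
  apply: measurable_funM; last exact: measurableT_comp.
  apply: (measurableT_comp measurable_sqdev).
  apply: (measurableT_comp (measurable_ov mcl (n := n))
    (g := fun p : (n.-tuple R * #|chan n|.-tuple R) * n.-tuple R => (p.1.1, p.2))).
  apply/measurable_fun_pair; last exact: measurable_snd.
  by apply: (measurableT_comp measurable_fst); exact: measurable_fst.
apply: (measurable_inv_ge0 mn) => p; apply: ltW; apply: ex_gt0.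
exact: (bmf_planted me eA).
Qed.

Let bs X : bmf (fun x : n.-tuple R => sqdev (ov cl X x)).
Proof.
split; last by exists (D ^+ 2) => x; apply: sqdev_le; exact: ov_le.
apply: (measurableT_comp measurable_sqdev).
exact: (meas_sec1 X (measurable_ov mcl (n := n))).
Qed.

Let gibbs_bound X z : `|gibbs M (planted ec X z) (fun x => sqdev (ov cl X x))| <= D ^+ 2.
Proof.
have [me eA] := edge_coef_bmf mcl clK lambda n.
apply: gibbs_norm_le => //; first exact: (bmf_planted me eA).
by move=> x; apply: sqdev_le; exact: ov_le.
Qed.

Let igl_gibbs X : igl gam (fun z => gibbs M (planted ec X z) (fun x => sqdev (ov cl X x))).
Proof. by apply: igl_bound => [|z]; [exact: (meas_sec1 X measurable_gibbs)|exact: gibbs_bound]. Qed.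

Let igl_gibbs2 : igl M (fun X => \int[gam]_z gibbs M (planted ec X z) (fun x => sqdev (ov cl X x))).
Proof.
apply: igl_bound => [|X]; first exact: (meas_Rint gam measurable_gibbs).
by apply: norm_Rint; [exact: igl_gibbs|exact: (igl_cst gam (D ^+ 2))|exact: gibbs_bound].
Qed.

Lemma overlap_error_le_gap : (n%:R * eta) * overlap_error n <=
  \int[M]_X \int[gam]_z lnp M ec tl X z - \int[M]_X \int[gam]_z lnp M ec (fun _ _ => 0) X z.
Proof.
have [me eA] := edge_coef_bmf mcl clK lambda n.
have cA0 : 0 <= Num.sqrt (lambda / n%:R) * B by rewrite mulr_ge0 ?sqrtr_ge0.
have m0 : measurable_fun setT (fun p : n.-tuple R * n.-tuple R => 0 : R) by exact: measurable_cst.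
have h0 (X x : n.-tuple R) : `|0 : R| <= 0 by rewrite normr0.
have mt := measurable_tilt mcl mf (n := n).
have it := tilt_le clK n0 fF.
have i1 := igl_lnp2 M hg cA0 me eA mt it.
have i0 := igl_lnp2 M hg cA0 me eA m0 h0.
have i1z X := igl_lnp M hg cA0 me eA mt it X.
have i0z X := igl_lnp M hg cA0 me eA m0 h0 X.
rewrite /overlap_error -(RintB i1 i0) -(RintZ _ igl_gibbs2).
apply: (le_Rint (iglZ _ igl_gibbs2) (iglB i1 i0)) => X.
rewrite -(RintB (i1z X) (i0z X)) -(RintZ _ (igl_gibbs X)).
apply: (le_Rint (iglZ _ (igl_gibbs X)) (iglB (i1z X) (i0z X))) => z.
exact: gibbs_le.
Qed.

(** The term [n%:R * lambda * q ^+ 2 / 4] of the lower bound completes [gmean] to the potential at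
    [q], so at order [n] only its gap to [V] and the grid error remain. *)
Lemma overlap_error_bound : (n%:R * eta) * overlap_error n <=
  n%:R * (V - F lambda q + slack K lambda (eta * (4 * B * D)) N) +
  (Num.sqrt n%:R * (Num.sqrt (lambda / 2) * B * \int[g]_z `|z| +
     \sum_(l < N.+1) (msq g K (lambda * `|grid K N l|) (lambda * grid K N l) + 1)) +
   (lambda * K ^+ 4 / 2 + ln N.+1%:R)).
Proof.
have C0 := lip_ge0 eta0.
have h1 := overlap_error_le_gap.
have h2 := free_energy_upper hg K0 mcl clK l0 n0 C0 mf fC fF fV N0.
have h3 := free_energy_lower P0 hg (ltW K0) mcl clK l0 n0 q0.
have e : n%:R * gmean P0 g cl (lambda * q) (lambda * q) = n%:R * F lambda q + n%:R * lambda * q ^+ 2 / 4.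
  by rewrite FE; field.
rewrite e in h3.
apply: le_trans h1 _; move: h2 h3; exact: gap_arith.
Qed.

End fixed_size.

Theorem overlap_error_cvg e : 0 < e ->
  exists n1 : nat, (0 < n1)%N /\ forall n : nat, (n1 <= n)%N -> overlap_error n <= e.
Proof.
(* Three contributions, per spin, are made at most [eta * (e / 4)] each: the perturbed maximum, the
   grid error, and everything of order [sqrt n] or less. They sum to less than [eta * e]. *)
move=> e0; have e4 : 0 < e / 4 by rewrite divr_gt0.
have A0 : 0 <= K * \int[g]_z `|z| by rewrite mulr_ge0 ?(ltW K0)// Rintegral_ge0.
have A1 : 0 <= 3 / 2 * B by rewrite mulr_ge0.
have G0 := gmean0 P0 g cl.
have Gm s t (_ : 0 <= s) (_ : 0 <= t) := gmean_modulus P0 hg (ltW K0) mcl clK s t.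
have [eta eta0 he] := perturbed_max (G := fun s => gmean P0 g cl s s) A0 A1 G0 Gm FE l0 dpsi q0 B0 e4 hq.
pose V := F lambda q + eta * (e / 4).
(* [perturbed_max] covers nonnegative overlaps. Both the quadratic term and [sqdev] are even in [m],
   and [gmean_sign] compares the remaining term at [m] with that at [|m|]. *)
have fV m : `|m| <= B ->
    - lambda / 4 * m ^+ 2 + eta * sqdev m + gmean P0 g cl (lambda * `|m|) (lambda * m) <= V.
  move=> mB; have := he `|m| (normr_ge0 m) mB.
  rewrite FE real_normK ?num_real// -/(sqdev m) => h; apply: le_trans h.
  rewrite mulNr addrAC lerD2r lerD2l; have [m0|m0] := leP 0 m; first by rewrite ger0_norm.
  have -> : lambda * m = - (lambda * `|m|) by rewrite ltr0_norm// mulrN opprK.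
  by apply: (gmean_sign P0 hg (ltW K0) mcl clK); rewrite mulr_ge0// ltW.
pose C := eta * (4 * B * D).
have C0 : 0 <= C := lip_ge0 eta0.
pose c := eta * (e / 4).
have c0 : 0 < c by rewrite mulr_gt0.
(* The grid error is at most [S / N%:R]: in its quadratic part one of the two factors [N%:R^-1] is
   replaced by 1. *)
pose S := 2 * B * (lambda * B + C).
have S0 : 0 <= S by apply: mulr_ge0; [exact: mulr_ge0|apply: addr_ge0 => //; apply: mulr_ge0 => //; exact: ltW].
pose N := (Num.truncn (S / c)).+1.
have SN : S / N%:R <= c.
  rewrite ler_pdivrMr ?ltr0n// mulrC -ler_pdivrMr//.
  by have /andP[_ /ltW] := truncn_itv (divr_ge0 S0 (ltW c0)).
have slackS : slack K lambda C N <= c.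
  apply: le_trans SN; rewrite /slack.
  have N1 : N%:R^-1 <= 1 :> R by rewrite invf_le1 ?ltr0n// ler1n.
  have Ni0 : 0 <= N%:R^-1 :> R by rewrite invr_ge0.
  move: N1 Ni0; move: (N%:R^-1 : R) => w w1 w0.
  have h : lambda * B ^+ 2 * w * w <= lambda * B ^+ 2 * w * 1.
    by rewrite ler_wpM2l// mulr_ge0// mulr_ge0 ?(ltW l0)// sqr_ge0.
  have -> : lambda * (2 * B * w) ^+ 2 / 2 = 2 * (lambda * B ^+ 2 * w * w) by field.
  have -> : S * w = 2 * (lambda * B ^+ 2 * w * 1) + C * (2 * B * w) by rewrite /S; ring.
  by rewrite lerD2r ler_wpM2l.
have [n1 [n10 hn1]] := sqrt_eventually (Num.sqrt (lambda / 2) * B * \int[g]_z `|z| +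
     \sum_(l < N.+1) (msq g K (lambda * `|grid K N l|) (lambda * grid K N l) + 1))
     (lambda * K ^+ 4 / 2 + ln N.+1%:R) c0.
exists n1; split => // n hn; have n0 : (0 < n)%N := leq_trans n10 hn.
have h := overlap_error_bound n0 eta0 fV (ltn0Sn _ : (0 < N)%N).
have nR : 0 < n%:R :> R by rewrite ltr0n.
have ne0 : 0 < n%:R * eta by rewrite mulr_gt0.
rewrite -(ler_pM2l ne0); apply: le_trans h _.
apply: le_trans (lerD (lexx _) (hn1 n hn)) _.
rewrite (_ : n%:R * eta * e = n%:R * (4 * c)); last by rewrite /c; field.
rewrite -mulrDr ler_wpM2l ?ler0n// /V (addrC (F lambda q)) addrK -/c.
by move: slackS; rewrite -/C; lra.
Qed.

End model_limit.

(** * Transfer to the observation model *)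

Section support.
Context (R : realType) (P0 : probability R R).

Lemma measurable_gt_norm (K : R) : measurable [set x : R | K < `|x|].
Proof.
have mn : measurable_fun setT (fun x : R => `|x|) by exact: measurableT_comp.
rewrite (_ : [set x | _] = (fun x : R => `|x|) @^-1` [set` `]K, +oo[%R]).
  by rewrite -[X in measurable X]setTI; apply: mn => //; exact: measurable_itv.
by apply/seteqP; split => x /=; rewrite in_itv/= andbT.
Qed.

(** Every point outside the support lies in an interval with rational endpoints of measure zero, and
    there are countably many such intervals. *)
Lemma support_null (K : R) : (forall x, measure_support P0 x -> `|x| <= K) ->
  P0 [set x | K < `|x|] = 0%E.
Proof.
move=> hK.
pose I (p : rat * rat) : set R := [set x | ratr p.1 < x < ratr p.2].
have mI p : measurable (I p).
  rewrite (_ : I p = [set` `]ratr p.1, ratr p.2[%R]); first exact: measurable_itv.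
  by apply/seteqP; split => x /=; rewrite in_itv.
pose N k := if unpickle k is Some p then (if P0 (I p) == 0%E then I p else set0) else set0.
have IN p : P0 (I p) = 0%E -> I p `<=` \bigcup_k N k.
  by move=> p0 x px; exists (pickle p); [exact: Logic.I|rewrite /N pickleK p0 eqxx].
have nN : P0.-negligible (\bigcup_k N k).
  apply: negligible_bigcup => k; rewrite /N; case: unpickle => [p|]; last exact: negligible_set0.
  by case: eqP => [e|_]; [exists (I p); split|exact: negligible_set0].
have mS := measurable_gt_norm K.
apply/(measure_negligible mS)/(negligibleS _ nN) => x /= Kx.
have : ~ measure_support P0 x by move=> /hK; rewrite leNgt Kx.
rewrite /measure_support/= => /existsNP[U /not_implyP[oU /not_implyP[Ux /negP]]].
rewrite -leNgt => U0.
have /nbhs_ballP[e /= e0 he] : nbhs x U by apply: open_nbhs_nbhs; split.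
have h2 : 0 < e / 2 by rewrite divr_gt0.
have [a /andP[a1 a2]] : exists a : rat, x - e / 2 < ratr a < x.
  have h : x - e / 2 < x by rewrite ltrBlDr ltrDl.
  by have [a] := rat_in_itvoo h; rewrite in_itv; exists a.
have [b /andP[b1 b2]] : exists b : rat, x < ratr b < x + e / 2.
  have h : x < x + e / 2 by rewrite ltrDl.
  by have [b] := rat_in_itvoo h; rewrite in_itv; exists b.
have IU : I (a, b) `<=` U.
  move=> y /= /andP[y1 y2]; apply: he.
  by rewrite /ball/= ltr_distl; apply/andP; split; lra.
apply: (IN (a, b)); last by rewrite /I/= a2 b1.
apply/eqP; rewrite eq_le measure_ge0 andbT; apply: le_trans U0; apply: le_measure; rewrite ?inE//.
exact: open_measurable.
Qed.

(** Clipping moves only points of the null set where [K < |x|]. It trades the almost sure bound on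
    the spins for the pointwise one required above. *)
Lemma clip_law (K : R) : 0 <= K -> (forall x, measure_support P0 x -> `|x| <= K) ->
  forall S, measurable S -> P0 (clip K @^-1` S) = P0 S.
Proof.
move=> K0 hK S mS; have N0 := support_null hK.
have mN := measurable_gt_norm K.
have mc : measurable (clip K @^-1` S).
  by rewrite -[X in measurable X]setTI; exact: measurable_clip.
have le A B : measurable A -> measurable B -> A `<=` B `|` [set x : R | K < `|x|] -> (P0 A <= P0 B)%E.
  move=> mA mB AB; apply: (@le_trans _ _ (P0 (B `|` [set x : R | K < `|x|]))).
    by apply: le_measure; rewrite ?inE//; exact: measurableU.
  by rewrite -[leRHS]adde0 -N0; exact: (measureU2 P0 mB mN).
apply/eqP; rewrite eq_le; apply/andP; split; apply: le => // x /=.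
  by move=> h; have [xK|Kx] := leP `|x| K; [left; rewrite clip_id in h|right].
by move=> h; have [xK|Kx] := leP `|x| K; [left; rewrite clip_id|right].
Qed.

End support.

Section potential_gmean.
Context (R : realType) (P0 : probability R R) (cl : R -> R) (K : R) (K0 : 0 <= K).
Hypothesis mcl : measurable_fun setT cl.
Hypothesis clK : forall x, `|cl x| <= K.
Hypothesis cl_law : forall S, measurable S -> P0 (cl @^-1` S) = P0 S.
Local Notation g := (std_gauss R).

Let phi (p : R * R) : R * measurableTypeR R := (cl p.1, p.2).

Let mphi : measurable_fun setT phi.
Proof.
apply/measurable_fun_pair; last exact: measurable_snd.
by apply: (measurableT_comp mcl); exact: measurable_fst.
Qed.

HB.instance Definition _ := isMeasurableFun.Build _ _ _ _ phi mphi.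

Let phi_law S : measurable S -> (P0 \x g)%E (phi @^-1` S) = (P0 \x normal_prob 0 1)%E S.
Proof.
move=> mS; rewrite -[LHS]/(distribution (P0 \x g)%E phi S); symmetry.
apply: product_measure_unique => // A B mA mB.
rewrite -[LHS]/((P0 \x g)%E ((cl @^-1` A) `*` B)) product_measure1E//.
  by congr (_ * _)%E; exact: cl_law.
by rewrite -[X in measurable X]setTI; exact: mcl.
Qed.

(** The map [phi] clips the signal and carries [std_gauss] to [normal_prob 0 1] without changing the
    law of the pair; the inner integral over [P0] is clipped likewise, and Fubini gives the iterated
    form. *)
Lemma potentialE lam q : potential P0 lam q =
  - (lam / 4) * q ^+ 2 + gmean P0 g cl (lam * q) (lam * q).
Proof.
rewrite /potential; congr (_ + _).
pose f (p : R * measurableTypeR R) := ln (\int[P0]_x expR (Num.sqrt (lam * q) * p.2 * x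
  + lam * q * x * p.1 - lam / 2 * q * x ^+ 2)).
have m2 : measurable_fun setT (fun p : (R * measurableTypeR R) * R => p.2) by exact: measurable_snd.
have m11 : measurable_fun setT (fun p : (R * measurableTypeR R) * R => p.1.1).
  by apply: (measurableT_comp measurable_fst); exact: measurable_fst.
have m12 : measurable_fun setT (fun p : (R * measurableTypeR R) * R => p.1.2 : R).
  by apply: (measurableT_comp measurable_snd); exact: measurable_fst.
have me : measurable_fun setT (fun p : (R * measurableTypeR R) * R =>
    expR (Num.sqrt (lam * q) * p.1.2 * p.2 + lam * q * p.2 * p.1.1 - lam / 2 * q * p.2 ^+ 2)).
  apply: measurableT_comp => //; apply: measurable_funB; last first.
    by apply: measurable_funM => //; exact: measurable_funX.
  by apply: measurable_funD; apply: measurable_funM => //; exact: measurable_funM.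
have mf : measurable_fun setT f.
  apply: (measurableT_comp (@measurable_ln R)).
  exact: (meas_Rint P0 me).
rewrite (Rint_law (P := (P0 \x g)%E) mphi phi_law mf).
have fE p : f (phi p) = slog P0 cl (lam * q) (lam * q) p.1 p.2.
  rewrite /f /slog /ex; congr (ln _).
  rewrite (Rint_law (P := P0) mcl cl_law); last exact: (meas_sec1 (phi p) me).
  by apply: eq_Rintegral => x _; rewrite /sham /phi/=; congr expR; ring.
transitivity (\int[(P0 \x g)%E]_p slog P0 cl (lam * q) (lam * q) p.1 p.2).
  by apply: eq_Rintegral => p _; exact: fE.
have ms := measurable_slog P0 mcl (lam * q) (lam * q).
have ib := igl_sbound (std_gauss_law R) K (lam * q) (lam * q).
have is_ X := igl_slog P0 (std_gauss_law R) K0 mcl clK (lam * q) (lam * q) X.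
have ip : igl (P0 \x g)%E (fun p => slog P0 cl (lam * q) (lam * q) p.1 p.2).
  apply: (igl_prod ms (igl_cst P0 1) ib) => //.
    by move=> x y; rewrite mul1r; exact: (slog_le P0 K0 mcl clK).
  by move=> y; apply: le_trans (slog_le P0 K0 mcl clK (lam * q) (lam * q) 0 y).
exact: (Rint_prod ip is_).
Qed.

End potential_gmean.

Lemma measurable_mktuple d1 d2 (T : measurableType d1) (U : measurableType d2) n (f : 'I_n -> T -> U) :
  (forall i, measurable_fun setT (f i)) -> measurable_fun setT (fun w => [tuple f i w | i < n]).
Proof.
move=> mf; apply/measurable_fun_tnthP => i.
by rewrite (_ : _ \o _ = f i)//; apply/funext => w /=; rewrite tnth_mktuple.
Qed.

Lemma eprod_enum (R : realType) (I : finType) (F : 'I_#|I| -> \bar R) :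
  (\prod_k F k = \prod_(i : I) F (enum_rank i))%E.
Proof. by rewrite (reindex (@enum_rank I))//; apply: onW_bij; exact: enum_rank_bij. Qed.

Section posterior.
Context (R : realType) (P0 : probability R R) (lambda q : R) (n : nat).
Local Notation M := (tuple_prob P0 n).

Definition posterior_sqdev (p : n.-tuple R * #|{: edge n}|.-tuple R) : R :=
  posterior_mean P0 lambda (observation lambda (tnth p.1) (fun e => tnth p.2 (enum_rank e)))
    (fun x => sqdev q (overlap (tnth x) (tnth p.1))).

Let LLR (p : (n.-tuple R * #|{: edge n}|.-tuple R) * n.-tuple R) : R :=
  log_likelihood_ratio lambda
    (observation lambda (tnth p.1.1) (fun e => tnth p.1.2 (enum_rank e))) p.2.
Let dev (p : (n.-tuple R * #|{: edge n}|.-tuple R) * n.-tuple R) : R :=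
  sqdev q (overlap (tnth p.2) (tnth p.1.1)).

Let m2 i : measurable_fun setT (fun p : (n.-tuple R * #|{: edge n}|.-tuple R) * n.-tuple R => tnth p.2 i).
Proof. by apply: (measurableT_comp (measurable_tnth i)); exact: measurable_snd. Qed.
Let m11 i : measurable_fun setT (fun p : (n.-tuple R * #|{: edge n}|.-tuple R) * n.-tuple R => tnth p.1.1 i).
Proof.
apply: (measurableT_comp (measurable_tnth i)).
by apply: (measurableT_comp measurable_fst); exact: measurable_fst.
Qed.
Let m12 i : measurable_fun setT (fun p : (n.-tuple R * #|{: edge n}|.-tuple R) * n.-tuple R => tnth p.1.2 i).
Proof.
apply: (measurableT_comp (measurable_tnth i)).
by apply: (measurableT_comp measurable_snd); exact: measurable_fst.
Qed.

Lemma measurable_LLR : measurable_fun setT LLR.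
Proof.
apply: measurable_sum => e; apply: measurable_funB.
  apply: measurable_funM; first by apply: measurable_funM => //; exact: measurable_funM.
  by apply: measurable_funD => //; apply: measurable_funM => //; exact: measurable_funM.
by apply: measurable_funM; [apply: measurable_funM => //|]; exact: measurable_funX.
Qed.

Lemma measurable_dev : measurable_fun setT dev.
Proof.
apply: (measurableT_comp (measurable_sqdev q)); apply: measurable_funM => //.
by apply: measurable_sum => i; exact: measurable_funM.
Qed.

Lemma measurable_posterior_sqdev : measurable_fun setT posterior_sqdev.
Proof.
have mE : measurable_fun setT (fun p => expR (LLR p)) by apply: measurableT_comp => //; exact: measurable_LLR.
rewrite (_ : posterior_sqdev = fun p => (ex M (fun x => LLR (p, x)))^-1 *
  \int[M]_x (dev (p, x) * expR (LLR (p, x)))); last by apply/funext.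
apply: measurable_funM; last first.
  apply: (meas_Rint M (f := fun r => dev r * expR (LLR r))).
  by apply: measurable_funM => //; exact: measurable_dev.
have mI : measurable_fun setT (fun p => ex M (fun x => LLR (p, x))) by exact: (meas_Rint M mE).
by apply: (measurable_inv_ge0 mI) => p; apply: Rintegral_ge0 => x _; exact: expR_ge0.
Qed.

Hypothesis l0 : 0 < lambda.
Context (cl : R -> R) (K : R) (K0 : 0 <= K).
Hypothesis mcl : measurable_fun setT cl.
Hypothesis clK : forall x, `|cl x| <= K.
Hypothesis cl_law : forall S, measurable S -> P0 (cl @^-1` S) = P0 S.
Local Notation g := (std_gauss R).
Local Notation gam := (tuple_prob g #|chan n|).
Local Notation gE := (tuple_prob g #|{: edge n}|).

Let mapcl (x : n.-tuple R) : n.-tuple R := [tuple cl (tnth x i) | i < n].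
Let rho (z : #|chan n|.-tuple R) : #|{: edge n}|.-tuple R := [tuple co z (inl (inl (enum_val k))) | k < _].

Let mmapcl : measurable_fun setT mapcl.
Proof.
by apply: measurable_mktuple => i; apply: (measurableT_comp mcl); exact: measurable_tnth.
Qed.
Let mrho : measurable_fun setT rho.
Proof. by apply: measurable_mktuple => k; exact: measurable_co. Qed.

HB.instance Definition _ := isMeasurableFun.Build _ _ _ _ mapcl mmapcl.

Let mapcl_box (A : 'I_n -> set R) : mapcl @^-1` box A = box (fun i => cl @^-1` A i).
Proof. by apply/seteqP; split => x /= h i; have := h i; rewrite tnth_mktuple. Qed.

Let mcl_pre (A : set R) : measurable A -> measurable (cl @^-1` A).
Proof. by move=> mA; rewrite -[X in measurable X]setTI; exact: mcl. Qed.

Let mapcl_law S : measurable S -> M (mapcl @^-1` S) = M S.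
Proof.
move=> mS; rewrite -[LHS]/(distribution M mapcl S); apply: tuple_prob_law => // A mA.
rewrite -[LHS]/(M (mapcl @^-1` box A)) mapcl_box tuple_prob_box => [|i]; last exact: mcl_pre.
by apply: eq_bigr => i _; exact: cl_law.
Qed.

(** Passage from the space of the interpolation to that of the observations: the signal is clipped,
    and of the channel noises only those of the edges are kept. *)
Let phi (p : n.-tuple R * #|chan n|.-tuple R) := (mapcl p.1, rho p.2).

Let mphi : measurable_fun setT phi.
Proof.
apply/measurable_fun_pair.
  by apply: (measurableT_comp mmapcl); exact: measurable_fst.
by apply: (measurableT_comp mrho); exact: measurable_snd.
Qed.

HB.instance Definition _ := isMeasurableFun.Build _ _ _ _ phi mphi.

Let phi_law S : measurable S -> (M \x gam)%E (phi @^-1` S) = (M \x gE)%E S.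
Proof.
move=> mS; rewrite -[LHS]/(distribution (M \x gam)%E phi S); apply: tuple_prob2_law => //.
  by have := probability_setT (distribution (M \x gam)%E phi); rewrite /= => ->; rewrite ltry.
move=> A B mA mB.
(* The noises of the other channels are unconstrained and contribute factors 1. *)
pose C (c : chan n) : set R := if c is inl (inl e) then B (enum_rank e) else setT.
have mC c : measurable (C c) by case: c => [[e|[]]|i]; rewrite /C.
rewrite -[LHS]/((M \x gam)%E (phi @^-1` (box A `*` box B))).
rewrite (_ : phi @^-1` _ = box (fun i => cl @^-1` A i) `*` box (fun k => C (enum_val k))); last first.
  apply/seteqP; split => -[x z] /= [h1 h2].
    split; first by rewrite -mapcl_box.
    move=> k; case E : (enum_val k) => [[e|u]|i] //=.
    by have := h2 (enum_rank e); rewrite tnth_mktuple enum_rankK /co -E enum_valK.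
  split; first by rewrite -mapcl_box in h1.
  move=> k; rewrite tnth_mktuple; have := h2 (enum_rank (inl (inl (enum_val k)))).
  by rewrite enum_rankK /C enum_valK.
rewrite product_measure1E; [|by apply: measurable_box => i; exact: mcl_pre|exact: measurable_box].
congr (_ * _)%E.
  apply: etrans (tuple_prob_box P0 (fun i => mcl_pre (mA i))) _.
  by apply: eq_bigr => i _; exact: cl_law.
apply: etrans (tuple_prob_box g (fun k => mC (enum_val k))) _.
rewrite eprod_enum [RHS]eprod_enum.
under eq_bigr do rewrite enum_rankK.
rewrite big_sumType/= [X in (_ * X)%E]big1 ?mule1 => [|i _]; last by rewrite probability_setT.
by rewrite big_sumType/= [X in (_ * X)%E]big1 ?mule1// => i _; rewrite probability_setT.
Qed.

Let ovE X x : overlap (tnth (mapcl x)) (tnth (mapcl X)) = ov cl X x.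
Proof. by congr (_ * _); apply: eq_bigr => i _; rewrite !tnth_mktuple. Qed.

(** Substituting the observation splits each edge term into the noise part and the coupling of [x]
    to the planted [X]; the remaining channels have zero coefficient. *)
Let LLR_E X z x : LLR (phi (X, z), mapcl x) = planted (@edge_coef R cl lambda n) X z x.
Proof.
rewrite /planted sum_chan [X in _ + X]big1 => [|i _]; last by rewrite /= mulr0 expr0n/= mul0r subr0.
rewrite [X in _ + X + _]/= mulr0 expr0n/= mul0r subr0 !addr0.
apply: eq_bigr => e _; rewrite /observation /phi/= !tnth_mktuple enum_rankK /spin.
have s2 : Num.sqrt (lambda / n%:R) ^+ 2 = lambda / n%:R.
  by rewrite sqr_sqrtr// divr_ge0 ?ler0n// ltW.
have -> : lambda / (2 * n%:R) = Num.sqrt (lambda / n%:R) ^+ 2 / 2.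
  by rewrite s2 invfM mulrAC -mulrA mulrC mulrAC mulrC.
by field.
Qed.

Lemma posterior_sqdevE X z : posterior_sqdev (phi (X, z)) =
  gibbs M (planted (@edge_coef R cl lambda n) X z) (fun x => sqdev q (ov cl X x)).
Proof.
have mL := meas_sec1 (phi (X, z)) measurable_LLR.
have mD := meas_sec1 (phi (X, z)) measurable_dev.
have mE : measurable_fun setT (fun x => expR (LLR (phi (X, z), x))) by exact: measurableT_comp.
rewrite /posterior_sqdev /posterior_mean /partition_function /gibbs mulrC; congr (_ / _).
  transitivity (\int[M]_x (dev (phi (X, z), x) * expR (LLR (phi (X, z), x)))) => //.
  rewrite (Rint_law (P := M) mmapcl mapcl_law); last exact: measurable_funM.
  by apply: eq_Rintegral => x _; rewrite LLR_E /dev ovE.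
transitivity (\int[M]_x (expR (LLR (phi (X, z), x)))) => //.
rewrite (Rint_law (P := M) mmapcl mapcl_law)//.
by apply: eq_Rintegral => x _; rewrite LLR_E.
Qed.

Lemma expectation_posterior : (0 < n)%N -> (\int[(M \x gE)%E]_p (posterior_sqdev p)%:E)%E =
  (overlap_error P0 g cl lambda q n)%:E.
Proof.
move=> n0.
have mp : measurable_fun setT (fun p => (posterior_sqdev p)%:E).
  by apply/measurable_EFinP; exact: measurable_posterior_sqdev.
rewrite (int_law (P := (M \x gam)%E) mphi phi_law mp).
have bnd X z : `|posterior_sqdev (phi (X, z))| <= ((K ^+ 2) ^+ 2 + q ^+ 2) ^+ 2.
  rewrite posterior_sqdevE; have [me eA] := edge_coef_bmf mcl clK lambda n.
  apply: gibbs_norm_le.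
  - exact: (bmf_planted me eA).
  - split; last by exists (((K ^+ 2) ^+ 2 + q ^+ 2) ^+ 2) => x; apply: sqdev_le; exact: ov_le.
    apply: (measurableT_comp (measurable_sqdev q)).
    exact: (meas_sec1 X (measurable_ov mcl (n := n))).
  - by move=> x; apply: sqdev_le; exact: ov_le.
have mq : measurable_fun setT (fun p => posterior_sqdev (phi p)).
  exact: (measurableT_comp measurable_posterior_sqdev mphi).
have ip : igl (M \x gam)%E (fun p => posterior_sqdev (phi p)).
  by apply: (igl_bound _ mq) => -[X z]; exact: bnd.
rewrite -EFin_Rint//; congr (_%:E).
rewrite (Rint_prod ip) => [|X]; last first.
  by apply: igl_bound => [|z]; [exact: (meas_sec1 X mq)|exact: bnd].
apply: eq_Rintegral => X _; apply: eq_Rintegral => z _; exact: posterior_sqdevE.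
Qed.

End posterior.

(** * Joint law of the signal and the noise *)

Section sampling.
Context (R : realType) (P0 : probability R R) (n : nat).
Context (d : measure_display) (Omega : measurableType d) (P : probability Omega R).
Context (X : 'I_n -> {RV P >-> R}) (Z : edge n -> {RV P >-> R}).
Hypothesis XP0 : forall i, has_law (X i) P0.
Hypothesis Zgauss : forall e, has_law (Z e) (normal_prob 0 1).
Hypothesis indep : mutually_independent (signal_noise X Z).
Local Notation M := (tuple_prob P0 n).
Local Notation gE := (tuple_prob (std_gauss R) #|{: edge n}|).

Definition sample (w : Omega) : n.-tuple R * #|{: edge n}|.-tuple R :=
  ([tuple X i w | i < n], [tuple Z (enum_val k) w | k < #|{: edge n}|]).

Lemma measurable_sample : measurable_fun setT sample.
Proof. by apply/measurable_fun_pair; apply: measurable_mktuple => i; exact: measurable_funPT. Qed.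

HB.instance Definition _ := isMeasurableFun.Build _ _ _ _ sample measurable_sample.

(** Products of boxes are exactly the events of mutual independence taken over all indices, and they
    determine the joint law. *)
Lemma sample_law S : measurable S -> P (sample @^-1` S) = (M \x gE)%E S.
Proof.
move=> mS; rewrite -[LHS]/(distribution P sample S); apply: tuple_prob2_law => //.
  by have := probability_setT (distribution P sample); rewrite /= => ->; rewrite ltry.
move=> A B mA mB.
pose C (k : 'I_n + edge n) : set R := match k with inl i => A i | inr e => B (enum_rank e) end.
have mC k : measurable (C k) by case: k => [i|e]; rewrite /C.
rewrite -[LHS]/(P (sample @^-1` (box A `*` box B))).
rewrite (_ : sample @^-1` _ = [set w | forall k, k \in [set: 'I_n + edge n]%SET -> C k (signal_noise X Z k w)]); last first.
  apply/seteqP; split => w /=.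
    move=> [h1 h2] [i|e] _ /=; first by have := h1 i; rewrite tnth_mktuple.
    by have := h2 (enum_rank e); rewrite tnth_mktuple enum_rankK.
  move=> h; split => [i|k]; rewrite tnth_mktuple.
    by have := h (inl i) (finset.in_setT _).
  by have := h (inr (enum_val k)) (finset.in_setT _); rewrite /= enum_valK.
rewrite indep//.
rewrite (eq_bigl predT) => [|k]; last by rewrite finset.in_setT.
rewrite big_sumType/= [X in (_ * X)%E = _]/=; congr (_ * _)%E.
  by apply: eq_bigr => i _; exact: XP0.
rewrite eprod_enum; apply: eq_bigr => e _; exact: Zgauss.
Qed.

End sampling.

Theorem theorem2 (R : realType) (P0 : probability R R)
    (bounded_supp : bounded_set (measure_support P0))
    (lambda : R) (lambdaD : regular_snr P0 lambda)
    (d : nat -> measure_display)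
    (Omega : forall n, measurableType (d n))
    (P : forall n, probability (Omega n) R)
    (X : forall n, 'I_n -> {RV (P n) >-> R})
    (Z : forall n, edge n -> {RV (P n) >-> R})
    (XP0 : forall n (i : 'I_n), has_law (X n i) P0)
    (Zgauss : forall n (e : edge n), has_law (Z n e) (normal_prob 0 1))
    (indep : forall n, mutually_independent (signal_noise (X n) (Z n))) :
  ('E_(P n)[(fun w =>
     let Xw := fun i => X n i w in
     let Yw := observation lambda Xw (fun e => Z n e w) in
     posterior_mean P0 lambda Yw
       (fun x => (overlap (tnth x) Xw ^+ 2 - q_star P0 lambda ^+ 2) ^+ 2))%R])%E
    @[n --> \oo] --> 0%E.
Proof.
have [l0 dpsi] := lambdaD.
have [K [K0 hK]] : exists K : R, 0 < K /\ forall x, measure_support P0 x -> `|x| <= K.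
  (* Boundedness provides a bound for each real strictly above [M], hence [M + 1]; the maximum with
     1 makes it positive. *)
  have [M [_ hM]] := bounded_supp; exists (Num.max 1 (M + 1)); split.
    by rewrite lt_max ltr01.
  by move=> x; apply: hM; rewrite lt_max ltrDl ltr01 orbT.
pose cl := clip K; pose g := std_gauss R; have hg : gaussian_law g := std_gauss_law R.
have mcl : measurable_fun setT cl := measurable_clip K.
have clK x : `|cl x| <= K := clip_le (ltW K0) x.
have cl_law := clip_law (ltW K0) hK.
have FE := potentialE (ltW K0) mcl clK cl_law.
have [q0 hq] : 0 <= q_star P0 lambda /\
    forall r, 0 <= r -> potential P0 lambda r <= potential P0 lambda (q_star P0 lambda).
  have A0 : 0 <= K * \int[g]_z `|z| by rewrite mulr_ge0 ?(ltW K0)// Rintegral_ge0.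
  have A1 : 0 <= 3 / 2 * K ^+ 2 by rewrite mulr_ge0// sqr_ge0.
  have Gm s t (_ : 0 <= s) (_ : 0 <= t) := gmean_modulus P0 hg (ltW K0) mcl clK s t.
  have [q q0 hq] := exists_max (G := fun s => gmean P0 g cl s s) A0 A1 (gmean0 P0 g cl) Gm FE l0.
  (* Existence of a maximizer suffices to specify [q_star]; uniqueness is used inside
     [perturbed_max]. *)
  rewrite /q_star; apply: (@xgetPex _ 0 [set q | 0 <= q /\ forall r, 0 <= r -> potential P0 lambda r <= potential P0 lambda q]).
  by exists q.
set q := q_star P0 lambda in q0 hq *.
pose u n := overlap_error P0 g cl lambda q n.
have u_cvg : u n @[n --> \oo] --> 0.
  apply/cvgrPdist_le => e e0.
  have [n1 [n10 hn1]] := overlap_error_cvg hg K0 mcl clK l0 FE dpsi q0 hq e0.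
  exists n1 => // n /= n1n; rewrite sub0r normrN ger0_norm; first exact: hn1.
  apply: Rintegral_ge0 => x _; apply: Rintegral_ge0 => z _.
  have [me eA] := edge_coef_bmf mcl clK lambda n.
  by apply: gibbs_ge0 => [|y]; [exact: (bmf_planted me eA)|exact: sqr_ge0].
apply: (@cvg_trans _ ((fun n => (u n)%:E) @ \oo)); last first.
  by apply: cvg_EFin => //; exact: nearW.
apply: near_eq_cvg; exists 1%N => // n /= n0.
rewrite /u -(expectation_posterior q l0 mcl clK cl_law n0) expectation.unlock.
have mp : measurable_fun setT (fun p => (@posterior_sqdev R P0 lambda q n p)%:E).
  by apply/measurable_EFinP; exact: measurable_posterior_sqdev.
rewrite (int_law (measurable_sample (X n) (Z n)) (sample_law (XP0 n) (Zgauss n) (indep n)) mp).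
have E w : posterior_sqdev P0 lambda q (sample (X n) (Z n) w) =
    posterior_mean P0 lambda (observation lambda (fun i => X n i w) (fun e => Z n e w))
      (fun x => (overlap (tnth x) (fun i => X n i w) ^+ 2 - q ^+ 2) ^+ 2).
  rewrite /posterior_sqdev.
  have -> : tnth (sample (X n) (Z n) w).1 = fun i => X n i w by apply/funext => i; rewrite tnth_mktuple.
  have -> // : (fun e => tnth (sample (X n) (Z n) w).2 (enum_rank e)) = fun e => Z n e w.
  by apply/funext => e; rewrite tnth_mktuple enum_rankK.
apply: eq_integral => w _.
by rewrite -E.
Qed.
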